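(* The value function $v$ is the unique viscosity solution of the Hamilton--Jacobi--Bellman equation $$\frac{\partial u}{\partial t}(x,t) + H\big(x,t,\nabla u(x,t)\big) = 0, \qquad (x,t)\in U\times(0,\infty),$$ in the class $\mathcal{V}^t_{\mathrm{loc}}$ which satisfies the initial condition $v(x,0)=v_0(x)$ for all $x\in U$.
   Context: Let $U=\mathbb{R}\times(0,\infty)$ and $Q=U\times(0,\infty)$. Data. $c:[0,\infty)\to\mathbb{R}$ is a fixed continuous function. The function $\eta:[0,\infty)\to\mathbb{R}$ is a fixed realisation of a stochastic integral: in the filtering model $dX_t=\alpha_tX_t\,dt+\sqrt{\beta_t}\,dB_t$, $dY_t=c_tX_t\,dt+dW_t$, $Y_0=0$ (with independent Brownian motions $B,W$), one chooses a version of $\int_0^\cdot c_s\,dY_s$ (independent of the choice of the parameters) all of whose paths are locally H\''older continuous with every exponent strictly less than $1/2$, fixes an outcome $\omega$ and sets $\eta_t=(\int_0^tc_s\,dY_s)(\omega)$. Thus $\eta$ is a fixed deterministic function with $\eta_0=0$ which is locally H\''older continuous with every exponent $<1/2$. Dynamics. For $t\ge0$, $a\in\mathbb{R}$, $b\ge 0$, and $z=(z_1,z_2)\in\mathbb{R}^2$, set $$f(z,t,a,b)=\big(-(z_1+\eta_t)(a+bz_2),\ -bz_2^2-2az_2+c_t^2\big)\ \text{ if } z\in U,\qquad f(z,t,a,b)=\big(-(z_1+\eta_t)a,\ c_t^2\big)\ \text{ if } z\in\mathbb{R}^2\setminus U.$$ $\mathcal{A}$ is the set of measurable, locally bounded functions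 $(\alpha,\beta):[0,\infty)\to\mathbb{R}\times[0,\infty)$ (controls). For $x\in U$, $t\ge0$ and $(\alpha,\beta)\in\mathcal{A}$, $w(\cdot)=w(\cdot\,;x,t,\alpha,\beta)$ is the solution of $\frac{dw}{ds}(s)=f(w(s),s,\alpha_s,\beta_s)$ for $0<s<t$ with terminal condition $w(t)=x$. Running cost. $\gamma:[0,\infty)\times\mathbb{R}\times[0,\infty)\to[0,\infty]$ is continuous (as an extended-real-valued map), finite whenever $b>0$, and there is $p>1$ such that for every $T>0$, $\inf_{0\le t\le T}\frac{\gamma(t,a,b)}{|a|^p+b^p}\to\infty$ as $|a|+b\to\infty$. Moreover $\gamma(t,0,0)<\infty$ for all $t\ge0$. Initial cost. $v_0:\mathbb{R}^2\to\mathbb{R}\cup\{\infty\}$ equals $\infty$ on $\mathbb{R}^2\setminus U$, is finite-valued, bounded below and locally Lipschitz continuous on $U$, $v_0(x)\to\infty$ as $|x|\to\infty$, and $v_0(x_1,x_2)\to\infty$ as $x_2\to0^+$ uniformly in $x_1$. Value function. For $x\in U$, $t\ge0$, $$v(x,t)=\inf_{(\alpha,\beta)\in\mathcal{A}}\Big\{\int_0^t\gamma(s,\alpha_s,\beta_s)\,ds+v_0\big(w(0;x,t,\alpha,\beta)\big)\Big\},$$ where the initial cost is taken to be $\infty$ if the trajectory blows up (backwards in time) before reaching $s=0$. Hamiltonian. $H(x,t,p)=\sup_{(a,b)\in\mathbb{R}\times[0,\infty)}\{f(x,t,a,b)\cdot p-\gamma(t,a,b)\}$. Class $\mathcal{V}^t_{\mathrm{loc}}$: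 real-valued functions $u$ on $U\times[0,\infty)$ which are bounded below and satisfy, for every $T>0$, $\inf_{0\le t\le T}u(x,t)\to\infty$ as $|x|\to\infty$ and $\inf_{x_1\in\mathbb{R},\,0\le t\le T}u(x_1,x_2,t)\to\infty$ as $x_2\to0^+$. Viscosity solutions. Viscosity (sub/super)solutions are always continuous (up to $t=0$, so that initial conditions make sense). $u$ is a viscosity subsolution (resp. supersolution) of $\partial_tu+H(x,t,\nabla u)=0$ if for every $C^1$ function $\varphi$ and every local maximum (resp. minimum) point $(x,t)\in Q$ of $u-\varphi$, $\partial_t\varphi(x,t)+H(x,t,\nabla\varphi(x,t))\le0$ (resp. $\ge0$); a viscosity solution is both. *)

(* Defs.v *)
From HB Require Import structures.
From mathcomp Require Import all_boot all_order all_algebra.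
From mathcomp Require Import all_classical all_reals all_analysis.

Set Implicit Arguments.
Unset Strict Implicit.
Unset Printing Implicit Defensive.

Import Order.TTheory GRing.Theory Num.Theory numFieldNormedType.Exports.
Local Open Scope classical_set_scope.
Local Open Scope ring_scope.

(** Conventions. Points of the plane have type [R * R] and space-time points
    have type [R * R * R]. Functions whose mathematical domain is a proper subset
    (nonnegative times, nonnegative [b], the upper half-plane) are represented by
    total functions, and every hypothesis and conclusion only constrains them on
    that domain. The norm of [R * R] is the max norm; since all norms on the plane
    are equivalent, this affects neither Lipschitz continuity nor limits as
    [`|x|] goes to infinity. *)

Definition halfplane (R : realType) : set (R * R) := [set x | 0 < x.2].

Definition spacetime (R : realType) : set (R * R * R) :=
  [set z | halfplane z.1 /\ 0 < z.2].

Definition spacetime0 (R : realType) : set (R * R * R) :=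
  [set z | halfplane z.1 /\ 0 <= z.2].

Definition locally_holder (R : realType) (h : R) (eta : R -> R) : Prop :=
  forall T : R, 0 < T -> exists C : R,
    forall s t : R, s \in `[0, T] -> t \in `[0, T] ->
      `|eta s - eta t| <= C * `|s - t| `^ h.

(** * Dynamics *)

Definition drift (R : realType) (c eta : R -> R) (z : R * R) (t a b : R) : R * R :=
  if 0 < z.2 then
    (- (z.1 + eta t) * (a + b * z.2), - b * z.2 ^+ 2 - 2 * a * z.2 + c t ^+ 2)
  else
    (- (z.1 + eta t) * a, c t ^+ 2).

Definition controls (R : realType) : set ((R -> R) * (R -> R)) :=
  [set k : (R -> R) * (R -> R) |
    [/\ measurable_fun (`[0, +oo[ : set R) k.1,
        measurable_fun (`[0, +oo[ : set R) k.2,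
        forall s, 0 <= s -> 0 <= k.2 s &
        forall T : R, [bounded k.1 s | s in `[0, T]] /\
                      [bounded k.2 s | s in `[0, T]]]].

(** [w] solves [dw/ds = drift] on [[0, t]] with terminal value [w t = x]. The
    controls being merely measurable, solutions are understood in the sense of
    Caratheodory, i.e. through the integrated equation
    [w s = x - \int_s^t drift (w r) r (alpha r) (beta r) dr]. *)
Definition trajectory (R : realType) (c eta : R -> R) (x : R * R) (t : R)
    (k : (R -> R) * (R -> R)) (w : R -> R * R) : Prop :=
  {within `[0, t], continuous w} /\
  forall s, s \in `[0, t] ->
    w s = (x.1 - \int[lebesgue_measure]_(r in `[s, t])
                    (drift c eta (w r) r (k.1 r) (k.2 r)).1,
           x.2 - \int[lebesgue_measure]_(r in `[s, t])
                    (drift c eta (w r) r (k.1 r) (k.2 r)).2).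

(** The drift is locally Lipschitz in the state, so a trajectory on [[0, t]] is
    unique (on [[0, t]]) if it exists, and the only obstruction to its existence is
    blow-up backwards in time; the initial cost is then infinite. *)
Definition initial_cost (R : realType) (c eta : R -> R) (v0 : R * R -> \bar R)
    (x : R * R) (t : R) (k : (R -> R) * (R -> R)) : \bar R :=
  match pselect (exists w, trajectory c eta x t k w) with
  | left exw => v0 (sval (cid exw) 0)
  | right _ => +oo%E
  end.

Definition cost (R : realType) (c eta : R -> R) (gamma : R -> R -> R -> \bar R)
    (v0 : R * R -> \bar R) (x : R * R) (t : R) (k : (R -> R) * (R -> R)) : \bar R :=
  (\int[lebesgue_measure]_(s in `[0%R, t]) gamma s (k.1 s) (k.2 s)
   + initial_cost c eta v0 x t k)%E.

Definition value (R : realType) (c eta : R -> R) (gamma : R -> R -> R -> \bar R)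
    (v0 : R * R -> \bar R) (x : R * R) (t : R) : \bar R :=
  ereal_inf [set cost c eta gamma v0 x t k | k in @controls R].

(** * Assumptions on the costs *)

Definition running_cost_assumptions (R : realType)
    (gamma : R -> R -> R -> \bar R) : Prop :=
  [/\ {within [set z : R * R * R | 0 <= z.1.1 /\ 0 <= z.2],
        continuous (fun z : R * R * R => gamma z.1.1 z.1.2 z.2)},
      forall t a b : R, 0 <= t -> 0 <= b -> (0 <= gamma t a b)%E,
      forall t a b : R, 0 <= t -> 0 < b -> (gamma t a b < +oo)%E,
      exists2 p : R, 1 < p &
        forall T : R, 0 < T -> forall M : R, exists K : R,
          forall a b : R, 0 <= b -> K <= `|a| + b ->
            (M%:E <= ereal_inf [set gamma t a b / (`|a| `^ p + b `^ p)%:E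
                                | t in `[0%R, T]])%E &
      forall t : R, 0 <= t -> (gamma t 0%R 0%R < +oo)%E].

Definition initial_cost_assumptions (R : realType) (v0 : R * R -> \bar R) : Prop :=
  [/\ forall x, ~ halfplane x -> v0 x = +oo%E,
      forall x, halfplane x -> v0 x \is a fin_num,
      exists m : R, forall x, halfplane x -> (m%:E <= v0 x)%E,
      forall x, halfplane x ->
        exists2 N, nbhs x N &
          [lipschitz (fine (v0 y) : R^o) | y in N `&` @halfplane R] &
      (forall M : R, exists K : R, forall x, K <= `|x| -> (M%:E <= v0 x)%E) /\
      (forall M : R, exists2 d : R, 0 < d &
        forall x1 x2, 0 < x2 < d -> (M%:E <= v0 (x1, x2))%E)].

(** * The Hamilton-Jacobi-Bellman equation *)

Definition dot (R : realType) (x y : R * R) : R := x.1 * y.1 + x.2 * y.2.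

Definition hamiltonian (R : realType) (c eta : R -> R)
    (gamma : R -> R -> R -> \bar R) (x : R * R) (t : R) (p : R * R) : \bar R :=
  ereal_sup [set ((dot (drift c eta x t k.1 k.2) p)%:E - gamma t k.1 k.2)%E
             | k in [set k : R * R | 0 <= k.2]].

Definition dt (R : realType) (phi : R * R * R -> R) (z : R * R * R) : R :=
  'D_(0, 0, 1) phi z.

Definition grad (R : realType) (phi : R * R * R -> R) (z : R * R * R) : R * R :=
  ('D_(1, 0, 0) phi z, 'D_(0, 1, 0) phi z).

Definition C1 (R : realType) (phi : R * R * R -> R) : Prop :=
  (forall z, spacetime z -> differentiable phi z) /\
  (forall h, {within @spacetime R, continuous (fun z => 'D_h phi z)}).

Definition viscosity_subsolution (R : realType)
    (H : R * R -> R -> R * R -> \bar R) (u : R * R * R -> R) : Prop :=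
  {within @spacetime0 R, continuous u} /\
  forall phi, C1 phi -> forall z, spacetime z ->
    (\forall y \near z, u y - phi y <= u z - phi z) ->
    ((dt phi z)%:E + H z.1 z.2 (grad phi z) <= 0)%E.

Definition viscosity_supersolution (R : realType)
    (H : R * R -> R -> R * R -> \bar R) (u : R * R * R -> R) : Prop :=
  {within @spacetime0 R, continuous u} /\
  forall phi, C1 phi -> forall z, spacetime z ->
    (\forall y \near z, u z - phi z <= u y - phi y) ->
    (0 <= (dt phi z)%:E + H z.1 z.2 (grad phi z))%E.

Definition viscosity_solution (R : realType)
    (H : R * R -> R -> R * R -> \bar R) (u : R * R * R -> R) : Prop :=
  viscosity_subsolution H u /\ viscosity_supersolution H u.

Definition class_Vloc (R : realType) (u : R * R * R -> R) : Prop :=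
  (exists m : R, forall z, spacetime0 z -> m <= u z) /\
  forall T : R, 0 < T ->
    (forall M : R, exists K : R, forall x, halfplane x -> K <= `|x| ->
       (M%:E <= ereal_inf [set (u (x, t))%:E | t in `[0%R, T]])%E) /\
    (forall M : R, exists2 d : R, 0 < d & forall x2, 0 < x2 < d ->
       (M%:E <= ereal_inf [set (u (y.1, x2, y.2))%:E
                           | y in [set y : R * R | y.2 \in `[0%R, T]]])%E).

Definition HJB_solution (R : realType) (c eta : R -> R)
    (gamma : R -> R -> R -> \bar R) (v0 : R * R -> \bar R)
    (u : R * R * R -> R) : Prop :=
  [/\ viscosity_solution (hamiltonian c eta gamma) u,
      class_Vloc u &
      forall x, halfplane x -> (u (x, 0))%:E = v0 x].

(* Main.v *)
Require Import Defs.
From HB Require Import structures.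
From mathcomp Require Import all_boot all_order all_algebra.
From mathcomp Require Import all_classical all_reals all_analysis.
From mathcomp Require Import measurable_realfun.
From mathcomp Require Import ring lra.

Set Implicit Arguments.
Unset Strict Implicit.
Unset Printing Implicit Defensive.

Import Order.TTheory GRing.Theory Num.Theory numFieldNormedType.Exports.
Local Open Scope classical_set_scope.
Local Open Scope ring_scope.

(** The value function solves the equation by dynamic programming, and uniqueness
is a comparison principle. The two difficulties are that trajectories may blow
up and that neither the drift nor the running cost is bounded in the control.

Trajectories. The component [w2] solves a Riccati equation driven by the control
and, once [w2] is known, the equation of [w1] is linear. The initial cost being
infinite outside the half-plane, only trajectories that start inside it at time
0 matter, and they remain inside it ([drift_stays_positive]); such a trajectory,
with its control, is called a [flow]. The size of a flow is bounded in terms of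
its position at time 0 and of the effort, the integral of [|a| + b]
([flow_bounds]). No general existence theorem for differential equations is
used: the difference of two solutions of a Riccati equation solves a Bernoulli
equation, so the flow can be moved to a nearby terminal point with the same
control in closed form ([flow_shift]), and the other flows that are needed are
obtained by prescribing [w2] and solving its equation for [a]
([flow_stay], [flow_local]).

The value function. The running cost dominates any multiple of the effort up to
a constant. Hence almost optimal flows have bounded effort and stay in a fixed
compact subset of the half-plane ([near_optimal]), and over short intervals their
effort is small ([effort_small]). Together with the dynamic programming
principle this gives continuity ([value_continuous]) and the growth conditions
([value_class_Vloc]). If the subsolution inequality failed, a short flow with a
continuous control would beat the value ([value_subsolution]); if the
supersolution inequality failed, it would fail for all controls in a
neighbourhood, and no flow could be almost optimal ([value_supersolution]).

Comparison. Let [u] be a subsolution bounded below and [w] a supersolution with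
the growth conditions. The growth of [w] confines maximum points only where [w] is
bounded, so [u], shifted to satisfy [u >= 1], is first replaced by the bounded
function [N u / (u + N)] with [N] large. The result satisfies the same inequality
with the running cost multiplied by the derivative of the transform, a factor
bounded away from 1 ([subsolution_transform]). Doubling the variables with the penalization
[k |x - y|^2 + l (t - s)^2] gives interior maximum points
([doubling_maximum]). For fixed [k], the supersolution inequality is attained, up
to a small error, by controls in a bounded set, on which the data are uniformly
continuous, so that [l -> oo] removes the difference between the times
([doubled_control]). The remaining difference of the drifts is at most a multiple
of [k |x - y|^2 (|a| + b)] ([dot_drift_space]); since [k |x - y|^2] is small at
the maximum points, it is absorbed by the fraction of the running cost that the
transform has gained ([comparison]). *)

(** * Continuity on subsets and on compact sets *)

Section Continuity.
Context {R : realType}.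

Lemma within_continuousP (V W : normedModType R) (A : set V) (f : V -> W) :
  {within A, continuous f} <->
  forall x, A x -> forall e : R, 0 < e -> exists2 d : R, 0 < d &
    forall y, A y -> `|y - x| < d -> `|f y - f x| < e.
Proof.
rewrite subspace_continuousP; split => H x Ax.
- move=> e e0; have /cvgrPdist_lt/(_ e e0) := H x Ax.
  rewrite near_withinE => /nbhs_ballP[d /= d0 dH]; exists d => // y Ay yx.
  by rewrite distrC; apply: dH => //; rewrite -ball_normE /= distrC.
- apply/cvgrPdist_lt => e e0; have [d d0 dH] := H x Ax e e0.
  rewrite near_withinE; apply/nbhs_ballP; exists d => //= y.
  by rewrite -ball_normE /= => yx Ay; rewrite distrC dH// distrC.
Qed.

Lemma compact_uniform (V W : normedModType R) (A : set V) (f : V -> W) :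
  compact A -> {within A, continuous f} -> forall e : R, 0 < e ->
  exists2 d : R, 0 < d &
    forall x y, A x -> A y -> `|y - x| < d -> `|f y - f x| < e.
Proof.
move=> cA /within_continuousP cf e e0.
move/compact_near_coveringP/near_covering_withinP : cA => cA.
have cov : \forall d \near 0^'+, A `<=`
    (fun x => forall y, A y -> `|y - x| < d -> `|f y - f x| < e).
  apply: cA => x Ax.
have [d d0 dH] := cf x Ax (e / 2) (divr_gt0 e0 (ltr0Sn _ 1)).
  exists (ball x (d / 2), [set h | h < d / 2]) => /=.
    split; first by apply: nbhsx_ballx; rewrite divr_gt0.
    by apply: nbhs_right_lt; rewrite divr_gt0.
  move=> [x' h] /= [+ hd] Ax' y Ay yx'; rewrite -ball_normE /= => xx'.
  have yx : `|y - x| < d.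
    rewrite -(subrKA x') (le_lt_trans (ler_normD _ _))// (splitr d) ltrD//.
      exact: lt_trans hd.
    by rewrite distrC.
  have x'x : `|x' - x| < d by rewrite distrC (lt_trans xx')// ltr_pdivrMr// ltr_pMr// ltrDl.
  rewrite -(subrKA (f x)) (le_lt_trans (ler_normD _ _))// (splitr e) ltrD//.
    exact: dH.
  by rewrite distrC dH.
have [d [dK d0]] := @filter_ex _ _ _ _ (filterI cov (nbhs_right_gt 0)).
  exists d => // x y Ax Ay yx.
  exact: dK.
Qed.

Lemma within_mul (V : topologicalType) (A : set V) (f g : V -> R) :
  {within A, continuous f} -> {within A, continuous g} ->
  {within A, continuous (fun r => f r * g r)}.
Proof. by move=> cf cg r; apply: continuousM; [exact: cf|exact: cg]. Qed.

Lemma within_sub (V : topologicalType) (A : set V) (f g : V -> R) :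
  {within A, continuous f} -> {within A, continuous g} ->
  {within A, continuous (fun r => f r - g r)}.
Proof. by move=> cf cg r; apply: continuousB; [exact: cf|exact: cg]. Qed.

Lemma within_add (V : topologicalType) (A : set V) (f g : V -> R) :
  {within A, continuous f} -> {within A, continuous g} ->
  {within A, continuous (fun r => f r + g r)}.
Proof. by move=> cf cg r; apply: continuousD; [exact: cf|exact: cg]. Qed.

Lemma within_cst (V : topologicalType) (A : set V) (k : R) :
  {within A, continuous (fun=> k : R)}.
Proof. by move=> r; exact: cst_continuous. Qed.

End Continuity.

Notation Int g s t := (\int[lebesgue_measure]_(r in `[s, t]) g r).

(** * Integrals of bounded measurable functions *)

Section Tame.
Context {R : realType}.
Implicit Types (s t : R) (g y : R -> R).

Definition tame s t g := measurable_fun `[s, t] g /\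
  exists M : R, forall r, s <= r <= t -> `|g r| <= M.

Lemma tameS s t s' t' g : s <= s' -> t' <= t -> tame s t g -> tame s' t' g.
Proof.
move=> ss tt [mg [M gM]]; split.
  apply: measurable_funS mg => //; apply: subset_itv => //=; rewrite bnd_simp//.
exists M => r /andP[r1 r2]; apply: gM; lra.
Qed.

Lemma tame_eq s t g g' : (forall r, s <= r <= t -> g r = g' r) ->
  tame s t g -> tame s t g'.
Proof.
move=> gg' [mg [M gM]]; split.
  apply: eq_measurable_fun mg => r /set_mem /=; rewrite in_itv /= => rst.
  exact: gg'.
by exists M => r rst; rewrite -gg'// gM.
Qed.

Lemma tame_cst s t (k : R) : tame s t (cst k).
Proof. by split=> //; exists `|k|. Qed.

Lemma tameD s t g h : tame s t g -> tame s t h -> tame s t (fun r => g r + h r).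
Proof.
move=> [mg [M gM]] [mh [N hN]]; split; first exact: measurable_funD.
exists (M + N) => r rst.
by rewrite (le_trans (ler_normD _ _))// lerD ?gM ?hN.
Qed.

Lemma tameM s t g h : tame s t g -> tame s t h -> tame s t (fun r => g r * h r).
Proof.
move=> [mg [M gM]] [mh [N hN]]; split; first exact: measurable_funM.
by exists (M * N) => r rst; rewrite normrM ler_pM ?gM ?hN.
Qed.

Lemma tameN s t g : tame s t g -> tame s t (fun r => - g r).
Proof.
move=> tg; apply: tame_eq (tameM (tame_cst s t (-1)) tg) => r _ /=.
by rewrite mulN1r.
Qed.

Lemma tameB s t g h : tame s t g -> tame s t h -> tame s t (fun r => g r - h r).
Proof. by move=> tg th; apply: tameD => //; apply: tameN. Qed.

Lemma tame_norm s t g : tame s t g -> tame s t (fun r => `|g r|).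
Proof.
move=> [mg [M gM]]; split; first exact: measurableT_comp.
by exists M => r rst; rewrite normr_id gM.
Qed.

Lemma tame_max0 s t g : tame s t g -> tame s t (fun r => Num.max (g r) 0).
Proof.
move=> [mg [M gM]]; split; first exact: measurable_maxr.
exists M => r rst; apply: le_trans (gM _ rst).
rewrite /Num.max; case: ifPn => // _; rewrite normr0; exact: normr_ge0.
Qed.

Lemma tame_cont s t g : {within `[s, t], continuous g} -> tame s t g.
Proof.
move=> cg; split; first by apply: subspace_continuous_measurable_fun.
have /compact_bounded[M [_ gM]] := continuous_compact cg (segment_compact (a:=s) (b:=t)).
exists (M + 1) => r rst; apply: (gM (M + 1)); first by rewrite ltrDl.
by exists r => //=; rewrite in_itv.
Qed.

Lemma tame_integrable s t g : tame s t g ->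
  lebesgue_measure.-integrable `[s, t] (EFin \o g).
Proof.
move=> [mg [M gM]]; apply: measurable_bounded_integrable => //.
  apply: le_lt_trans (ltry (`|t - s|)); have := @lebesgue_measure_itv R `[s, t].
  rewrite /= => ->; case: ifP => // _; rewrite -EFinB lee_fin; exact: ler_norm.
exists M; split; first exact: num_real.
move=> x Mx r /=; rewrite in_itv /= => rst; apply: le_trans (ltW Mx).
exact: gM.
Qed.

Lemma IntD s t g h : tame s t g -> tame s t h ->
  Int (fun r => g r + h r) s t = Int g s t + Int h s t.
Proof. by move=> tg th; rewrite RintegralD//; exact: tame_integrable. Qed.

Lemma IntZ s t (k : R) g : tame s t g -> Int (fun r => k * g r) s t = k * Int g s t.
Proof. by move=> tg; rewrite RintegralZl//; exact: tame_integrable. Qed.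

Lemma Int_eq s t g h : (forall r, s <= r <= t -> g r = h r) -> Int g s t = Int h s t.
Proof.
move=> gh; apply: eq_Rintegral => r /set_mem /=; rewrite in_itv /=; exact: gh.
Qed.

Lemma Int_le s t g h : tame s t g -> tame s t h ->
  (forall r, s <= r <= t -> g r <= h r) -> Int g s t <= Int h s t.
Proof.
move=> tg th gh; apply: le_Rintegral => //; try exact: tame_integrable.
Qed.

Lemma Int_cst s t (k : R) : s <= t -> Int (cst k) s t = k * (t - s).
Proof.
move=> st; rewrite Rintegral_cst//; have := @lebesgue_measure_itv R `[s, t].
rewrite /= lte_fin => ->.
move: st; rewrite le_eqVlt => /orP[/eqP->|->]; first by rewrite ltxx subrr.
by [].
Qed.

Lemma Int_refl s g : Int g s s = 0.
Proof. by rewrite set_itv1 Rintegral_set1. Qed.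

Lemma Int_cat s u t g : s <= u -> u <= t -> tame s t g ->
  Int g s t = Int g s u + Int g u t.
Proof.
move=> su ut tg.
have := @Rintegral_itvB R g (BLeft s) (BRight t) u (tame_integrable tg).
rewrite !bnd_simp => /(_ su ut) /eqP; rewrite subr_eq addrC => /eqP ->.
congr (_ + _); apply: Rintegral_itv_obnd_cbnd.
apply: integrableS (tame_integrable tg) => //; apply: subset_itv => //=.
Qed.

Lemma Int_abs s t g : tame s t g -> `|Int g s t| <= Int (fun r => `|g r|) s t.
Proof. by move=> tg; apply: le_normr_Rintegral => //; exact: tame_integrable. Qed.

Lemma Int_bound s t g (M : R) : s <= t -> tame s t g ->
  (forall r, s <= r <= t -> `|g r| <= M) -> `|Int g s t| <= M * (t - s).
Proof.
move=> st tg gM; apply: le_trans (Int_abs tg) _.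
rewrite -Int_cst//; apply: Int_le => //; [exact: tame_norm|exact: tame_cst].
Qed.

Lemma tame_bound (T : R) (g : R -> R) : tame 0 T g ->
  exists2 M, 0 <= M & forall r, 0 <= r <= T -> `|g r| <= M.
Proof.
move=> [_ [M gM]]; exists `|M| => // r rT; exact: le_trans (gM _ rT) (ler_norm _).
Qed.

End Tame.

(** * Calculus of primitives *)

Section Primitives.
Context {R : realType}.
Implicit Types (s t : R) (g h y z F : R -> R).

(** Integrands are merely measurable, so primitives need not be differentiable.
    The rules below compare a candidate primitive with the integral: the
    increments of the difference are of smaller order than the step, hence its
    derivative exists and vanishes. *)
Lemma flat_constant s t F : s <= t ->
  (forall r, s <= r <= t -> forall e : R, 0 < e -> exists2 d : R, 0 < d &
     forall r', s <= r' <= t -> `|r' - r| < d -> `|F r' - F r| <= e * `|r' - r|) ->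
  F t = F s.
Proof.
move=> st flat.
have drv r : r \in `]s, t[ -> is_derive r 1 F (cst 0 r).
  rewrite in_itv /= => /andP[sr rt].
  have lim : h^-1 *: (F (h *: 1 + r) - F r) @[h --> 0^'] --> (0 : R).
    apply/cvgrPdist_le => e e0.
    have [|d d0 dF] := flat r _ e e0; first by rewrite !ltW.
    have m0 : 0 < Num.min d (Num.min (r - s) (t - r)).
      by rewrite !lt_min d0 !subr_gt0 sr rt.
    apply/nbhs_ballP; exists (Num.min d (Num.min (r - s) (t - r))) => //= x.
    rewrite -ball_normE /= sub0r normrN !lt_min => /andP[xd /andP[xs xt]] x0.
    have [E1 E2] : s <= x *: 1 + r <= t /\ `|x *: 1 + r - r| = `|x|.
      rewrite [x *: 1]mulr1 addrK; split => //.
      by move: xs xt; rewrite !ltr_norml; lra.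
    have := dF _ E1; rewrite E2 => /(_ xd) H.
    rewrite sub0r normrN normrM normfV ler_pdivrMl ?normr_gt0//.
    by rewrite [_ * e]mulrC.
  split; first by apply/cvg_ex; exists 0.
  exact: cvg_lim.
have cF : {within `[s, t], continuous F}.
  apply/within_continuousP => r; rewrite /= in_itv /= => rst e e0.
  have [d d0 dF] := flat r rst 1 ltr01.
  exists (Num.min d e); first by rewrite lt_min d0.
  move=> r'; rewrite /= in_itv /= lt_min => r'st /andP[r'd r'e].
  by have := dF _ r'st r'd; rewrite mul1r => /le_lt_trans; apply.
have [c _] := MVT_segment st drv cF.
by rewrite /= mul0r => /eqP; rewrite subr_eq0 => /eqP.
Qed.

(** Solutions in the sense of Caratheodory: [y' = g] in integrated form. *)
Definition prim s t y g := tame s t g /\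
  forall r r', s <= r -> r <= r' -> r' <= t -> y r' - y r = Int g r r'.

Lemma primS s t s' t' y g : s <= s' -> t' <= t -> prim s t y g -> prim s' t' y g.
Proof.
move=> ss tt [tg yg]; split; first exact: tameS tg.
move=> r r' sr rr' r't; apply: yg => //; lra.
Qed.

Lemma prim_eq s t y y' g g' : (forall r, s <= r <= t -> y r = y' r) ->
  (forall r, s <= r <= t -> g r = g' r) -> prim s t y g -> prim s t y' g'.
Proof.
move=> yy gg [tg yg]; split; first exact: tame_eq tg.
move=> r r' sr rr' r't; rewrite -!yy; [|lra|lra].
by rewrite yg//; apply: Int_eq => q qr; apply: gg; lra.
Qed.

Lemma prim_lip s t y g : prim s t y g -> exists2 L : R, 0 <= L &
  forall r r', s <= r <= t -> s <= r' <= t -> `|y r' - y r| <= L * `|r' - r|.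
Proof.
move=> [tg yg]; case: (tg) => mg [M gM]; exists `|M| => //.
have H r r' : s <= r -> r <= r' -> r' <= t -> `|y r' - y r| <= `|M| * `|r' - r|.
  move=> sr rr' r't; rewrite yg// [`|r' - r|]ger0_norm ?subr_ge0//.
  apply: Int_bound => //; first exact: tameS tg.
  move=> q qr; apply: le_trans (ler_norm M); apply: gM; lra.
move=> r r' rst r'st; case: (leP r r') => [rr'|/ltW rr'].
  by apply: H; lra.
by rewrite distrC [`|r' - r|]distrC; apply: H; lra.
Qed.

Lemma prim_within_continuous s t y g : prim s t y g -> {within `[s, t], continuous y}.
Proof.
move=> /prim_lip[L L0 yL]; apply/within_continuousP => r; rewrite /= in_itv /= => rst e e0.
exists (e / (L + 1)); first by apply: divr_gt0 => //; lra.
move=> r'; rewrite /= in_itv /= => r'st; rewrite ltr_pdivlMr; last lra.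
move=> H; apply: le_lt_trans (yL _ _ rst r'st) _; apply: le_lt_trans H.
rewrite mulrC ler_wpM2l//; lra.
Qed.

Lemma prim_tame s t y g : prim s t y g -> tame s t y.
Proof. by move=> /prim_within_continuous; exact: tame_cont. Qed.

(** Only short intervals with [r] as an endpoint have to be considered, so that
    coefficients can be frozen at [r]. *)
Lemma prim_flat s t y g : tame s t g ->
  (forall r, s <= r <= t -> forall e : R, 0 < e -> exists2 d : R, 0 < d &
     forall r1 r2, s <= r1 -> r1 <= r2 -> r2 <= t -> r1 = r \/ r2 = r ->
       r2 - r1 < d -> `|y r2 - y r1 - Int g r1 r2| <= e * (r2 - r1)) ->
  prim s t y g.
Proof.
move=> tg H; split => // a b sa ab bt.
have tgab : tame a b g by apply: tameS tg.
have : (y b - Int g a b) = (y a - Int g a a).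
  apply: (@flat_constant a b (fun r => y r - Int g a r)) => // r rab e e0.
  have [|d d0 dH] := H r _ e e0; first lra.
  exists d => // r' r'ab r'r.
  have [rr'|/ltW rr'] := leP r r'.
    have -> : Int g a r' = Int g a r + Int g r r'.
      by apply: Int_cat; [lra|lra|apply: tameS tgab; lra].
    rewrite (_ : _ - _ = y r' - y r - Int g r r'); last by ring.
    rewrite [`|r' - r|]ger0_norm ?subr_ge0//; apply: dH => //; [lra|lra|by left|].
    by move: r'r; rewrite ger0_norm ?subr_ge0.
  have -> : Int g a r = Int g a r' + Int g r' r.
    by apply: Int_cat; [lra|lra|apply: tameS tgab; lra].
  rewrite (_ : _ - _ = - (y r - y r' - Int g r' r)); last by ring.
  rewrite normrN [`|r' - r|]distrC [`|r - r'|]ger0_norm ?subr_ge0//.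
  apply: dH => //; [lra|lra|by right|].
  by move: r'r; rewrite distrC ger0_norm ?subr_ge0.
rewrite Int_refl; lra.
Qed.

Lemma prim_quadratic s t y g (C : R) : tame s t g ->
  (forall r1 r2, s <= r1 -> r1 <= r2 -> r2 <= t ->
     `|y r2 - y r1 - Int g r1 r2| <= C * (r2 - r1) ^+ 2) ->
  prim s t y g.
Proof.
move=> tg H; apply: prim_flat => // r rst e e0.
have C0 : 0 < `|C| + 1 by rewrite ltr_pwDr.
exists (e / (`|C| + 1)); first exact: divr_gt0.
move=> r1 r2 sr1 r12 r2t _; rewrite ltr_pdivlMr// => He.
apply: le_trans (H _ _ sr1 r12 r2t) _; rewrite expr2 mulrA ler_wpM2r//; first lra.
apply: le_trans (ltW He); rewrite mulrC ler_wpM2l//; first lra.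
by rewrite ler_wpDr// ler_norm.
Qed.

Lemma prim_cst s t (k : R) : prim s t (cst k) (cst 0).
Proof.
by split=> [|r r' sr rr' _]; [exact: tame_cst|rewrite Int_cst//= subrr mul0r].
Qed.

Lemma prim_id s t : prim s t id (cst 1).
Proof.
by split=> [|r r' sr rr' _]; [exact: tame_cst|rewrite Int_cst//= mul1r].
Qed.

Lemma primD s t y g z h : prim s t y g -> prim s t z h ->
  prim s t (fun r => y r + z r) (fun r => g r + h r).
Proof.
move=> [tg yg] [th zh]; split; first exact: tameD.
move=> r r' sr rr' r't; rewrite IntD; [|exact: tameS tg|exact: tameS th].
by rewrite -yg// -zh//; ring.
Qed.

Lemma primZ s t (k : R) y g : prim s t y g ->
  prim s t (fun r => k * y r) (fun r => k * g r).
Proof.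
move=> [tg yg]; split; first by apply: tameM => //; exact: tame_cst.
move=> r r' sr rr' r't; rewrite IntZ; last exact: tameS tg.
by rewrite -yg//; ring.
Qed.

Lemma primN s t y g : prim s t y g -> prim s t (fun r => - y r) (fun r => - g r).
Proof.
move=> /(primZ (-1)); apply: prim_eq => r _; exact: mulN1r.
Qed.

Lemma primB s t y g z h : prim s t y g -> prim s t z h ->
  prim s t (fun r => y r - z r) (fun r => g r - h r).
Proof. by move=> yg /primN; exact: primD. Qed.

(** The two quadratic Taylor bounds on the range [P] of [y] replace
    differentiability, so that [phi] may be the square of the positive part, whose
    derivative is only Lipschitz. *)
Lemma prim_comp s t y g (phi dphi : R -> R) (P : R -> Prop) (C : R) :
  prim s t y g -> (forall r, s <= r <= t -> P (y r)) ->
  (forall u v, P u -> P v -> `|phi v - phi u - dphi u * (v - u)| <= C * (v - u) ^+ 2) ->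
  (forall u v, P u -> P v -> `|dphi v - dphi u| <= C * `|v - u|) ->
  prim s t (phi \o y) (fun r => dphi (y r) * g r).
Proof.
move=> pyg Py H1 H2; have [tg yg] := pyg; have [mg [M gM]] := tg.
have [L L0 yL] := prim_lip pyg.
have tdy : tame s t (dphi \o y).
  apply: tame_cont; apply/within_continuousP => r; rewrite /= in_itv /= => rst e e0.
  have C0 : 0 < `|C| * L + 1 by rewrite ltr_wpDl// mulr_ge0.
  exists (e / (`|C| * L + 1)); first exact: divr_gt0.
  move=> r'; rewrite /= in_itv /= => r'st; rewrite ltr_pdivlMr// => He.
  apply: le_lt_trans He; apply: le_trans (H2 _ _ (Py _ rst) (Py _ r'st)) _.
  apply: (@le_trans _ _ (`|C| * `|y r' - y r|)); first by rewrite ler_wpM2r ?ler_norm.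
  apply: (@le_trans _ _ (`|C| * (L * `|r' - r|))); first by rewrite ler_wpM2l// yL.
  rewrite mulrA [X in _ <= X]mulrC ler_wpM2r//; lra.
have tdg : tame s t (fun r => dphi (y r) * g r) by apply: tameM.
apply: (@prim_quadratic _ _ _ _ (`|C| * L ^+ 2 + `|C| * L * `|M|)) => // r1 r2 sr1 r12 r2t.
have r1st : s <= r1 <= t by lra.
have r2st : s <= r2 <= t by lra.
have tg12 : tame r1 r2 g by apply: tameS tg.
have tdg12 : tame r1 r2 (fun r => dphi (y r) * g r) by apply: tameS tdg.
rewrite (_ : _ - _ = (phi (y r2) - phi (y r1) - dphi (y r1) * (y r2 - y r1)) -
  Int (fun r => dphi (y r) * g r + (- dphi (y r1)) * g r) r1 r2); last first.
  rewrite IntD//; last by apply: tameM => //; exact: tame_cst.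
  by rewrite IntZ// -yg//=; ring.
rewrite mulrDl; apply: le_trans (ler_normB _ _) _; apply: lerD.
  apply: le_trans (H1 _ _ (Py _ r1st) (Py _ r2st)) _.
  rewrite -mulrA -exprMn; apply: (@le_trans _ _ (`|C| * (y r2 - y r1) ^+ 2)).
    by rewrite ler_wpM2r// ?sqr_ge0 ?ler_norm.
  rewrite ler_wpM2l// -(real_normK (num_real (y r2 - y r1))) lerXn2r ?nnegrE//.
    by rewrite mulr_ge0//; lra.
  by have := yL _ _ r1st r2st; rewrite [`|r2 - r1|]ger0_norm//; lra.
rewrite expr2 mulrA; apply: Int_bound => //.
  by apply: tameD => //; apply: tameM => //; exact: tame_cst.
move=> r rr; rewrite -mulrDl normrM mulrAC; apply: ler_pM => //; last first.
  by apply: le_trans (gM _ _) (ler_norm M); lra.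
have rst : s <= r <= t by lra.
apply: le_trans (H2 _ _ (Py _ r1st) (Py _ rst)) _; rewrite -mulrA.
apply: (@le_trans _ _ (`|C| * `|y r - y r1|)); first by rewrite ler_wpM2r ?ler_norm.
rewrite ler_wpM2l//; apply: le_trans (yL _ _ r1st rst) _.
by rewrite ler_wpM2l// ger0_norm; lra.
Qed.

Lemma prim_sqr s t y g : prim s t y g ->
  prim s t (fun r => y r ^+ 2) (fun r => (2 * y r) * g r).
Proof.
move=> yg; apply: (@prim_comp s t y g (fun x => x ^+ 2) (fun x => 2 * x)
  (fun=> True) 2) => // u v _ _.
- rewrite (_ : _ - _ = (v - u) ^+ 2); last by ring.
  by rewrite normrX real_normK ?num_real// ler_peMl ?sqr_ge0//; lra.
- by rewrite -mulrBr normrM gtr0_norm.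
Qed.

Lemma prim_pospart_sqr s t y g : prim s t y g ->
  prim s t (fun r => Num.max (y r) 0 ^+ 2) (fun r => (2 * Num.max (y r) 0) * g r).
Proof.
move=> yg; apply: (@prim_comp s t y g (fun x => Num.max x 0 ^+ 2)
  (fun x => 2 * Num.max x 0) (fun=> True) 2) => // u v _ _.
- have := sqr_ge0 (v - u); rewrite !expr2 ler_norml => ?.
  by case: (leP v 0) => ?; case: (leP u 0) => ?; apply/andP; split; nra.
- rewrite ler_norml; case: (leP v 0) => ?; case: (leP u 0) => ?;
  case: (ler0P (v - u)) => ?; apply/andP; split; lra.
Qed.

(** Polarization of the rule for squares. *)
Lemma primM s t y g z h : prim s t y g -> prim s t z h ->
  prim s t (fun r => y r * z r) (fun r => g r * z r + y r * h r).
Proof.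
move=> yg zh.
have := primZ (1/4) (primB (prim_sqr (primD yg zh)) (prim_sqr (primB yg zh))).
apply: prim_eq => r _; lra.
Qed.

Lemma prim_exp s t y g : prim s t y g ->
  prim s t (fun r => expR (y r)) (fun r => expR (y r) * g r).
Proof.
move=> yg; have [_ [M yM]] := prim_tame yg.
have lip u v : `|u| <= M -> `|v| <= M -> `|expR v - expR u| <= expR M * `|v - u|.
  wlog uv : u v / u <= v.
    move=> H; case: (leP u v) => [|/ltW] uv uM vM; first exact: H.
    by rewrite distrC [`|v - u|]distrC; exact: H.
  move=> uM vM; have [|c cuv ->] := @MVT_segment R expR expR u v uv.
    by apply: continuous_subspaceT => x; exact: continuous_expR.
  rewrite normrM ler_wpM2r// ger0_norm ?expR_ge0// ler_expR.
  move: cuv vM; rewrite in_itv /= ler_norml; lra.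
apply: (@prim_comp s t y g _ expR (fun x => `|x| <= M) (expR M)) => // u v uM vM.
wlog : u v uM vM / exists2 c, `|c| <= M & `|c - u| <= `|v - u| /\ expR v - expR u = expR c * (v - u).
  apply => //; case: (leP u v) => [uv|/ltW uv].
    have [|c cuv E] := @MVT_segment R expR expR u v uv.
        by apply: continuous_subspaceT => x; exact: continuous_expR.
    move: cuv uM vM; rewrite in_itv /= !ler_norml => cuv uM vM.
    exists c; first by rewrite ler_norml; lra.
    by split=> //; rewrite !ger0_norm; lra.
  have [|c cuv E] := @MVT_segment R expR expR v u uv.
    by apply: continuous_subspaceT => x; exact: continuous_expR.
  move: cuv uM vM; rewrite in_itv /= !ler_norml => cuv uM vM.
  exists c; first by rewrite ler_norml; lra.
  by split=> //; [rewrite !ler0_norm; lra|lra].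
move=> [c cM [cu ->]]; rewrite -mulrBl normrM -[(v - u) ^+ 2]real_normK ?num_real// expr2 mulrA.
rewrite ler_wpM2r//; apply: le_trans (lip _ _ uM cM) _.
by rewrite ler_wpM2l ?expR_ge0.
Qed.

Lemma prim_inv s t y g (k : R) : 0 < k -> (forall r, s <= r <= t -> k <= y r) ->
  prim s t y g -> prim s t (fun r => (y r)^-1) (fun r => - ((y r)^-1 ^+ 2) * g r).
Proof.
move=> k0 yk yg.
have k1 : 0 < k^-1 by rewrite invr_gt0.
have inv_le x : k <= x -> 0 <= x^-1 <= k^-1.
  by move=> kx; rewrite invr_ge0 lef_pV2 ?posrE; lra.
apply: (@prim_comp s t y g _ (fun x => - (x^-1 ^+ 2)) (fun x => k <= x)
   (k^-1 ^+ 3 *+ 2)) => // u v ku kv.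
- have [u0 v0] : 0 < u /\ 0 < v by lra.
  rewrite (_ : _ - _ = (u^-1 ^+ 2 * v^-1) * (v - u) ^+ 2); last by field; lra.
  have /andP[u1 u2] := inv_le _ ku; have /andP[v1 v2] := inv_le _ kv.
  rewrite normrM [`|(v - u) ^+ 2|]ger0_norm ?sqr_ge0// ler_wpM2r ?sqr_ge0//.
  rewrite ger0_norm; last by rewrite mulr_ge0// sqr_ge0.
  apply: (@le_trans _ _ (k^-1 ^+ 3)); last by rewrite mulr2n lerDl exprn_ge0// ltW.
  rewrite (exprSr k^-1 2) ler_pM ?sqr_ge0//.
  by rewrite !expr2 ler_pM.
- have [u0 v0] : 0 < u /\ 0 < v by lra.
  rewrite (_ : _ - _ = (u^-1 * v^-1 * (u^-1 + v^-1)) * (v - u)); last by field; lra.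
  have /andP[u1 u2] := inv_le _ ku; have /andP[v1 v2] := inv_le _ kv.
  rewrite normrM ler_wpM2r// ger0_norm; last by rewrite mulr_ge0 ?addr_ge0 ?mulr_ge0.
  rewrite (_ : k^-1 ^+ 3 *+ 2 = k^-1 * k^-1 * (k^-1 + k^-1)); last by ring.
  apply: ler_pM; [exact: mulr_ge0|exact: addr_ge0|exact: ler_pM|exact: lerD].
Qed.

Lemma prim_Int_left s t g : tame s t g -> prim s t (fun r => Int g s r) g.
Proof.
move=> tg; split=> // r r' sr rr' r't.
rewrite (@Int_cat _ s r r')//; last exact: tameS tg.
by rewrite addrAC subrr add0r.
Qed.

Lemma prim_Int_right s t g : tame s t g ->
  prim s t (fun r => Int g r t) (fun r => - g r).
Proof.
move=> tg; apply: prim_eq (primB (prim_cst s t (Int g s t)) (prim_Int_left tg)) => r rst /=.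
  rewrite (@Int_cat _ s r t)//; [ring|lra|lra].
by rewrite sub0r.
Qed.

Lemma prim_ndecr s t y g : s <= t -> prim s t y g ->
  (forall r, s <= r <= t -> 0 <= g r) -> y s <= y t.
Proof.
move=> st [tg yg] g0; rewrite -subr_ge0 yg//.
by apply: Rintegral_ge0 => r; rewrite /= in_itv; exact: g0.
Qed.

Lemma prim_growth (s t : R) (y g h : R -> R) (r : R) : prim s t y g -> tame s t h -> s <= r <= t ->
  (forall q, s <= q <= t -> g q <= h q) -> y r <= y s + Int h s r.
Proof.
move=> [tg yg] th /andP[sr rt] gh; rewrite addrC -lerBlDr yg//.
apply: Int_le => [||q qr]; [exact: tameS tg|exact: tameS th|].
by apply: gh; clear -qr rt; lra.
Qed.

End Primitives.

(** * Linear and Bernoulli equations, backwards in time *)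

Section BackwardEquations.
Context {R : realType}.
Implicit Types (s t : R) (g h y z F : R -> R).

Lemma Int_norm_le s t r r' g : s <= r -> r <= r' -> r' <= t -> tame s t g ->
  `|Int g r r'| <= Int (fun q => `|g q|) s t.
Proof.
move=> sr rr' r't tg; have tn := tame_norm tg.
apply: le_trans (Int_abs _) _; first exact: tameS tg.
have ge0 a b : s <= a -> b <= t -> 0 <= Int (fun q => `|g q|) a b.
  by move=> *; apply: Rintegral_ge0.
rewrite (@Int_cat _ s r t)//; last lra.
rewrite (@Int_cat _ r r' t)//; last by apply: tameS tn.
rewrite addrCA lerDl addr_ge0 ?ge0//; lra.
Qed.

(** Variation of constants, with the exponential of the integral of [g] over
    [[r, t]] as integrating factor. *)
Lemma linear_backward s t g h (x : R) : s <= t -> tame s t g -> tame s t h ->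
  let A := Int (fun r => `|g r|) s t in
  exists y, [/\ prim s t y (fun r => - g r * y r - h r), y t = x &
    forall r, s <= r <= t ->
      `|y r| <= expR A * (`|x| + expR A * Int (fun r => `|h r|) s t)].
Proof.
move=> st tg th A.
pose G r := Int g r t; have pG : prim s t G (fun r => - g r) := prim_Int_right tg.
have GA r : s <= r <= t -> `|G r| <= A by move=> ?; apply: Int_norm_le => //; lra.
pose E r := expR (G r).
have pE : prim s t E (fun r => E r * - g r) := prim_exp pG.
pose F r := expR (- G r).
have tF : tame s t F := prim_tame (prim_exp (primN pG)).
have thF : tame s t (fun r => h r * F r) by apply: tameM.
pose K r := x + Int (fun r => h r * F r) r t.
have pK : prim s t K (fun r => 0 + - (h r * F r)).
  by apply: primD; [exact: prim_cst|exact: prim_Int_right].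
have expA u : `|u| <= A -> expR u <= expR A.
  by move=> uA; rewrite ler_expR (le_trans (ler_norm u)).
exists (fun r => E r * K r); split.
- apply: prim_eq (primM pE pK) => // r _; rewrite /F /E expRN.
  have := expR_gt0 (G r) => G0; field; lra.
- by rewrite /E /K /G !Int_refl expR0 addr0 mul1r.
- move=> r rst; rewrite normrM; apply: ler_pM => //.
    by rewrite ger0_norm ?expR_ge0// expA// GA.
  apply: le_trans (ler_normD _ _) _; rewrite lerD2l.
  apply: le_trans (Int_norm_le (s:=s) (t:=t) _ _ _ _) _ => //; [lra|lra|].
  rewrite -IntZ; last exact: tame_norm.
  apply: Int_le; [exact: tame_norm|by apply: tameM; [exact: tame_cst|exact: tame_norm]|].
  move=> q qst; rewrite normrM mulrC ler_wpM2r//.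
  by rewrite ger0_norm ?expR_ge0// expA// normrN GA.
Qed.

(** The solution is [d E / (1 - d B)], where [E] solves the linear equation
    [E' = - g E], [E t = 1], and [B r] is the integral of [b E] over [[r, t]]; the
    smallness of [d] keeps the denominator above [1 / 2], that is, excludes
    blow-up. *)
Lemma bernoulli_backward s t g b (d : R) : s <= t -> tame s t g -> tame s t b ->
  let E := expR (Int (fun r => `|g r|) s t) in
  `|d| * (E * Int (fun r => `|b r|) s t) <= 1 / 2 ->
  exists y, [/\ prim s t y (fun r => - g r * y r - b r * y r ^+ 2), y t = d &
    forall r, s <= r <= t -> `|y r| <= 2 * `|d| * E].
Proof.
move=> st tg tb M dM.
have M0 : 0 < M := expR_gt0 _.
have [E [pE Et EM]] := linear_backward 1 st tg (tame_cst s t 0).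
have {}EM r : s <= r <= t -> `|E r| <= M.
  move=> /EM /le_trans; apply.
  have -> : Int (fun q => `|@cst R R 0 q|) s t = 0.
    by apply: etrans (etrans (Int_cst 0 st) (mul0r _)); apply: Int_eq => q _; exact: normr0.
  by rewrite -/M normr1 mulr0 addr0 mulr1.
have tE := prim_tame pE; have tbE : tame s t (fun r => b r * E r) by apply: tameM.
pose D r := 1 - d * Int (fun r => b r * E r) r t.
have pD : prim s t D (fun r => 0 - d * - (b r * E r)).
  by apply: primB; [exact: prim_cst|apply: primZ; exact: prim_Int_right].
have D2 r : s <= r <= t -> 1 / 2 <= D r.
  move=> rst; rewrite /D.
  suff : `|d * Int (fun r => b r * E r) r t| <= 1 / 2 by rewrite ler_norml; lra.
  rewrite normrM; apply: le_trans dM; rewrite ler_wpM2l//.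
  apply: le_trans (Int_norm_le (s:=s) (t:=t) _ _ _ _) _ => //; [lra|lra|].
  rewrite -IntZ; last exact: tame_norm.
  apply: Int_le; [exact: tame_norm|by apply: tameM; [exact: tame_cst|exact: tame_norm]|].
  by move=> q qst; rewrite normrM mulrC ler_wpM2r// EM.
have pV : prim s t (fun r => (D r)^-1) _ := prim_inv (divr_gt0 ltr01 (ltr0Sn _ 1)) D2 pD.
exists (fun r => d * (E r * (D r)^-1)); split.
- apply: prim_eq (primZ d (primM pE pV)) => // r rst; have := D2 _ rst => ?.
  by rewrite /cst; field; lra.
- by rewrite Et /D Int_refl mulr0 subr0 invr1 mul1r mulr1.
- move=> r rst; have Dr := D2 _ rst; rewrite !normrM (_ : 2 * _ * M = `|d| * (M * 2)); last by ring.
  rewrite ler_wpM2l// ler_pM ?EM// ger0_norm ?invr_ge0; last lra.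
  rewrite (_ : 2 = (1 / 2)^-1); last by field.
  rewrite lef_pV2 ?posrE//; lra.
Qed.

End BackwardEquations.

(** * Chain rule along a curve *)

Section Chain.
Context {R : realType}.
Implicit Types (s t : R) (g : R -> R).

Lemma norm_lt_pair (a b d : R) : (`|(a, b) : R * R| < d) = (`|a| < d) && (`|b| < d).
Proof. by rewrite prod_normE /= gt_max. Qed.

Lemma norm_lt_triple (x : R * R * R) (d : R) :
  (`|x| < d) = [&& `|x.1.1| < d, `|x.1.2| < d & `|x.2| < d].
Proof. by rewrite !prod_normE /= !gt_max andbA. Qed.

Lemma norm_le_triple (x : R * R * R) (d : R) :
  (`|x| <= d) = [&& `|x.1.1| <= d, `|x.1.2| <= d & `|x.2| <= d].
Proof. by rewrite !prod_normE /= !ge_max andbA. Qed.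

Lemma within_coords (A : set (R * R * R)) :
  [/\ {within A, continuous (fun z : R * R * R => z.1.1)},
      {within A, continuous (fun z : R * R * R => z.1.2)} &
      {within A, continuous (fun z : R * R * R => z.2)}].
Proof.
by split; apply/within_continuousP => x xA e e0; exists e => // y yA;
  rewrite norm_lt_triple => /and3P[].
Qed.

Lemma differentiable_locally (phi : R * R * R -> R) (z : R * R * R) : differentiable phi z ->
  forall e : R, 0 < e -> exists2 d : R, 0 < d & forall z' : R * R * R, `|z' - z| < d ->
   `|phi z' - phi z - ((grad phi z).1 * (z' - z).1.1 + (grad phi z).2 * (z' - z).1.2
       + dt phi z * (z' - z).2)| <= e * `|z' - z|.
Proof.
move=> dphi e e0; have [_ /eqaddoP] := (diff_locallyP _ _).1 dphi.
move=> /(_ e e0) /nbhs_ballP[d /= d0 dH]; exists d => // z' zz'.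
have H : ball (0 : R * R * R) d (z' - z) by rewrite -ball_normE /= sub0r normrN.
move/dH: H; rewrite /cst -[(_ - (_ + _)) _]/(phi (z' - z + z) - (phi z + 'd phi z (z' - z))) subrK.
have -> : 'd phi z (z' - z) = (grad phi z).1 * (z' - z).1.1 +
    (grad phi z).2 * (z' - z).1.2 + dt phi z * (z' - z).2.
  rewrite /grad /dt !deriveE//; case: (z' - z) => [[h1 h2] h3] /=.
  have -> : (h1, h2, h3) = h1 *: (1, 0, 0) + h2 *: (0, 1, 0) + h3 *: (0, 0, 1) :> R * R * R.
    apply/eqP; rewrite !xpair_eqE /= /GRing.scale /= !mulr0 !mulr1 !addr0 !add0r.
    by rewrite !eqxx.
  rewrite !linearD !linearZ /= /GRing.scale /=.
  by congr (_ + _ + _); exact: mulrC.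
by rewrite opprD addrA.
Qed.

Lemma path_lip s t w1 w2 g1 g2 : prim s t w1 g1 -> prim s t w2 g2 ->
  exists2 L : R, 0 < L & forall r r', s <= r <= t -> s <= r' <= t ->
    `|((w1 r', w2 r', r') : R * R * R) - (w1 r, w2 r, r)| <= L * `|r' - r|.
Proof.
move=> /prim_lip[L1 L10 H1] /prim_lip[L2 L20 H2].
exists (L1 + L2 + 1); first lra.
move=> r r' rst r'st; rewrite norm_le_triple /=.
have n0 := normr_ge0 (r' - r).
have := H1 _ _ rst r'st; have := H2 _ _ rst r'st.
set n := `|r' - r| in n0 *; set a := `|_|; set b := `|_| => hb ha.
by apply/and3P; split; nra.
Qed.

Lemma path_within_continuous s t w1 w2 g1 g2 (A : set (R * R * R)) (f : R * R * R -> R) :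
  prim s t w1 g1 -> prim s t w2 g2 -> (forall r, s <= r <= t -> A (w1 r, w2 r, r)) ->
  {within A, continuous f} -> {within `[s, t], continuous (fun r => f (w1 r, w2 r, r))}.
Proof.
move=> p1 p2 wA /within_continuousP cf.
have [L L0 pL] := path_lip p1 p2.
apply/within_continuousP => r; rewrite /= in_itv /= => rst e e0.
have [d d0 dH] := cf _ (wA _ rst) _ e0.
exists (d / L); first exact: divr_gt0.
move=> r'; rewrite /= in_itv /= => r'st; rewrite ltr_pdivlMr// => He.
apply: dH; first exact: wA.
by apply: le_lt_trans (pL _ _ rst r'st) _; rewrite mulrC.
Qed.

(** On a short interval both sides are compared with their linearization at the
    base point: the left-hand side by differentiability of [phi], the integrand by
    continuity of the gradient along the curve. *)
Lemma prim_chain s t phi w1 w2 g1 g2 : C1 phi -> 0 < s ->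
  prim s t w1 g1 -> prim s t w2 g2 -> (forall r, s <= r <= t -> 0 < w2 r) ->
  prim s t (fun r => phi (w1 r, w2 r, r)) (fun r =>
    (grad phi (w1 r, w2 r, r)).1 * g1 r + (grad phi (w1 r, w2 r, r)).2 * g2 r +
    dt phi (w1 r, w2 r, r)).
Proof.
move=> [dphi cphi] s0 p1 p2 w20.
have wA r : s <= r <= t -> spacetime (w1 r, w2 r, r).
  by move=> rst; split; [exact: w20|rewrite /=; lra].
have cP (h : R * R * R) : {within `[s, t], continuous (fun r => 'D_h phi (w1 r, w2 r, r))}.
  exact: path_within_continuous p1 p2 wA (cphi h).
have [t1 _] := p1; have [t2 _] := p2.
have [_ [M1 gM1]] := t1; have [_ [M2 gM2]] := t2.
have tG : tame s t (fun r =>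
    (grad phi (w1 r, w2 r, r)).1 * g1 r + (grad phi (w1 r, w2 r, r)).2 * g2 r +
    dt phi (w1 r, w2 r, r)).
  by apply: tameD; [apply: tameD; apply: tameM => //|]; apply: tame_cont; exact: cP.
have [L L0 pL] := path_lip p1 p2.
apply: prim_flat => // r rst e e0.
have M0 : 0 < `|M1| + `|M2| + 1 by rewrite ltr_wpDl// addr_ge0.
pose e1 := e / 2 / (`|M1| + `|M2| + 1).
have e10 : 0 < e1 by rewrite !divr_gt0.
have ct (h : R * R * R) : exists2 d : R, 0 < d & forall q, s <= q <= t -> `|q - r| < d ->
    `|'D_h phi (w1 q, w2 q, q) - 'D_h phi (w1 r, w2 r, r)| <= e1.
  have /within_continuousP/(_ r _ e1 e10) := cP h.
  rewrite /= in_itv /= => /(_ rst)[d d0 dH]; exists d => // q qst qr.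
  by apply/ltW/dH => //; rewrite in_itv.
have [d1 d10 D1] := ct (1, 0, 0); have [d2 d20 D2] := ct (0, 1, 0).
have [d3 d30 D3] := ct (0, 0, 1).
have eL : 0 < e / 2 / L by rewrite !divr_gt0.
have [d4 d40 D4] := differentiable_locally (dphi _ (wA r rst)) eL.
exists (Num.min (d4 / L) (Num.min d1 (Num.min d2 d3))).
  by rewrite !lt_min d10 d20 d30 divr_gt0.
move=> r1 r2 sr1 r12 r2t rr; rewrite !lt_min => /and4P[].
rewrite ltr_pdivlMr// => l4 l1 l2 l3.
have near q : r1 <= q <= r2 -> `|q - r| <= r2 - r1.
  by clear -rr; case: rr => <- ?; rewrite ler_norml; lra.
move: D4; set P1 := (grad phi (w1 r, w2 r, r)).1.
set P2 := (grad phi (w1 r, w2 r, r)).2; set P3 := dt phi (w1 r, w2 r, r) => D4.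
have {}D1 q : s <= q <= t -> `|q - r| < d1 ->
  `|(grad phi (w1 q, w2 q, q)).1 - P1| <= e1 by exact: D1.
have {}D2 q : s <= q <= t -> `|q - r| < d2 ->
  `|(grad phi (w1 q, w2 q, q)).2 - P2| <= e1 by exact: D2.
have {}D3 q : s <= q <= t -> `|q - r| < d3 ->
  `|dt phi (w1 q, w2 q, q) - P3| <= e1 by exact: D3.
clearbody P1 P2 P3.
have [t1' t2' tG'] : [/\ tame r1 r2 g1, tame r1 r2 g2 & tame r1 r2 (fun r =>
    (grad phi (w1 r, w2 r, r)).1 * g1 r + (grad phi (w1 r, w2 r, r)).2 * g2 r +
    dt phi (w1 r, w2 r, r))].
  by split; [apply: tameS t1|apply: tameS t2|apply: tameS tG].
set G := (fun r => _ + _) in tG tG' *.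
have tP : tame r1 r2 (fun q => P1 * g1 q + P2 * g2 q + P3).
  by apply: tameD; [apply: tameD; apply: tameM => //|]; exact: tame_cst.
have IP : Int (fun q => P1 * g1 q + P2 * g2 q + P3) r1 r2 =
    P1 * (w1 r2 - w1 r1) + P2 * (w2 r2 - w2 r1) + P3 * (r2 - r1).
  rewrite IntD; [|by apply: tameD; apply: tameM => //; exact: tame_cst|exact: tame_cst].
  rewrite IntD; [|by apply: tameM => //; exact: tame_cst|by apply: tameM => //; exact: tame_cst].
  rewrite !IntZ//; have [_ ->//] := p1; have [_ ->//] := p2.
  by congr (_ + _); exact: Int_cst.
have IB : `|Int (fun q => G q - (P1 * g1 q + P2 * g2 q + P3)) r1 r2| <= e / 2 * (r2 - r1).
  apply: Int_bound => // [|q qr]; first exact: tameB.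
  have qst : s <= q <= t by clear -sr1 r2t qr; lra.
  have qr' := near _ qr.
  have H1 := D1 _ qst (le_lt_trans qr' l1); have H2 := D2 _ qst (le_lt_trans qr' l2).
  have H3 := D3 _ qst (le_lt_trans qr' l3).
  have alg (a1 a2 a3 b1 b2 b3 x y : R) : a1 * x + a2 * y + a3 - (b1 * x + b2 * y + b3) =
    (a1 - b1) * x + (a2 - b2) * y + (a3 - b3) by clear; ring.
  rewrite /G alg.
  rewrite (_ : e / 2 = e1 * `|M1| + e1 * `|M2| + e1); last by rewrite -{3}(mulr1 e1) -!mulrDr divfK// gt_eqF.
  apply: le_trans (ler_normD _ _) _; apply: lerD => //.
  apply: le_trans (ler_normD _ _) _; rewrite !normrM; apply: lerD; apply: ler_pM => //.
    by apply: le_trans (gM1 _ qst) (ler_norm _).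
  by apply: le_trans (gM2 _ qst) (ler_norm _).
have : `|phi (w1 r2, w2 r2, r2) - phi (w1 r1, w2 r1, r1)
    - (P1 * (w1 r2 - w1 r1) + P2 * (w2 r2 - w2 r1) + P3 * (r2 - r1))| <= e / 2 * (r2 - r1).
  have D5 q : s <= q <= t -> `|q - r| <= r2 - r1 ->
     `|phi (w1 q, w2 q, q) - phi (w1 r, w2 r, r)
    - (P1 * (w1 q - w1 r) + P2 * (w2 q - w2 r) + P3 * (q - r))| <= e / 2 * (r2 - r1).
    move=> qst qr; have lq := pL _ _ rst qst.
    have lq' : L * `|q - r| <= L * (r2 - r1) by rewrite ler_wpM2l// ltW.
    apply: le_trans (D4 (w1 q, w2 q, q) _) _; first by clear -lq lq' l4; lra.
    apply: (@le_trans _ _ (e / 2 / L * (L * (r2 - r1)))).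
      by rewrite ler_wpM2l; [|exact: ltW|clear -lq lq'; lra].
    by rewrite mulrA divfK// gt_eqF.
  case: rr => [E|E]; rewrite -E in rst D5.
    apply: D5; first by clear -rst r2t sr1 r12; lra.
    by clear -r12; rewrite ger0_norm; lra.
  rewrite -normrN; have := D5 r1; rewrite -[in X in _ -> _ <= X]opprB.
  have -> : - (phi (w1 r2, w2 r2, r2) - phi (w1 r1, w2 r1, r1)
    - (P1 * (w1 r2 - w1 r1) + P2 * (w2 r2 - w2 r1) + P3 * (r2 - r1)))
    = phi (w1 r1, w2 r1, r1) - phi (w1 r2, w2 r2, r2)
    - (P1 * (w1 r1 - w1 r2) + P2 * (w2 r1 - w2 r2) + P3 * (r1 - r2)) by clear; ring.
  rewrite opprB; apply; first by clear -rst r2t sr1 r12; lra.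
  by clear -r12; rewrite ler0_norm; lra.
move=> H; rewrite (_ : G = fun q => (G q - (P1 * g1 q + P2 * g2 q + P3)) + (P1 * g1 q + P2 * g2 q + P3)); last by apply/funext => q; clear; ring.
rewrite IntD//; last exact: tameB.
rewrite IP opprD addrCA -opprB; move: IB H; clear; rewrite !ler_norml; lra.
Qed.

End Chain.

(** * Bounds on trajectories in the half-plane *)

Section FlowBounds.
Context {R : realType} (c eta : R -> R).
Hypothesis c_tame : forall T, tame 0 T c.
Hypothesis eta_tame : forall T, tame 0 T eta.

(** Trajectories that stay in the half-plane, on an arbitrary time interval so that
    they can be restricted and concatenated. In the half-plane the drift is given
    by a single formula. *)
Definition flow (s t : R) (a b w1 w2 : R -> R) : Prop :=
  [/\ tame s t a, tame s t b, forall r, s <= r <= t -> 0 <= b r,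
      forall r, s <= r <= t -> 0 < w2 r &
      prim s t w1 (fun r => - (w1 r + eta r) * (a r + b r * w2 r)) /\
      prim s t w2 (fun r => - b r * w2 r ^+ 2 - 2 * a r * w2 r + c r ^+ 2)].

Lemma flowS s t s' t' a b w1 w2 : s <= s' -> t' <= t ->
  flow s t a b w1 w2 -> flow s' t' a b w1 w2.
Proof.
move=> ss tt [ta tb b0 w0 [p1 p2]]; split.
- exact: tameS ta.
- exact: tameS tb.
- by move=> r ?; apply: b0; lra.
- by move=> r ?; apply: w0; lra.
- by split; [exact: primS p1|exact: primS p2].
Qed.

(** The quantity controlled by the running cost, in terms of which all bounds on
    trajectories are expressed. *)
Definition effort (s t : R) (a b : R -> R) := Int (fun r => `|a r| + b r) s t.

Lemma effort_tame s t a b w1 w2 : flow s t a b w1 w2 -> tame s t (fun r => `|a r| + b r).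
Proof. by move=> [ta tb *]; apply: tameD => //; exact: tame_norm. Qed.

Lemma effort_ge0 s t a b w1 w2 : flow s t a b w1 w2 -> 0 <= effort s t a b.
Proof.
move=> [_ _ b0 *]; apply: Rintegral_ge0 => r; rewrite /= in_itv /= => rst.
by rewrite addr_ge0// b0.
Qed.

Lemma effort_sub s t r r' a b w1 w2 : flow s t a b w1 w2 ->
  s <= r -> r <= r' -> r' <= t -> effort r r' a b <= effort s t a b.
Proof.
move=> F sr rr' r't; have tF := effort_tame F; rewrite /effort.
rewrite (@Int_cat _ s r t)//; last lra.
rewrite (@Int_cat _ r r' t)//; last by apply: tameS tF.
rewrite addrCA lerDl addr_ge0//.
  by apply: (@effort_ge0 s r a b w1 w2); apply: flowS F; lra.
by apply: (@effort_ge0 r' t a b w1 w2); apply: flowS F; lra.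
Qed.

Lemma Int_effort s t r r' a b w1 w2 (g : R -> R) (k A : R) : flow s t a b w1 w2 ->
  s <= r -> r <= r' -> r' <= t -> tame s t g -> 0 <= k ->
  (forall q, s <= q <= t -> `|g q| <= k * (`|a q| + b q)) ->
  effort s t a b <= A -> Int (fun q => `|g q|) r r' <= k * A.
Proof.
move=> F sr rr' r't tg k0 gk EA; have tF := effort_tame F.
apply: (@le_trans _ _ (k * effort r r' a b)).
  rewrite -IntZ; last exact: tameS tF.
  apply: Int_le => [||q qrr].
  - by apply: tame_norm; apply: tameS tg.
  - by apply: tameM; [exact: tame_cst|exact: tameS tF].
  - by apply: gk; clear -qrr sr r't; lra.
by rewrite ler_wpM2l//; apply: le_trans EA; exact: effort_sub F sr rr' r't.
Qed.

(** Let [I] be the primitive of [2 a]. Dropping [- b w2^2] in the equation of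
    [w2 exp I] bounds [w2] above; dropping [- (c / w2)^2] in the equation of
    [exp (- I) / w2] bounds it away from zero. The integrating factor for the
    linear equation of [w1] is the exponential of the primitive of [a + b w2]. *)
Lemma flow_bounds (T A K d : R) : 0 <= T -> 0 <= A -> 0 <= K -> 0 < d ->
  exists2 K' : R, 0 <= K' & exists2 d' : R, 0 < d' &
  forall t a b w1 w2, 0 <= t <= T -> flow 0 t a b w1 w2 -> effort 0 t a b <= A ->
    `|w1 0| <= K -> d <= w2 0 <= K ->
  forall r, 0 <= r <= t -> `|w1 r| <= K' /\ d' <= w2 r <= K'.
Proof.
move=> T0 A0 K0 d0.
have [Mc Mc0 cM] := tame_bound (c_tame T); have [Me Me0 eM] := tame_bound (eta_tame T).
pose e := expR (2 * A).
have e0 : 0 < e := expR_gt0 _; have e0' := ltW e0.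
pose K2 := e * (K + e * Mc ^+ 2 * T).
have K20 : 0 <= K2 by rewrite mulr_ge0// addr_ge0// !mulr_ge0// sqr_ge0.
pose dd := (e * (d^-1 + e * A))^-1.
have dd0 : 0 < dd by rewrite invr_gt0 mulr_gt0// ltr_pwDl ?invr_gt0// mulr_ge0.
pose A1 := (1 + K2) * A.
have A10 : 0 <= A1 by rewrite mulr_ge0// addr_ge0.
pose K1 := expR A1 * (K + Me * expR A1 * A1).
have K10 : 0 <= K1.
  by do ?[exact: expR_ge0 | assumption | apply: mulr_ge0 | apply: addr_ge0].
exists (K1 + K2); first exact: addr_ge0.
exists dd => // t a b w1 w2 tT F EA w10 w20.
have [ta tb b0 w0 [p1 p2]] := F.
have tF := effort_tame F.
have tc : tame 0 t c by apply: tameS (c_tame T) => //; clear -tT; lra.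
have te : tame 0 t eta by apply: tameS (eta_tame T) => //; clear -tT; lra.
have pI : prim 0 t (fun r => Int (fun q => 2 * a q) 0 r) (fun r => 2 * a r).
  by apply: prim_Int_left; apply: tameM => //; exact: tame_cst.
pose I r := Int (fun q => 2 * a q) 0 r.
have IA r : 0 <= r <= t -> `|I r| <= 2 * A.
  move=> rt; apply: le_trans (Int_abs _) _.
    apply: tameM; first exact: tame_cst.
    by apply: tameS ta => //; clear -rt; lra.
  apply: (Int_effort (s:=0) (t:=t) F) => //; [by clear -rt; lra|by clear -rt; lra| | ].
    by apply: tameM => //; exact: tame_cst.
  by move=> q qt; rewrite normrM gtr0_norm// ler_wpM2l// lerDl b0.
have eI r : 0 <= r <= t -> expR (I r) <= e /\ expR (- I r) <= e.
  by move=> /IA; rewrite !ler_expR ler_norml; clear; lra.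
have pE := prim_exp pI; have pE' := prim_exp (primN pI).
have Ig0 r : 0 < expR (I r) := expR_gt0 _.
have EV r : expR (- I r) = (expR (I r))^-1 by rewrite expRN.
have I0 : I 0 = 0 by rewrite /I Int_refl.
have up r : 0 <= r <= t -> w2 r <= K2.
  move=> rt; have [eI1 eI2] := eI _ rt.
  (* the derivative of [w2 exp I] is [exp I (c^2 - b w2^2)] *)
  have H : w2 r * expR (I r) <= w2 0 + e * Mc ^+ 2 * (r - 0).
    have := prim_growth (primM p2 pE) (tame_cst 0 t (e * Mc ^+ 2)) rt.
    rewrite -!/(I _) I0 expR0 mulr1 Int_cst; last by clear -rt; lra.
    apply=> q qt; rewrite -/(I q) (_ : _ + _ = expR (I q) * (c q ^+ 2 - b q * w2 q ^+ 2)); last by clear; ring.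
    have cq : c q ^+ 2 <= Mc ^+ 2.
      rewrite -real_normK ?num_real// lerXn2r ?nnegrE// cM//.
      by clear -qt tT; lra.
    have bq : 0 <= b q * w2 q ^+ 2 by rewrite mulr_ge0 ?b0// sqr_ge0.
    have [eq1 _] := eI _ qt; have := ltW (Ig0 q) => eq0.
    have := sqr_ge0 Mc => Mc2.
    apply: (@le_trans _ _ (expR (I q) * Mc ^+ 2)); last by rewrite ler_wpM2r.
    by rewrite ler_wpM2l//; clear -cq bq; lra.
  rewrite (_ : w2 r = w2 r * expR (I r) * expR (- I r)); last by rewrite -mulrA -expRD subrr expR0 mulr1.
  have {}H : w2 r * expR (I r) <= K + e * Mc ^+ 2 * T.
    apply: le_trans H _; apply: lerD; first by case/andP: w20.
    rewrite subr0 ler_wpM2l//; last by clear -rt tT; lra.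
    by rewrite mulr_ge0// sqr_ge0.
  rewrite /K2 [X in _ <= X]mulrC; apply: ler_pM => //.
  by rewrite mulr_ge0 ?expR_ge0// ltW// w0.
have lo r : 0 <= r <= t -> dd <= w2 r.
  move=> rt; have [eI1 eI2] := eI _ rt.
  have [m m0 mw] : exists2 m : R, 0 < m & forall q, 0 <= q <= t -> m <= w2 q.
    have cw := prim_within_continuous p2.
    have [|q qt qH] := EVT_min _ cw; first by clear -tT; lra.
    exists (w2 q); first by apply: w0; move: qt; rewrite in_itv.
    by move=> q' q't; apply: qH; rewrite in_itv.
  have pV := prim_inv m0 mw p2.
  (* the derivative of [exp (- I) / w2] is [exp (- I) (b - (c / w2)^2)] *)
  have H : (w2 r)^-1 * expR (- I r) <= (w2 0)^-1 + Int (fun q => e * (`|a q| + b q)) 0 r.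
    have th : tame 0 t (fun q => e * (`|a q| + b q)) by apply: tameM => //; exact: tame_cst.
    have := prim_growth (primM pV pE') th rt.
    rewrite -!/(I _) I0 oppr0 expR0 mulr1; apply=> q qt; rewrite -/(I q) (_ : _ + _ = expR (- I q) * (b q - (c q / w2 q) ^+ 2)); last first.
      by have := w0 _ qt; clear => ?; field; lra.
    have [_ eq2] := eI _ qt; have eq0 := expR_ge0 (- I q).
    apply: (@le_trans _ _ (expR (- I q) * b q)).
      by rewrite ler_wpM2l// lerBlDr lerDl sqr_ge0.
    by apply: ler_pM => //; [exact: b0|rewrite lerDr].
  have {}H : (w2 r)^-1 * expR (- I r) <= d^-1 + e * A.
    apply: le_trans H _; apply: lerD.
      by case/andP: w20 => dw _; rewrite lef_pV2 ?posrE// (lt_le_trans d0).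
    rewrite IntZ; last by apply: tameS tF => //; clear -rt; lra.
    rewrite ler_wpM2l//; apply: le_trans EA.
    by apply: (effort_sub F) => //; clear -rt; lra.
  have w2r := w0 _ rt.
  rewrite -[w2 r]invrK lef_pV2 ?posrE ?invr_gt0 ?mulr_gt0 ?ltr_pwDl ?invr_gt0 ?mulr_ge0//.
  rewrite (_ : (w2 r)^-1 = (w2 r)^-1 * expR (- I r) * expR (I r)); last first.
    by rewrite -mulrA -expRD addrC subrr expR0 mulr1.
  rewrite [X in _ <= X]mulrC; apply: ler_pM => //.
  by rewrite mulr_ge0 ?expR_ge0// invr_ge0 ltW.
have tg : tame 0 t (fun q => a q + b q * w2 q).
  by apply: tameD => //; apply: tameM => //; exact: prim_tame p2.
pose G r := Int (fun q => a q + b q * w2 q) 0 r.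
have GA r r' : 0 <= r -> r <= r' -> r' <= t ->
    Int (fun q => `|a q + b q * w2 q|) r r' <= A1.
  move=> r0 rr' r't; apply: (Int_effort (s:=0) (t:=t) F) => //; first exact: addr_ge0.
  move=> q qt; apply: le_trans (ler_normD _ _) _.
  have bq := b0 _ qt; have wq := w0 _ qt; have uq := up _ qt; have aq := normr_ge0 (a q).
  rewrite normrM (ger0_norm bq) (gtr0_norm wq); set x := `|a q| in aq *.
  by clear -bq wq uq aq K20; nra.
have GA' r : 0 <= r <= t -> `|G r| <= A1.
  move=> rt; apply: le_trans (Int_abs _) _; first by apply: tameS tg => //; clear -rt; lra.
  by apply: GA; clear -rt; lra.
have pG := prim_exp (prim_Int_left tg).
have eG r : 0 <= r <= t -> expR (G r) <= expR A1 /\ expR (- G r) <= expR A1.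
  by move=> /GA'; rewrite !ler_expR ler_norml; clear; lra.
move=> r rt; split; last first.
  rewrite lo//=; apply: le_trans (up _ rt) _; by rewrite lerDr.
apply: (@le_trans _ _ K1); last by rewrite lerDl.
have [eG1 eG2] := eG _ rt.
have [tY Y] := primM p1 pG.
have H : w1 r * expR (G r) = w1 0 + Int (fun q => - (w1 q + eta q) * (a q + b q * w2 q) * expR (G q)
    + w1 q * (expR (G q) * (a q + b q * w2 q))) 0 r.
  have /eqP := Y 0 r (lexx _) (andP rt).1 (andP rt).2; rewrite subr_eq => /eqP.
  by rewrite -!/(G _) {2}/G Int_refl expR0 mulr1 => ->; rewrite addrC.
have {}H : `|w1 r * expR (G r)| <= K + Me * expR A1 * A1.
  rewrite H; apply: le_trans (ler_normD _ _) _; apply: lerD => //.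
  apply: le_trans (Int_abs _) _; first by apply: tameS tY => //; clear -rt; lra.
  apply: (@le_trans _ _ (Int (fun q => (Me * expR A1) * `|a q + b q * w2 q|) 0 r)).
    apply: Int_le => [||q qr].
    - by apply: tame_norm; apply: tameS tY => //; clear -rt; lra.
    - apply: tameM; first exact: tame_cst.
      by apply: tame_norm; apply: tameS tg => //; clear -rt; lra.
    rewrite (_ : _ + _ = - (eta q * expR (G q)) * (a q + b q * w2 q)); last by clear; ring.
    have qt : 0 <= q <= t by clear -qr rt; lra.
    have [eGq _] := eG _ qt.
    rewrite normrM normrN normrM (ger0_norm (expR_ge0 _)) ler_wpM2r//.
    by apply: ler_pM; rewrite ?expR_ge0// eM//; clear -qt tT; lra.
  rewrite IntZ; last by apply: tame_norm; apply: tameS tg => //; clear -rt; lra.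
  rewrite ler_wpM2l ?mulr_ge0 ?expR_ge0//.
  by apply: GA; clear -rt; lra.
rewrite (_ : w1 r = w1 r * expR (G r) * expR (- G r)); last first.
  by rewrite -mulrA -expRD subrr expR0 mulr1.
rewrite normrM (ger0_norm (expR_ge0 (- _))) /K1 [X in _ <= X]mulrC.
by apply: ler_pM; rewrite ?expR_ge0.
Qed.

End FlowBounds.

(** * Perturbation of the terminal point *)

Section FlowPerturbation.
Context {R : realType} (c eta : R -> R).
Hypothesis c_tame : forall T, tame 0 T c.
Hypothesis eta_tame : forall T, tame 0 T eta.

Local Notation flow := (flow c eta).

(** With the control kept, the change of [w2] solves a Bernoulli equation and the
    change of [w1] a linear one. Solving them backwards from the new terminal point
    gives at once the existence of the new trajectory up to time 0 and its
    Lipschitz dependence on the terminal point. *)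
Lemma flow_shift (T A K d : R) : 0 <= T -> 0 <= A -> 0 <= K -> 0 < d ->
  exists2 C : R, 0 < C & exists2 h0 : R, 0 < h0 &
  forall t a b w1 w2 (x1 x2 h : R), 0 <= t <= T -> flow 0 t a b w1 w2 ->
    effort 0 t a b <= A ->
    (forall r, 0 <= r <= t -> `|w1 r| <= K /\ d <= w2 r <= K) ->
    `|x1 - w1 t| <= h -> `|x2 - w2 t| <= h -> h <= h0 ->
  exists z1 z2, [/\ flow 0 t a b z1 z2, z1 t = x1, z2 t = x2,
    `|z1 0 - w1 0| <= C * h & `|z2 0 - w2 0| <= C * h /\ C * h <= d / 2].
Proof.
move=> T0 A0 K0 d0.
have [Me Me0 eM] := tame_bound (eta_tame T).
pose A1 := (2 * (1 + K)) * A.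
pose e := expR A1.
have e0 : 0 < e := expR_gt0 _; have e0' := ltW e0.
pose A2 := (1 + (2 * K + d)) * A.
pose e2 := expR A2.
have e20 : 0 < e2 := expR_gt0 _; have e20' := ltW e20.
pose C := 2 * e + (e2 * (1 + e2 * ((K + Me) * (2 * e) * A))).
have C0' : 0 <= e2 * (1 + e2 * ((K + Me) * (2 * e) * A)).
  by do ?[assumption | apply: mulr_ge0 | apply: addr_ge0].
have C0 : 0 < C by rewrite /C; apply: ltr_pwDl => //; rewrite mulr_gt0.
pose h0 := Num.min (d / 2 / C) (1 / 2 / (e * A + 1)).
have eA0 : 0 < e * A + 1 by rewrite ltr_wpDl// mulr_ge0.
have h00 : 0 < h0 by rewrite lt_min !divr_gt0.
exists C => //; exists h0 => // t a b w1 w2 x1 x2 h tT F EA wK h1 h2 hh.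
have [ta tb b0 w0 [p1 p2]] := F.
have t0 : 0 <= t by case/andP: tT.
have h_ge0 : 0 <= h := le_trans (normr_ge0 _) h1.
have hd : C * h <= d / 2.
  by rewrite mulrC -ler_pdivlMr//; apply: le_trans hh _; rewrite ge_min lexx.
have tw2 := prim_tame p2.
pose g r := 2 * b r * w2 r + 2 * a r.
have tg : tame 0 t g.
  by apply: tameD; repeat apply: tameM => //; exact: tame_cst.
have gA : Int (fun r => `|g r|) 0 t <= A1.
  apply: (Int_effort (s:=0) (t:=t) F) => //; first by rewrite mulr_ge0// addr_ge0.
  move=> q qt; have [_ /andP[wl wu]] := wK q qt; have bq := b0 _ qt.
  have aq := normr_ge0 (a q).
  apply: le_trans (ler_normD _ _) _; rewrite !normrM !(ger0_norm (ler0n _ 2)) (ger0_norm bq).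
  rewrite (ger0_norm (x := w2 q)); last by clear -wl d0; lra.
  set x := `|a q| in aq *; clear -wl wu bq aq K0 d0; nra.
have bA : Int (fun r => `|b r|) 0 t <= 1 * A.
  apply: (Int_effort (s:=0) (t:=t) F) => // q qt.
  by rewrite (ger0_norm (b0 _ qt)) mul1r lerDr.
rewrite mul1r in bA.
have eg : expR (Int (fun r => `|g r|) 0 t) <= e by rewrite ler_expR.
have small : `|x2 - w2 t| * (expR (Int (fun r => `|g r|) 0 t) * Int (fun r => `|b r|) 0 t) <= 1 / 2.
  apply: (@le_trans _ _ (h0 * (e * A + 1))); last first.
    by rewrite -ler_pdivlMr// ge_min lexx orbT.
  have bI : 0 <= Int (fun r => `|b r|) 0 t by apply: Rintegral_ge0.
  apply: ler_pM => //; first by rewrite mulr_ge0// expR_ge0.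
    exact: le_trans hh.
  by apply: ler_wpDr => //; apply: ler_pM => //; exact: expR_ge0.
have [y [py yt yB]] := bernoulli_backward t0 tg tb small.
have {}yB r : 0 <= r <= t -> `|y r| <= 2 * e * h.
  move=> /yB /le_trans; apply; rewrite mulrAC; apply: ler_pM => //.
  by rewrite ler_wpM2l.
have yd r : 0 <= r <= t -> `|y r| <= d / 2.
  move=> /yB /le_trans; apply; apply: le_trans hd; rewrite ler_wpM2r// /C.
  by rewrite lerDl.
pose z2 r := w2 r + y r.
have pz2 : prim 0 t z2 (fun r => - b r * z2 r ^+ 2 - 2 * a r * z2 r + c r ^+ 2).
  by apply: prim_eq (primD p2 py) => // r _; rewrite /z2 /g; clear; ring.
have z20 r : 0 <= r <= t -> 0 < z2 r.
  move=> rt; have [_ /andP[wl _]] := wK _ rt; have := yd _ rt.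
  by rewrite ler_norml /z2; clear -wl d0; lra.
have tz2 := prim_tame pz2; have ty := prim_tame py; have tw1 := prim_tame p1.
have te : tame 0 t eta by exact: eta_tame.
pose G r := a r + b r * z2 r.
have tG : tame 0 t G by apply: tameD => //; exact: tameM.
pose H r := (w1 r + eta r) * b r * y r.
have tH : tame 0 t H by repeat apply: tameM => //; exact: tameD.
have [D [pD Dt DB]] := linear_backward (x1 - w1 t) t0 tG tH.
have GA : Int (fun r => `|G r|) 0 t <= A2.
  apply: (Int_effort (s:=0) (t:=t) F) => //.
    by rewrite addr_ge0// addr_ge0 ?mulr_ge0// ltW.
  move=> q qt; have [_ /andP[wl wu]] := wK q qt; have bq := b0 _ qt.
  have aq := normr_ge0 (a q); have := yd _ qt; rewrite ler_norml => yq.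
  have zE : z2 q = w2 q + y q by [].
  move: (z20 _ qt) zE; rewrite /G; set z := z2 q => z0 zE.
  apply: le_trans (ler_normD _ _) _; rewrite normrM (ger0_norm bq) (gtr0_norm z0).
  have {}zE : z <= 2 * K + d by clear -zE yq wl wu d0 K0; lra.
  set x := `|a q| in aq *; clearbody z x; clear -z0 zE bq aq K0 d0; nra.
have HA : Int (fun r => `|H r|) 0 t <= ((K + Me) * (2 * e * h)) * A.
  apply: (Int_effort (s:=0) (t:=t) F) => //.
    by do ?[assumption | apply: mulr_ge0 | apply: addr_ge0].
  move=> q qt; have [wq _] := wK q qt; have bq := b0 _ qt.
  have eq : `|eta q| <= Me by apply: eM; clear -qt tT; lra.
  rewrite /H mulrAC !normrM (ger0_norm bq); apply: ler_pM => //; last by rewrite lerDr.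
  apply: ler_pM => //; last exact: yB.
  by apply: le_trans (ler_normD _ _) _; exact: lerD.
exists (fun r => w1 r + D r), z2; split.
- split=> //; split=> //; apply: prim_eq (primD p1 pD) => // r _.
  by rewrite /G /H /z2; clear; ring.
- by rewrite Dt; clear; ring.
- by rewrite /z2 yt; clear; ring.
- rewrite addrAC subrr add0r; apply: le_trans (DB 0 _) _; first by rewrite lexx.
  apply: (@le_trans _ _ (e2 * (1 + e2 * ((K + Me) * (2 * e) * A)) * h)); last first.
    by rewrite ler_wpM2r// /C lerDr mulr_ge0.
  have HI : 0 <= Int (fun r => `|H r|) 0 t by apply: Rintegral_ge0.
  rewrite -mulrA; apply: ler_pM; rewrite ?expR_ge0 ?ler_expR//.
    by rewrite addr_ge0// mulr_ge0 ?expR_ge0.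
  rewrite mulrDl mul1r lerD// -mulrA; apply: ler_pM; rewrite ?expR_ge0 ?ler_expR//.
  by apply: le_trans HA _; rewrite le_eqVlt; apply/orP; left; apply/eqP; clear; ring.
- split=> //; rewrite /z2 addrAC subrr add0r; apply: le_trans (yB 0 _) _; first by rewrite lexx.
  by rewrite ler_wpM2r// /C lerDl.
Qed.

End FlowPerturbation.

(** * Concatenation and explicit trajectories *)

Section Splicing.
Context {R : realType}.
Implicit Types (s t u : R) (f g y z h : R -> R).

Definition splice u f g r := if r <= u then f r else g r.

Lemma tame_splice s u t f g : s <= u -> u <= t -> tame s u f -> tame u t g ->
  tame s t (splice u f g).
Proof.
move=> su ut [mf [M fM]] [mg [N gN]]; split.
  have -> : [set` `[s, t]] = [set` `[s, u]] `|` [set` `]u, t]].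
    by rewrite -itv_bndbnd_setU// bnd_simp.
  apply/measurable_funU => //; split.
    apply: eq_measurable_fun mf => r /set_mem /=; rewrite in_itv /= /splice => /andP[_ ru].
    by rewrite ru.
  apply: (@eq_measurable_fun _ _ _ _ _ g).
    by move=> r /set_mem /=; rewrite in_itv /= /splice => /andP[ur _]; rewrite leNgt ur.
  by apply: measurable_funS mg => //; apply: subset_itv => //=; rewrite bnd_simp.
exists (Num.max M N) => r rst; rewrite le_max /splice; case: (leP r u) => ru.
  by rewrite fM//; clear -ru rst; lra.
by rewrite gN ?orbT//; clear -ru rst; lra.
Qed.

Lemma Int_eq_open s t g h : tame s t g -> tame s t h ->
  (forall r, s < r <= t -> g r = h r) -> Int g s t = Int h s t.
Proof.
move=> tg th gh.
have op f : tame s t f -> Int f s t = \int[lebesgue_measure]_(r in `]s, t]) f r.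
  move=> tf; symmetry; apply: Rintegral_itv_obnd_cbnd.
  by apply: integrableS (tame_integrable tf) => //; apply: subset_itv => //=; rewrite bnd_simp.
rewrite !op//; apply: eq_Rintegral => r /set_mem /=; rewrite in_itv /=; exact: gh.
Qed.

Lemma prim_splice s u t y z g h : s <= u -> u <= t -> prim s u y g -> prim u t z h ->
  y u = z u -> prim s t (splice u y z) (splice u g h).
Proof.
move=> su ut [tg yg] [th zh] yz; have tG := tame_splice su ut tg th.
have left r : s <= r <= u -> splice u y z u - splice u y z r = Int (splice u g h) r u.
  move=> ru; rewrite /splice lexx (andP ru).2 yg//; [|exact: (andP ru).1|exact: (andP ru).2].
  by apply: Int_eq => q /andP[_ ->].
have right r : u <= r <= t -> splice u y z r - splice u y z u = Int (splice u g h) u r.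
  move=> /andP[ur rt]; have -> : splice u y z r = z r.
    rewrite /splice; case: (leP r u) => // ru; have -> : r = u by apply/le_anti; rewrite ru ur.
    exact: yz.
  rewrite /splice lexx yz zh//; apply: Int_eq_open; [exact: tameS th|exact: tameS tG|].
  by move=> q /andP[uq _]; rewrite leNgt uq.
split=> // r r' sr rr' r't; have [ru|/ltW ur] := leP r' u.
  rewrite /splice ru (le_trans rr' ru) yg//.
  by apply: Int_eq => q /andP[_ qr']; rewrite (le_trans qr' ru).
have [ru|/ltW ur'] := leP r u.
  rewrite (@Int_cat _ r u r')//; last by apply: tameS tG.
  have := left r; have := right r'; rewrite sr ru ur r't => /(_ isT) H1 /(_ isT) H2.
  by clear -H1 H2; lra.
have := right r; have := right r'.
rewrite ur ur' r't (le_trans rr' r't) (@Int_cat _ u r r')//; last by apply: tameS tG.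
by move=> /(_ isT) H1 /(_ isT) H2; clear -H1 H2; lra.
Qed.

End Splicing.

Section ExplicitFlows.
Context {R : realType} (c eta : R -> R).
Hypothesis c_tame : forall T, tame 0 T c.
Hypothesis eta_tame : forall T, tame 0 T eta.
Hypothesis c_cont : {within `[0, +oo[, continuous c}.

Local Notation flow := (flow c eta).

Lemma flow_splice s u t a b w1 w2 a' b' z1 z2 : s <= u -> u <= t ->
  flow s u a b w1 w2 -> flow u t a' b' z1 z2 -> w1 u = z1 u -> w2 u = z2 u ->
  flow s t (splice u a a') (splice u b b') (splice u w1 z1) (splice u w2 z2).
Proof.
move=> su ut [ta tb b0 w0 [p1 p2]] [ta' tb' b0' w0' [p1' p2']] e1 e2; split.
- exact: tame_splice.
- exact: tame_splice.
- move=> r rst; rewrite /splice; case: (leP r u) => ru; [apply: b0|apply: b0']; clear -c eta ru rst; lra.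
- move=> r rst; rewrite /splice; case: (leP r u) => ru; [apply: w0|apply: w0']; clear -c eta ru rst; lra.
- split; [apply: prim_eq (prim_splice su ut p1 p1' e1)|
          apply: prim_eq (prim_splice su ut p2 p2' e2)] => // r _;
  by rewrite /splice; case: ifP.
Qed.

(** Once [w2] is prescribed, the equation of [w1] is linear. *)
Lemma linear_flow s t a b w2 (x1 : R) : 0 <= s -> s <= t -> tame s t a -> tame s t b ->
  tame s t w2 -> exists w1, prim s t w1 (fun r => - (w1 r + eta r) * (a r + b r * w2 r)) /\
    w1 t = x1 /\
  let g r := a r + b r * w2 r in
  forall r, s <= r <= t -> `|w1 r| <= expR (Int (fun r => `|g r|) s t) *
    (`|x1| + expR (Int (fun r => `|g r|) s t) * Int (fun r => `|eta r * g r|) s t).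
Proof.
move=> s0 st ta tb tw.
have te : tame s t eta by apply: tameS (eta_tame t).
have tg : tame s t (fun r => a r + b r * w2 r) by apply: tameD => //; exact: tameM.
have [w1 [p1 w1t B]] := linear_backward x1 st tg (tameM te tg).
exists w1; split=> //; apply: prim_eq p1 => // r _; clear -c eta; ring.
Qed.

(** With [b = 1], the equation of [w2] is solved for [a] so that [w2] stays
    constant. This provides competitors whose running cost is bounded. *)
Lemma flow_stay (T K d : R) : 0 <= T -> 0 <= K -> 0 < d ->
  exists2 C : R, 0 <= C & forall x1 x2 s t, `|x1| <= K -> d <= x2 <= K ->
    0 <= s -> s <= t -> t <= T ->
  exists a w1, [/\ flow s t a (cst 1) w1 (cst x2), w1 t = x1,
    forall r, s <= r <= t -> `|a r| <= C & `|w1 s - x1| <= C * (t - s)].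
Proof.
move=> T0 K0 d0.
have [Mc Mc0 cM] := tame_bound (c_tame T).
have [Me Me0 eM] := tame_bound (eta_tame T).
(* [w2 = x2] is constant for [a = (c^2 - x2^2) / (2 x2)], and [d <= x2 <= K] *)
pose Ca := (Mc ^+ 2 + K ^+ 2) / (2 * d).
have Ca0 : 0 <= Ca by rewrite divr_ge0 ?addr_ge0 ?sqr_ge0// mulr_ge0// ltW.
pose Cg := Ca + K; have Cg0 : 0 <= Cg by exact: addr_ge0.
pose E := expR (Cg * T).
pose B := E * (K + E * (Me * Cg * T)).
have B0 : 0 <= B.
  by do ?[exact: expR_ge0 | assumption | apply: mulr_ge0 | apply: addr_ge0].
have BC0 : 0 <= (B + Me) * Cg by rewrite mulr_ge0// addr_ge0.
exists (Ca + (B + Me) * Cg); first exact: addr_ge0.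
move=> x1 x2 s t x1K x2K s0 st tT.
have x20 : 0 < x2 by clear -c eta x2K d0; lra.
have sT r : s <= r <= t -> 0 <= r <= T by clear -c eta s0 tT; lra.
pose a r := (c r ^+ 2 - x2 ^+ 2) * (2 * x2)^-1.
have tc : tame s t c by apply: tameS (c_tame t).
have ta : tame s t a.
  apply: tameM; last exact: tame_cst.
  by apply: tameB; [exact: tameM|exact: tame_cst].
have aC r : s <= r <= t -> `|a r| <= Ca.
  move=> rst; rewrite normrM; apply: ler_pM => //.
    apply: le_trans (ler_normB _ _) _; rewrite !normrX; apply: lerD; rewrite lerXn2r ?nnegrE//.
      exact/cM/sT.
    by rewrite gtr0_norm//; case/andP: x2K.
  rewrite gtr0_norm ?invr_gt0 ?mulr_gt0// lef_pV2 ?posrE ?mulr_gt0// ler_pM2l//.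
  by case/andP: x2K.
have gC r : s <= r <= t -> `|a r + 1 * x2| <= Cg.
  move=> rst; apply: le_trans (ler_normD _ _) _; rewrite mul1r lerD ?aC//.
  by rewrite gtr0_norm//; case/andP: x2K.
have [w1 [p1 [w1t w1B]]] := linear_flow x1 s0 st ta (tame_cst s t 1) (tame_cst s t x2).
have tw1 := prim_tame p1.
have te : tame s t eta by apply: tameS (eta_tame t).
have tg : tame s t (fun r => a r + cst 1 r * cst x2 r).
  by apply: tameD => //; apply: tameM; exact: tame_cst.
have stT : t - s <= T by clear -c eta s0 tT; lra.
have ts0 : 0 <= t - s by rewrite subr_ge0.
have Ig : Int (fun r => `|a r + cst 1 r * cst x2 r|) s t <= Cg * T.
  apply: le_trans (ler_norm _) _; apply: (@le_trans _ _ (Cg * (t - s))).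
    by apply: Int_bound => //; [exact: tame_norm|move=> r rst; rewrite normr_id gC].
  by rewrite ler_wpM2l.
have Ih : Int (fun r => `|eta r * (a r + cst 1 r * cst x2 r)|) s t <= Me * Cg * T.
  apply: le_trans (ler_norm _) _; apply: (@le_trans _ _ (Me * Cg * (t - s))).
    apply: Int_bound => //; first by apply: tame_norm; exact: tameM.
    by move=> r rst; rewrite normr_id normrM; apply: ler_pM => //; [exact/eM/sT|exact: gC].
  by rewrite ler_wpM2l// mulr_ge0.
have {}w1B r : s <= r <= t -> `|w1 r| <= B.
  move=> /w1B /= /le_trans; apply.
  have Ih0 : 0 <= Int (fun r => `|eta r * (a r + cst 1 r * cst x2 r)|) s t.
    by apply: Rintegral_ge0.
  apply: ler_pM; rewrite ?expR_ge0 ?ler_expR//.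
    by rewrite addr_ge0// mulr_ge0 ?expR_ge0.
  by apply: lerD => //; apply: ler_pM; rewrite ?expR_ge0 ?ler_expR.
exists a, w1; split => //.
- split=> //; first exact: tame_cst.
  split=> //; apply: prim_eq (prim_cst s t x2) => // r _.
  by rewrite /a /cst; clear -c eta x20; field; lra.
- by move=> r /aC /le_trans; apply; rewrite lerDl.
- rewrite -w1t distrC; have [tp ->//] := p1.
  apply: le_trans (Int_bound (M := (B + Me) * Cg) st tp _) _.
    move=> r rst; rewrite normrM normrN; apply: ler_pM => //; last exact: gC.
    by apply: le_trans (ler_normD _ _) _; rewrite lerD ?w1B// eM// sT.
  by rewrite ler_wpM2r// lerDr.
Qed.

(** Prescribing [w2] affine, with the slope of the drift at [(a0, b0)], and [b]
    constant, the equation of [w2] determines a continuous control [a] with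
    [a t = a0]. *)
Lemma flow_local (x1 x2 t a0 b0 : R) : 0 < x2 -> 0 < t -> 0 <= b0 ->
  exists h a w1 w2, [/\ 0 < h <= t, flow (t - h) t a (cst b0) w1 w2,
    w1 t = x1, w2 t = x2 & a t = a0 /\ {within `[t - h, t], continuous a}].
Proof.
move=> x20 t0 b00.
(* the slope of [w2]; [h] is so small that [w2 >= x2 / 2] *)
pose f2 := - b0 * x2 ^+ 2 - 2 * a0 * x2 + c t ^+ 2.
pose h := Num.min t (x2 / 2 / (`|f2| + 1)).
have f20 : 0 < `|f2| + 1 by rewrite ltr_wpDl.
have h0 : 0 < h by rewrite lt_min t0 !divr_gt0.
have ht : h <= t by rewrite ge_min lexx.
have hf : h * `|f2| <= x2 / 2.
  apply: (@le_trans _ _ (h * (`|f2| + 1))); first by rewrite ler_wpM2l ?lerDl// ltW.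
  by rewrite -ler_pdivlMr// ge_min lexx orbT.
pose w2 r := x2 + f2 * (r - t).
have sh : t - h <= t by clear -c eta h0; lra.
have p2 : prim (t - h) t w2 (fun r => 0 + f2 * (1 - 0)).
  apply: primD; first exact: prim_cst.
  by apply: primZ; apply: primB; [exact: prim_id|exact: prim_cst].
have w2x r : t - h <= r <= t -> x2 / 2 <= w2 r.
  move=> rt; have : `|f2 * (r - t)| <= h * `|f2|.
    rewrite normrM mulrC ler_wpM2r// ler_norml; clear -c eta rt; lra.
  by rewrite /w2 ler_norml; clear -c eta hf; lra.
have x22 : 0 < x2 / 2 by rewrite divr_gt0.
have pV := prim_inv x22 w2x p2.
pose a r := (c r * c r - b0 * (w2 r * w2 r) - f2) * (2^-1 * (w2 r)^-1).
have cc : {within `[t - h, t], continuous c}.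
  apply: continuous_subspaceW c_cont => r; rewrite /= !in_itv /= andbT => /andP[rt _].
  by clear -c eta rt ht; lra.
have cw2 := prim_within_continuous p2.
have ca : {within `[t - h, t], continuous a}.
  apply: within_mul; last first.
    by apply: within_mul; [exact: within_cst|exact: prim_within_continuous pV].
  apply: within_sub; last exact: within_cst.
  apply: within_sub; first exact: within_mul.
  by apply: within_mul; [exact: within_cst|exact: within_mul].
have ta : tame (t - h) t a by exact: tame_cont.
have th0 : 0 <= t - h by clear -c eta ht; lra.
have [w1 [p1 [w1t _]]] := linear_flow x1 th0 sh ta (tame_cst _ _ b0) (prim_tame p2).
exists h, a, w1, w2; split => //.
- by rewrite h0.
- split => //; first exact: tame_cst.
    by move=> r /w2x; clear -c eta x20; lra.
  split=> //; apply: prim_eq p2 => // r /w2x wr.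
  by rewrite /a /cst; clear -c eta wr x20; field; lra.
- by rewrite /w2 subrr mulr0 addr0.
- split=> //; rewrite /a /w2 subrr mulr0 addr0 /f2; clear -c eta x20; field; lra.
Qed.

End ExplicitFlows.

(** * Positivity and uniqueness of trajectories *)

(** Young's inequality, for the differential inequality satisfied by the squared
    distance of two trajectories. *)
Lemma gronwall_algebra (R : realType) (u v l1 l2 l3 d1 d2 : R) :
  0 <= l1 -> 0 <= l2 -> 0 <= l3 -> 0 <= u -> 0 <= v ->
  - (u * (l1 * u + l2 * v)) <= d1 -> - (v * (l3 * v)) <= d2 ->
  0 <= 2 * d1 + 2 * d2 + (2 * l1 + 2 * l2 + 2 * l3) * (u ^+ 2 + v ^+ 2).
Proof.
move=> l10 l20 l30 u0 v0 H1 H2.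
have P1 := mulr_ge0 l10 (sqr_ge0 v); have P2 := mulr_ge0 l30 (sqr_ge0 u).
have P3 : 0 <= l2 * (u ^+ 2 + v ^+ 2 - u * v).
  apply: mulr_ge0 => //; have := sqr_ge0 (u - v); have := mulr_ge0 u0 v0.
  rewrite !expr2; lra.
move: P1 P2 P3 H1 H2; rewrite !expr2; lra.
Qed.

Section Trajectory.
Context {R : realType} (c eta : R -> R).
Hypothesis c_tame : forall T, tame 0 T c.
Hypothesis eta_tame : forall T, tame 0 T eta.

Local Notation flow := (flow c eta).

(** With the positive part of [z2], one formula covers both branches of the drift
    and shows that it is Lipschitz in the state across the boundary. *)
Let drift1 (z1 z2 r a b : R) := - (z1 + eta r) * (a + b * Num.max z2 0).
Let drift2 (z2 r a b : R) := - b * Num.max z2 0 ^+ 2 - 2 * a * Num.max z2 0 + c r ^+ 2.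

Lemma driftE (z : R * R) (r a b : R) :
  drift c eta z r a b = (drift1 z.1 z.2 r a b, drift2 z.2 r a b).
Proof.
rewrite /drift /drift1 /drift2; case: ifPn => [z0|].
  by rewrite (max_l (ltW z0)).
by rewrite -leNgt => z0; rewrite (max_r z0); congr pair; clear -c eta; ring.
Qed.

Lemma controls_tame (k : (R -> R) * (R -> R)) t : controls k -> tame 0 t k.1 /\ tame 0 t k.2.
Proof.
move=> [m1 m2 k0 kb]; have [[M1 [_ B1]] [M2 [_ B2]]] := kb t.
have sub : `[0, t] `<=` (`[0, +oo[ : set R).
  by move=> r; rewrite /= !in_itv /= andbT => /andP[].
split; split; try exact: measurable_funS sub _.
- exists (M1 + 1) => r rt; apply: (B1 (M1 + 1)); first by rewrite ltrDl.
  by rewrite /= in_itv.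
- exists (M2 + 1) => r rt; apply: (B2 (M2 + 1)); first by rewrite ltrDl.
  by rewrite /= in_itv.
Qed.

Lemma flow_trajectory t k w1 w2 : 0 <= t -> flow 0 t k.1 k.2 w1 w2 ->
  trajectory c eta (w1 t, w2 t) t k (fun r => (w1 r, w2 r)).
Proof.
move=> t0 [ta tb b0 w0 [p1 p2]]; split.
  have := prim_within_continuous p1; have := prim_within_continuous p2.
  move=> /within_continuousP c2 /within_continuousP c1.
  apply/within_continuousP => r rt e e0.
  have [d1 d10 D1] := c1 r rt e e0; have [d2 d20 D2] := c2 r rt e e0.
  exists (Num.min d1 d2); first by rewrite lt_min d10.
  by move=> q qt; rewrite lt_min norm_lt_pair => /andP[/D1-> // /D2->].
move=> s; rewrite in_itv /= => /andP[s0 st]; congr pair.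
- have [_ /(_ _ _ s0 st (lexx _)) H] := p1.
  rewrite -[LHS](subKr (w1 t)) H; congr (_ - _); apply: Int_eq => q /andP[sq qt]; rewrite driftE /= /drift1.
  by rewrite max_l// ltW// w0// qt (le_trans s0 sq).
- have [_ /(_ _ _ s0 st (lexx _)) H] := p2.
  rewrite -[LHS](subKr (w2 t)) H; congr (_ - _); apply: Int_eq => q /andP[sq qt]; rewrite driftE /= /drift2.
  by rewrite max_l// ltW// w0// qt (le_trans s0 sq).
Qed.

Lemma trajectory_prim x t k w : 0 <= t -> controls k -> trajectory c eta x t k w ->
  [/\ prim 0 t (fun r => (w r).1) (fun r => drift1 (w r).1 (w r).2 r (k.1 r) (k.2 r)),
      prim 0 t (fun r => (w r).2) (fun r => drift2 (w r).2 r (k.1 r) (k.2 r)) &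
      w t = x].
Proof.
move=> t0 /(controls_tame t)[ta tb] [/within_continuousP cw Hw].
have tw1 : tame 0 t (fun r => (w r).1).
  apply: tame_cont; apply/within_continuousP => r rt e e0.
  have [d d0 D] := cw r rt e e0; exists d => // q qt /(D _ qt).
  by rewrite prod_normE /= gt_max => /andP[].
have tw2 : tame 0 t (fun r => (w r).2).
  apply: tame_cont; apply/within_continuousP => r rt e e0.
  have [d d0 D] := cw r rt e e0; exists d => // q qt /(D _ qt).
  by rewrite prod_normE /= gt_max => /andP[].
have tc := c_tame t; have te := eta_tame t; have tm := tame_max0 tw2.
have t1 : tame 0 t (fun r => drift1 (w r).1 (w r).2 r (k.1 r) (k.2 r)).
  apply: tameM; first by apply: tameN; exact: tameD.
  by apply: tameD => //; exact: tameM.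
have t2 : tame 0 t (fun r => drift2 (w r).2 r (k.1 r) (k.2 r)).
  apply: tameD; last exact: tameM.
  apply: tameB; apply: tameM => //.
  - exact: tameN.
  - exact: tameM.
  - by apply: tameM => //; exact: tame_cst.
have {}Hw r : 0 <= r <= t ->
    w r = (x.1 - Int (fun r => drift1 (w r).1 (w r).2 r (k.1 r) (k.2 r)) r t,
           x.2 - Int (fun r => drift2 (w r).2 r (k.1 r) (k.2 r)) r t).
  move=> rt; rewrite {1}Hw ?in_itv//.
  by congr (_ - _, _ - _); apply: Int_eq => q _; rewrite driftE.
split.
- split=> // r r' r0 rr' r't.
  have rt : 0 <= r <= t by rewrite r0 (le_trans rr').
  have r't' : 0 <= r' <= t by rewrite r't (le_trans r0).
  have H1 := congr1 fst (Hw _ rt); have H2 := congr1 fst (Hw _ r't').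
  have H3 := @Int_cat R r r' t _ rr' r't (tameS r0 (lexx t) t1).
  by rewrite {}H1 {}H2 /= {}H3; clear -c eta; ring.
- split=> // r r' r0 rr' r't.
  have rt : 0 <= r <= t by rewrite r0 (le_trans rr').
  have r't' : 0 <= r' <= t by rewrite r't (le_trans r0).
  have H1 := congr1 snd (Hw _ rt); have H2 := congr1 snd (Hw _ r't').
  have H3 := @Int_cat R r r' t _ rr' r't (tameS r0 (lexx t) t2).
  by rewrite {}H1 {}H2 /= {}H3; clear -c eta; ring.
- by rewrite Hw ?t0 ?lexx// !Int_refl !subr0; case: x {Hw}.
Qed.

(** The term [c^2] pushes upwards and the others vanish with [w2], so the square of
    the positive part of [w2] decays at most exponentially. *)
Lemma drift_stays_positive t a b (w2 : R -> R) : tame 0 t a -> tame 0 t b ->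
  prim 0 t w2 (fun r => drift2 (w2 r) r (a r) (b r)) -> 0 < w2 0 ->
  forall r, 0 <= r <= t -> 0 < w2 r.
Proof.
move=> ta tb pw w0 r rt; have tw := prim_tame pw.
have [M M0 wM] := tame_bound tw; have [N N0 aN] := tame_bound ta.
have [P P0 bP] := tame_bound tb.
pose L := 2 * P * M + 4 * N.
have pE := prim_exp (primZ L (prim_id 0 t)).
have := prim_ndecr _ (primS (lexx 0) (andP rt).2 (primM (prim_pospart_sqr pw) pE)).
move=> /(_ (andP rt).1) H.
suff : 0 < Num.max (w2 r) 0 ^+ 2.
  by case: (ltP 0 (w2 r)) => // _; rewrite expr2 mulr0 ltxx.
rewrite -(pmulr_lgt0 _ (expR_gt0 (L * id r))); apply: lt_le_trans (H _).
  by rewrite mulr_gt0 ?expR_gt0// (max_l (ltW w0)) exprn_gt0.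
move=> q qr; have qt : 0 <= q <= t by clear -c eta rt qr; lra.
have -> : 2 * Num.max (w2 q) 0 * drift2 (w2 q) q (a q) (b q) * expR (L * id q) +
    Num.max (w2 q) 0 ^+ 2 * (expR (L * id q) * (L * cst 1 q)) =
   expR (L * id q) * (2 * Num.max (w2 q) 0 * drift2 (w2 q) q (a q) (b q) +
     L * Num.max (w2 q) 0 ^+ 2) by rewrite /cst; clear -c eta; ring.
apply: mulr_ge0; first exact: expR_ge0.
rewrite /drift2; have m0 : 0 <= Num.max (w2 q) 0 by rewrite le_max lexx orbT.
have mM : Num.max (w2 q) 0 <= M.
  by rewrite ge_max M0 andbT (le_trans (ler_norm _))// wM.
have := aN _ qt; have := bP _ qt; rewrite !ler_norml => bq aq.
set m := Num.max _ _ in m0 mM *.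
have bm : b q * m <= P * M by apply: (@le_trans _ _ (P * m)); rewrite ?ler_wpM2r ?ler_wpM2l//; case/andP: bq.
have -> : 2 * m * (- b q * m ^+ 2 - 2 * a q * m + c q ^+ 2) + L * m ^+ 2 =
   2 * (m * c q ^+ 2) + m ^+ 2 * (2 * (P * M - b q * m) + 4 * (N - a q)).
  by rewrite /L; clear -c eta; ring.
have aN' : a q <= N by case/andP: aq.
by do ?[exact: sqr_ge0 | exact: ler0n | assumption | rewrite subr_ge0; assumption
       | apply: mulr_ge0 | apply: addr_ge0].
Qed.

(** These are the only trajectories with finite initial cost. *)
Lemma trajectory_flow x t k w : 0 <= t -> controls k -> trajectory c eta x t k w ->
  halfplane (w 0) ->
  flow 0 t k.1 k.2 (fun r => (w r).1) (fun r => (w r).2) /\ w t = x.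
Proof.
move=> t0 ck tr w0; have [p1 p2 wt] := trajectory_prim t0 ck tr.
have [ta tb] := controls_tame t ck; split=> //.
have pos := drift_stays_positive ta tb p2 w0.
have [_ _ k0 _] := ck; split=> //.
  by move=> r /andP[r0 _]; exact: k0.
split; [apply: prim_eq p1|apply: prim_eq p2] => // r rt;
by rewrite /drift1 /drift2 max_l// ltW// pos.
Qed.

(** The squared distance, times an exponential, is nondecreasing in time and
    vanishes at the terminal time. *)
Lemma trajectory_unique x t k w w' : 0 <= t -> controls k ->
  trajectory c eta x t k w -> trajectory c eta x t k w' -> w 0 = w' 0.
Proof.
move=> t0 ck tr tr'; have [p1 p2 wt] := trajectory_prim t0 ck tr.
have [p1' p2' wt'] := trajectory_prim t0 ck tr'.
have [ta tb] := controls_tame t ck.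
have [N N0 aN] := tame_bound ta; have [P P0 bP] := tame_bound tb.
have [M1 M10 wM1] := tame_bound (prim_tame p1).
have [M2 M20 wM2] := tame_bound (prim_tame p2).
have [M1' M10' wM1'] := tame_bound (prim_tame p1').
have [M2' M20' wM2'] := tame_bound (prim_tame p2').
have [Me Me0 eM] := tame_bound (eta_tame t).
pose L1 := N + P * M2; pose L2 := (M1' + Me) * P; pose L3 := P * (M2 + M2') + 2 * N.
pose L := 2 * L1 + 2 * L2 + 2 * L3.
have L10 : 0 <= L1 by rewrite addr_ge0// mulr_ge0.
have L20 : 0 <= L2 by rewrite mulr_ge0// addr_ge0.
have L30 : 0 <= L3 by do ?[assumption | apply: mulr_ge0 | apply: addr_ge0].
have pE := prim_exp (primZ L (prim_id 0 t)).
have pD1 := primB p1 p1'; have pD2 := primB p2 p2'.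
have pD := primM (primD (prim_sqr pD1) (prim_sqr pD2)) pE.
have : forall q, 0 <= q <= t -> 0 <= 
   (2 * ((w q).1 - (w' q).1) * (drift1 (w q).1 (w q).2 q (k.1 q) (k.2 q)
      - drift1 (w' q).1 (w' q).2 q (k.1 q) (k.2 q))
   + 2 * ((w q).2 - (w' q).2) * (drift2 (w q).2 q (k.1 q) (k.2 q)
      - drift2 (w' q).2 q (k.1 q) (k.2 q))) + L * (((w q).1 - (w' q).1) ^+ 2 + ((w q).2 - (w' q).2) ^+ 2).
  move=> q qt.
  have := wM1' _ qt; have := wM2 _ qt; have := wM2' _ qt; have := eM _ qt.
  have := aN _ qt; have := bP _ qt.
  rewrite /drift1 /drift2.
  move: (w q) (w' q) (eta q) (k.1 q) (k.2 q) (c q) => [x1 x2] [y1 y2] e a b cq /=.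
  move=> bq aq eq y2q x2q y1q.
  set u1 := x1 - y1; set u2 := x2 - y2.
  have lip : `|Num.max x2 0 - Num.max y2 0| <= `|u2|.
    rewrite /u2; clear -c eta.
    case: (ltP x2 0) => ?; case: (ltP y2 0) => ?; rewrite ler_norml;
    case: (ler0P (x2 - y2)) => ?; apply/andP; split; lra.
  have maxM (z B : R) : `|z| <= B -> 0 <= Num.max z 0 <= B.
    move=> zB; rewrite le_max lexx orbT ge_max (le_trans (ler_norm z) zB) /=.
    exact: le_trans zB.
  have /andP[X0 XM] := maxM _ _ x2q; have /andP[Y0 YM] := maxM _ _ y2q.
  set X := Num.max x2 0 in lip X0 XM *.
  set Y := Num.max y2 0 in lip Y0 YM *.
  have E1 : `|- (x1 + e) * (a + b * X) - - (y1 + e) * (a + b * Y)| <= L1 * `|u1| + L2 * `|u2|.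
    rewrite (_ : _ - _ = - ((a + b * X) * u1 + (y1 + e) * b * (X - Y))); last first.
      by rewrite /u1; clear -c eta; ring.
    rewrite normrN; apply: le_trans (ler_normD _ _) _; rewrite !normrM; apply: lerD.
      rewrite ler_wpM2r//; apply: le_trans (ler_normD _ _) _; apply: lerD => //.
      by rewrite normrM; apply: ler_pM => //; rewrite ger0_norm.
    apply: ler_pM => //; apply: ler_pM => //.
    by apply: le_trans (ler_normD _ _) _; apply: lerD.
  have E2 : `|- b * X ^+ 2 - 2 * a * X + cq ^+ 2 - (- b * Y ^+ 2 - 2 * a * Y + cq ^+ 2)| <= L3 * `|u2|.
    rewrite (_ : _ - _ = - ((b * (X + Y) + 2 * a) * (X - Y))); last by clear -c eta; ring.
    rewrite normrN normrM; apply: ler_pM => //.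
    apply: le_trans (ler_normD _ _) _; rewrite !normrM (ger0_norm (ler0n _ 2)); apply: lerD.
      by apply: ler_pM => //; rewrite ger0_norm ?addr_ge0// lerD.
    by rewrite ler_wpM2l.
  move: E1 E2; set D1 := (X in `|X| <= L1 * _ + _).
  set D2 := (X in `|X| <= L3 * _ ) => E1 E2; rewrite -/D1 -/D2.
  have H1 : - (`|u1| * (L1 * `|u1| + L2 * `|u2|)) <= u1 * D1.
    rewrite lerNl; apply: le_trans (ler_norm _) _; rewrite normrN normrM ler_wpM2l//.
  have H2 : - (`|u2| * (L3 * `|u2|)) <= u2 * D2.
    rewrite lerNl; apply: le_trans (ler_norm _) _; rewrite normrN normrM ler_wpM2l//.
  rewrite -[u1 ^+ 2]real_normK ?num_real// -[u2 ^+ 2]real_normK ?num_real//.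
  have p0 := normr_ge0 u1; have q0 := normr_ge0 u2.
  rewrite /L -2!mulrA; exact: gronwall_algebra.
move=> Dge0.
have : ((w 0).1 - (w' 0).1) ^+ 2 + ((w 0).2 - (w' 0).2) ^+ 2 <= 0.
  rewrite -(pmulr_lle0 _ (expR_gt0 (L * id (0 : R)))).
  apply: le_trans (prim_ndecr t0 pD _) _ => [q qt|]; last first.
    by rewrite /= wt wt' !subrr (expr0n _ 2) addr0 mul0r.
  apply: le_trans (mulr_ge0 (expR_ge0 (L * id q)) (Dge0 q qt)) _.
  rewrite le_eqVlt; apply/orP; left; apply/eqP; rewrite /cst; clear -c eta; ring.
move=> D0; apply/eqP; rewrite -pair_eqE /pair_eq -(subr_eq0 (w 0).1) -(subr_eq0 (w 0).2).
rewrite -[X in X && _]sqrf_eq0 -[X in _ && X]sqrf_eq0 -paddr_eq0 ?sqr_ge0//.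
by rewrite eq_le D0 addr_ge0 ?sqr_ge0.
Qed.

End Trajectory.

(** * Running cost *)

Section Measurability.
Context {R : realType}.

(** The open set where [h] exceeds a threshold is the union of the countably many
    rational cubes that it contains, and the preimage of a cube is an intersection
    of preimages under the coordinates. *)
Lemma measurable_continuous3 (D : set R) (h : R * R * R -> R) (f1 f2 f3 : R -> R) :
  measurable D -> continuous h ->
  measurable_fun D f1 -> measurable_fun D f2 -> measurable_fun D f3 ->
  measurable_fun D (fun r => h (f1 r, f2 r, f3 r)).
Proof.
move=> mD ch m1 m2 m3.
apply: (measurability _ (RGenOInfty.measurableE R)) => //.
move=> _ [_ [y ->] <-].
pose box (q : rat * rat * rat * rat) (r : R) :=
  [&& `|ratr q.1.1.1 - f1 r| < ratr q.2, `|ratr q.1.1.2 - f2 r| < ratr q.2 &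
      `|ratr q.1.2 - f3 r| < ratr q.2].
pose good (q : rat * rat * rat * rat) :=
  forall z : R * R * R, `|(ratr q.1.1.1, ratr q.1.1.2, ratr q.1.2) - z| < ratr q.2 -> y < h z.
have -> : D `&` (fun r => h (f1 r, f2 r, f3 r)) @^-1` `]y, +oo[%classic =
    \bigcup_(q : rat * rat * rat * rat) (D `&` [set r | good q /\ box q r]).
  apply/seteqP; split=> [r [Dr]|r [q _ [Dr [gq bq]]]]; last first.
    by split=> //=; rewrite in_itv /= andbT; apply: gq; rewrite norm_lt_triple.
  rewrite /= in_itv /= andbT => yh.
  have [d d0 dH] : exists2 d : R, 0 < d & forall z : R * R * R,
      `|(f1 r, f2 r, f3 r) - z| < d -> y < h z.
    have hy : 0 < h (f1 r, f2 r, f3 r) - y by rewrite subr_gt0.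
    have /cvgrPdist_lt/(_ _ hy)/nbhs_ballP[d /= d0 dH] := ch (f1 r, f2 r, f3 r).
    exists d => // z zd; have := dH z; rewrite -ball_normE /= => /(_ zd).
    by rewrite ltr_norml => /andP[_]; rewrite ltrD2l ltrN2.
  have [e ed] := @rat_in_itvoo R 0 (d / 2) (divr_gt0 d0 (ltr0Sn _ 1)).
  move: ed; rewrite in_itv /= => /andP[e0 ed].
  have appr x : exists q, `|ratr q - x| < ratr e :> R.
    have [|q] := @rat_in_itvoo R (x - ratr e) (x + ratr e); first by clear -e0; lra.
    by rewrite in_itv /= => qx; exists q; rewrite ltr_norml; clear -qx; lra.
  have [q1 Q1] := appr (f1 r); have [q2 Q2] := appr (f2 r); have [q3 Q3] := appr (f3 r).
  exists (q1, q2, q3, e) => //; split=> //; split; last by rewrite /box /= Q1 Q2 Q3.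
  move=> z zq; apply: dH; rewrite -(subrKA (ratr q1, ratr q2, ratr q3)).
  apply: le_lt_trans (ler_normD _ _) _; rewrite (splitr d); apply: ltrD.
    by apply: lt_trans ed; rewrite distrC norm_lt_triple /= Q1 Q2 Q3.
  exact: lt_trans ed.
apply: countable_bigcupT_measurable => // q.
have [gq|ngq] := pselect (good q); last first.
  rewrite (_ : _ `&` _ = set0)//; apply/seteqP; split=> // r [_ [gq _]].
  exact: ngq.
rewrite (_ : _ `&` _ = (D `&` f1 @^-1` ball (ratr q.1.1.1 : R) (ratr q.2)) `&`
   ((D `&` f2 @^-1` ball (ratr q.1.1.2 : R) (ratr q.2)) `&`
   (D `&` f3 @^-1` ball (ratr q.1.2 : R) (ratr q.2)))).
  apply: measurableI; last apply: measurableI.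
  - by apply: m1 => //; exact: measurable_ball.
  - by apply: m2 => //; exact: measurable_ball.
  - by apply: m3 => //; exact: measurable_ball.
rewrite /preimage -!ball_normE; apply/seteqP; split=> [r [Dr [_ /and3P[]]]|r [[Dr b1] [[_ b2] [_ b3]]]] //=.
by split=> //; split=> //; apply/and3P; split.
Qed.

End Measurability.

Section RunningCost.
Context {R : realType} (gamma : R -> R -> R -> \bar R).
Hypothesis gamma_ok : running_cost_assumptions gamma.

Lemma gamma_ge0 t a b : 0 <= t -> 0 <= b -> (0 <= gamma t a b)%E.
Proof. by have [_ H _ _ _] := gamma_ok; exact: H. Qed.

(** The factor [M] is arbitrary because the quotient in the growth condition tends to
    infinity, and [|a|^p + b^p] is at least half of [|a| + b] when the latter
    exceeds 2. This freedom is what makes the effort small on short intervals. *)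
Lemma gamma_coercive (T M : R) : 0 <= T -> 0 <= M -> exists2 K : R, 0 <= K &
  forall t a b, 0 <= t <= T -> 0 <= b -> ((M * (`|a| + b) - K)%:E <= gamma t a b)%E.
Proof.
move=> T0 M0; have [_ _ _ [p p1 H] _] := gamma_ok.
have T10 : 0 < T + 1 by rewrite ltr_wpDl.
have [K0 HK] := H _ T10 (2 * M).
pose K := Num.max K0 2.
have K2 : 2 <= K by rewrite le_max lexx orbT.
exists (M * K) => [|t a b tT b0]; first by rewrite mulr_ge0// (le_trans _ K2).
have [small|big] := ltP (`|a| + b) K.
  apply: le_trans (gamma_ge0 a _ b0); last by case/andP: tT.
  by rewrite lee_fin -mulrBr mulr_ge0_le0// subr_le0 ltW.
have tT1 : t \in `[0, T + 1]%R by rewrite in_itv /=; clear -tT; lra.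
have K0K : K0 <= `|a| + b by apply: le_trans big; rewrite le_max lexx.
have := HK a b b0 K0K => /le_trans/(_ (ereal_inf_lbound _)) => /(_ _ (ex_intro2 _ _ t _ erefl)).
move=> /(_ tT1).
have a0 := normr_ge0 a.
have [S Sge] : exists2 S, S = `|a| `^ p + b `^ p & (`|a| + b) / 2 <= S.
  exists (`|a| `^ p + b `^ p) => //.
  have pa := powR_ge0 `|a| p; have pb := powR_ge0 b p.
  have big2 := le_trans K2 big.
  have [ab|/ltW ba] := leP b `|a|.
    have : `|a| <= `|a| `^ p by apply: le1r_powR; [clear -ab big2; lra|exact: ltW].
    clear -ab pb; lra.
  have : b <= b `^ p by apply: le1r_powR; [clear -ba big2; lra|exact: ltW].
  clear -ba pa; lra.
rewrite -Sge => S2.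
have S0 : 0 < S by have := le_trans K2 big; clear -S2; lra.
case: (gamma t a b) (gamma_ge0 a (andP tT).1 b0) => [g| |//] g0; last by rewrite leey.
rewrite inver gt_eqF// -EFinM !lee_fin ler_pdivlMr// => Mg.
have K0' : 0 <= K by rewrite (le_trans _ K2).
have := mulr_ge0 M0 K0'; have : M * (`|a| + b) <= 2 * M * S.
  by rewrite -mulrA [2 * _]mulrC -mulrA ler_wpM2l//; clear -S2; lra.
by clear -Mg; lra.
Qed.

(** The running cost may be infinite where [b = 0]; its truncations are finite and
    uniformly continuous on compact sets. *)
Definition gtrunc (G t a b : R) := fine (mine (gamma t a b) G%:E).

Lemma gtruncP G t a b : 0 <= G -> 0 <= t -> 0 <= b ->
  [/\ 0 <= gtrunc G t a b <= G, ((gtrunc G t a b)%:E <= gamma t a b)%E &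
      gtrunc G t a b < G -> gamma t a b = (gtrunc G t a b)%:E].
Proof.
move=> G0 t0 b0; rewrite /gtrunc; have := gamma_ge0 a t0 b0.
case: (gamma t a b) => [g| |//] g0.
  rewrite -EFin_min /=; split; first by rewrite lee_fin in g0; rewrite le_min g0 G0 ge_min lexx orbT.
    by rewrite lee_fin ge_min lexx.
  by rewrite /Num.min; case: ifP => // _; rewrite ltxx.
rewrite /mine ltNge leey /=; split; [by rewrite G0 lexx|by rewrite leey|by rewrite ltxx].
Qed.

Let quad : set (R * R * R) := [set z | 0 <= z.1.1 /\ 0 <= z.2].

Lemma gtrunc_continuous G : 0 <= G ->
  {within quad, continuous (fun z => gtrunc G z.1.1 z.1.2 z.2)}.
Proof.
move=> G0; have [cg _ _ _ _] := gamma_ok.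
move/subspace_continuousP: cg => cg.
apply/within_continuousP => -[[t a] b] zq e e0.
have near_gamma U : nbhs (gamma t a b) U ->
    exists2 d : R, 0 < d & forall y : R * R * R, quad y -> `|y - (t, a, b)| < d ->
      U (gamma y.1.1 y.1.2 y.2).
  move=> /(cg _ zq) /nbhs_ballP[d d0 dH]; exists d => // y qy yd.
  by apply: dH => //; rewrite -ball_normE /= distrC.
have [t0 b0] := zq.
have := gamma_ge0 a t0 b0; rewrite /gtrunc /=.
move: near_gamma; case: (gamma t a b) => [g| |//] near_gamma g0.
  have [|d d0 dH] := near_gamma (fun x => exists2 r, x = r%:E & `|r - g| < e).
    apply/nbhs_EFin/nbhs_ballP; exists e => //= x; rewrite -ball_normE /= distrC => xg.
    by exists x.
  exists d => // y qy yd; have [r -> rg] := dH y qy yd.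
  rewrite -!EFin_min /=; apply: le_lt_trans rg; rewrite ler_norml.
  case: (ler0P (r - g)) => ?; case: (ltP r G) => ?; case: (ltP g G) => ?; apply/andP; split; lra.
have [|d d0 dH] := near_gamma (fun x => (G%:E < x)%E); first by exists G; split; rewrite ?num_real.
exists d => // y qy yd; have Gy := dH y qy yd.
by rewrite (min_r (ltW Gy)) (min_r (leey _)) subrr normr0.
Qed.

End RunningCost.

Section CostOfControl.
Context {R : realType} (gamma : R -> R -> R -> \bar R).
Hypothesis gamma_ok : running_cost_assumptions gamma.

Let quad : set (R * R * R) := [set z | 0 <= z.1.1 /\ 0 <= z.2].

Definition box (T B : R) : set (R * R * R) :=
  [set z | [/\ 0 <= z.1.1 <= T, `|z.1.2| <= B & 0 <= z.2 <= B]].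

Lemma box_compact T B : compact (box T B).
Proof.
have -> : box T B = ([set` `[0, T]] `*` [set` `[- B, B]]) `*` [set` `[0, B]].
  apply/seteqP; split=> [z [z1 z2 z3]|z [[/= z1 z2] z3]] /=.
    by rewrite !in_itv /= -ler_norml.
  by split; [move: z1|move: z2; rewrite ler_norml|move: z3]; rewrite in_itv.
by apply: compact_setX; [apply: compact_setX|]; exact: segment_compact.
Qed.

Lemma gtrunc_uniform T B G e : 0 <= G -> 0 < e -> exists2 d : R, 0 < d &
  forall t t' a a' b b', box T B (t, a, b) -> box T B (t', a', b') ->
    `|t' - t| < d -> `|a' - a| < d -> `|b' - b| < d ->
    `|gtrunc gamma G t' a' b' - gtrunc gamma G t a b| < e.
Proof.
move=> G0 e0; have cG : {within box T B, continuous (fun z => gtrunc gamma G z.1.1 z.1.2 z.2)}.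
  apply: continuous_subspaceW (gtrunc_continuous gamma_ok G0).
  by move=> z [/andP[z1 _] _ /andP[z3 _]].
have [d d0 dH] := compact_uniform (@box_compact T B) cG e0.
exists d => // t t' a a' b b' bz bz' dt da db.
by apply: (dH (t, a, b) (t', a', b')) => //; rewrite norm_lt_triple /= dt da db.
Qed.

(** A finite value is exceeded by at most 1 in a neighbourhood, by continuity of the
    truncation at a higher level. *)
Lemma gamma_bounded (K : set (R * R * R)) : compact K -> K `<=` quad ->
  (forall z, K z -> (gamma z.1.1 z.1.2 z.2 < +oo)%E) ->
  exists2 C : R, 0 <= C & forall z, K z -> (gamma z.1.1 z.1.2 z.2 <= C%:E)%E.
Proof.
move=> cK Kq Kfin; move/compact_near_coveringP/near_covering_withinP : cK => cK.
have cov : \forall C \near +oo, K `<=` (fun z => (gamma z.1.1 z.1.2 z.2 <= C%:E)%E).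
  apply: cK => z Kz; have [z1 z3] := Kq _ Kz.
  have := gamma_ge0 gamma_ok z.1.2 z1 z3; have := Kfin _ Kz.
  case E: (gamma _ _ _) => [g| |//] // _ g0; rewrite lee_fin in g0.
  have G0 : 0 <= g + 1 by rewrite addr_ge0.
  have /within_continuousP/(_ z (Kq _ Kz) _ (ltr0Sn R 0))[d d0 dH] := gtrunc_continuous gamma_ok G0.
  exists (ball z d, [set C | g + 1 <= C]) => /=.
    by split; [exact: nbhsx_ballx|by apply: nbhs_pinfty_ge; exact: num_real].
  move=> [y C] [yz gC] Ky /=; have [y1 y3] := Kq _ Ky.
  have := dH y (Kq _ Ky); rewrite -ball_normE /= in yz; rewrite distrC => /(_ yz).
  have gz : gtrunc gamma (g + 1) z.1.1 z.1.2 z.2 = g.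
    by rewrite /gtrunc E -EFin_min /= min_l// lerDl.
  have [_ _ gy] := gtruncP gamma_ok y.1.2 G0 y1 y3.
  rewrite gz ltr_norml => /andP[_ H].
  have {}H : gtrunc gamma (g + 1) y.1.1 y.1.2 y.2 < g + 1 by clear -H; lra.
  by rewrite (gy H) lee_fin (le_trans _ gC)// ltW.
have [C [KC C0]] := @filter_ex _ _ _ _ (filterI cov (nbhs_pinfty_ge (num_real 0))).
by exists C.
Qed.

Implicit Types (s t : R) (a b : R -> R).

Definition admissible s t a b :=
  [/\ 0 <= s, tame s t a, tame s t b & forall r, s <= r <= t -> 0 <= b r].

Definition running s t a b : \bar R :=
  (\int[lebesgue_measure]_(r in `[s, t]) gamma r (a r) (b r))%E.

Lemma admissibleS s t s' t' a b : s <= s' -> t' <= t ->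
  admissible s t a b -> admissible s' t' a b.
Proof.
move=> ss tt [s0 ta tb b0]; split; [lra|exact: tameS ta|exact: tameS tb|].
by move=> r rst; apply: b0; clear -ss tt rst; lra.
Qed.

(** The running cost is the pointwise limit of its truncations, which extend
    continuously to all values of the variables. *)
Lemma gamma_measurable s t a b : admissible s t a b ->
  measurable_fun `[s, t] (fun r => gamma r (a r) (b r)).
Proof.
move=> [s0 [ma _] [mb _] b0].
have st r : r \in `[s, t] -> 0 <= r /\ 0 <= b r.
  by rewrite in_itv /= => rst; rewrite b0//; split => //; clear -s0 rst; lra.
apply: (@emeasurable_fun_cvg _ _ _ _ (fun n r => (gtrunc gamma n%:R r (a r) (b r))%:E)).
  move=> n; apply/measurable_EFinP.
  pose h (z : R * R * R) := gtrunc gamma n%:R (Num.max z.1.1 0) z.1.2 (Num.max z.2 0).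
  apply: (@eq_measurable_fun _ _ _ _ _ (fun r => h (r, a r, b r))).
    by move=> r /set_mem /st[r0 br0]; rewrite /h /= !max_l.
  apply: measurable_continuous3 => // z.
  have /within_continuousP cg := gtrunc_continuous gamma_ok (ler0n R n).
  apply/cvgrPdist_lt => e e0.
  have [|d d0 dH] := cg (Num.max z.1.1 0, z.1.2, Num.max z.2 0) _ e e0.
    by split; rewrite /= le_max lexx orbT.
  apply/(@nbhs_ballP R (R * R * R)%type z); exists d => // y; rewrite -ball_normE /= distrC norm_lt_triple /= => /and3P[y1 y2 y3].
  rewrite distrC; apply: (dH (Num.max y.1.1 0, y.1.2, Num.max y.2 0)).
    by split; rewrite /= le_max lexx orbT.
  have maxL (u v : R) : `|u - v| < d -> `|Num.max u 0 - Num.max v 0| < d.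
    apply: le_lt_trans; clear; case: (leP u 0) => ?; case: (leP v 0) => ?;
    rewrite ler_norml; case: (ler0P (u - v)) => ?; apply/andP; split; lra.
  by rewrite norm_lt_triple /= y2 !maxL.
move=> r /st[r0 br0]; have := gamma_ge0 gamma_ok (a r) r0 br0.
case E: (gamma r (a r) (b r)) => [g| |//] g0; rewrite /gtrunc E.
- apply: cvg_near_cst; near=> n; rewrite -EFin_min /= min_l//.
  by near: n; exact: nbhs_infty_ger.
- apply/cvgeryP; under eq_fun do rewrite min_r ?leey//=.
  exact: cvgr_idn.
Unshelve. all: by end_near. Qed.

Lemma running_ge0 s t a b : admissible s t a b -> (0 <= running s t a b)%E.
Proof.
move=> [s0 _ _ b0]; apply: integral_ge0 => r; rewrite /= in_itv /= => rst.
by apply: gamma_ge0 => //; [clear -s0 rst; lra|exact: b0].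
Qed.

Lemma EFin_Int s t (f : R -> R) : tame s t f ->
  (\int[lebesgue_measure]_(r in `[s, t]) (f r)%:E)%E = (Int f s t)%:E.
Proof. by move=> tf; rewrite /Rintegral fineK// integrable_fin_num//; exact: tame_integrable. Qed.

Lemma running_ge s t a b (f : R -> R) : admissible s t a b -> tame s t f ->
  (forall r, s <= r <= t -> ((f r)%:E <= gamma r (a r) (b r))%E) ->
  ((Int f s t)%:E <= running s t a b)%E.
Proof.
move=> ad tf fg; have [s0 _ _ b0] := ad.
have tm := tame_max0 tf.
apply: (@le_trans _ _ (Int (fun r => Num.max (f r) 0) s t)%:E).
  by rewrite lee_fin; apply: Int_le => // r _; rewrite le_max lexx.
rewrite -EFin_Int//; apply: ge0_le_integral => //.
- by move=> r _; rewrite lee_fin le_max lexx orbT.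
- by apply/measurable_EFinP; case: tm.
- exact: gamma_measurable.
- move=> r; rewrite /= in_itv /= => rst; rewrite EFin_max ge_max fg//=.
  by apply: gamma_ge0 => //; [clear -s0 rst; lra|exact: b0].
Qed.

Lemma running_le s t a b (f : R -> R) : admissible s t a b -> tame s t f ->
  (forall r, s <= r <= t -> (gamma r (a r) (b r) <= (f r)%:E)%E) ->
  (running s t a b <= (Int f s t)%:E)%E.
Proof.
move=> ad tf fg; have [s0 _ _ b0] := ad.
rewrite -EFin_Int//; apply: ge0_le_integral => //.
- move=> r; rewrite /= in_itv /= => rst.
  by apply: gamma_ge0 => //; [clear -s0 rst; lra|exact: b0].
- exact: gamma_measurable.
- by apply/measurable_EFinP; case: tf.
Qed.

Lemma running_eq_open s t a b a' b' : admissible s t a b -> admissible s t a' b' ->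
  (forall r, s < r <= t -> a r = a' r /\ b r = b' r) ->
  running s t a b = running s t a' b'.
Proof.
move=> ad ad' e.
have op x y : admissible s t x y -> running s t x y =
    (\int[lebesgue_measure]_(r in `]s, t]) gamma r (x r) (y r))%E.
  move=> /gamma_measurable m; symmetry; apply: integral_itv_obnd_cbnd.
  by apply: measurable_funS m => //; apply: subset_itv => //=; rewrite bnd_simp.
rewrite !op//; apply: eq_integral => r /set_mem; rewrite /= in_itv /= => /e[-> ->]//.
Qed.

Lemma running_cat s u t a b : s <= u -> u <= t -> admissible s t a b ->
  running s t a b = (running s u a b + running u t a b)%E.
Proof.
move=> su ut ad; have m := gamma_measurable ad.
have [s0 _ _ b0] := ad.
have st : [set` `[s, t]] = [set` `[s, u]] `|` [set` `]u, t]].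
  by rewrite -itv_bndbnd_setU// bnd_simp.
rewrite /running {1}st ge0_integral_setU -?st//; last 2 first.
- move=> r; rewrite /= in_itv /= => rst.
  by apply: gamma_ge0 => //; [clear -s0 rst; lra|exact: b0].
- rewrite disj_set2E; apply/eqP/seteqP; split=> // r [/=]; rewrite !in_itv /=.
  by move=> /andP[_ ru] /andP[]; rewrite ltNge ru.
congr (_ + _)%E; apply: integral_itv_obnd_cbnd.
by apply: measurable_funS m => //; apply: subset_itv => //=; rewrite bnd_simp.
Qed.

Lemma running_effort (T M : R) : 0 <= T -> 0 <= M -> exists2 K : R, 0 <= K &
  forall s t a b, admissible s t a b -> s <= t -> t <= T ->
    ((M * effort s t a b - K * (t - s))%:E <= running s t a b)%E.
Proof.
move=> T0 M0; have [K K0 HK] := gamma_coercive gamma_ok T0 M0.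
exists K => // s t a b ad st tT; have [s0 ta tb b0] := ad.
have te : tame s t (fun r => `|a r| + b r) by apply: tameD => //; exact: tame_norm.
have := @running_ge s t a b (fun r => M * (`|a r| + b r) + - K) ad.
rewrite IntD; [|by apply: tameM => //; exact: tame_cst|exact: tame_cst].
rewrite IntZ// Int_cst// mulNr; apply.
  by apply: tameD; [apply: tameM => //|]; exact: tame_cst.
by move=> r rst; apply: HK; [clear -s0 tT rst; lra|exact: b0].
Qed.

End CostOfControl.

(** * Almost optimal trajectories *)

Section NearOptimal.
Context {R : realType} (c eta : R -> R) (gamma : R -> R -> R -> \bar R) (v0 : R * R -> \bar R).
Hypothesis c_tame : forall T, tame 0 T c.
Hypothesis eta_tame : forall T, tame 0 T eta.
Hypothesis gamma_ok : running_cost_assumptions gamma.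
Hypothesis v0_ok : initial_cost_assumptions v0.

Local Notation flow := (flow c eta).
Local Notation V := (value c eta gamma v0).
Local Notation running := (running gamma).

Lemma flow_admissible s t a b w1 w2 : 0 <= s -> flow s t a b w1 w2 -> admissible s t a b.
Proof. by move=> s0 [ta tb b0 _ _]. Qed.

Lemma v0_fin x : 0 < x.2 -> v0 x \is a fin_num.
Proof. by have [_ H _ _ _] := v0_ok; exact: H. Qed.

Lemma v0_sublevel (M : R) : exists2 K : R, 0 <= K & exists2 d : R, 0 < d &
  forall x, (v0 x <= M%:E)%E -> `|x.1| <= K /\ d <= x.2 <= K.
Proof.
have [Vinf _ _ _ [Vb Vd]] := v0_ok.
have [K HK] := Vb (M + 1); have [d d0 Hd] := Vd (M + 1).
exists `|K|; first exact: normr_ge0.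
exists d => // x xM.
have M1 : (v0 x < (M + 1)%:E)%E by apply: le_lt_trans xM _; rewrite lte_fin ltrDl.
have xU : 0 < x.2.
  by apply: contrapT => /Vinf E; move: xM; rewrite E leye_eq.
have xK : `|x| < `|K|.
  apply: lt_le_trans (ler_norm K); rewrite ltNge; apply/negP => /HK.
  by rewrite leNgt M1.
have xd : d <= x.2.
  rewrite leNgt; apply/negP => xd; have := Hd x.1 x.2.
  by rewrite xU xd => /(_ isT); rewrite -surjective_pairing leNgt M1.
move: xK; case: x {xM M1} xU xd => x1 x2 /= xU xd; rewrite norm_lt_pair => /andP[/ltW -> x2K].
by rewrite xd ltW// (le_lt_trans (ler_norm _) x2K).
Qed.

(** The control is extended by zero after time [t] to belong to the class of
    controls; uniqueness identifies its trajectory with the given one. *)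
Lemma value_le_flow t a b w1 w2 : 0 <= t -> flow 0 t a b w1 w2 ->
  (V (w1 t, w2 t) t <= running 0%R t a b + v0 (w1 0%R, w2 0%R))%E.
Proof.
move=> t0 F; have [ta tb b0 w0 [p1 p2]] := F.
pose k := (splice t a (cst 0), splice t b (cst 0)).
have ctl (f : R -> R) : tame 0 t f ->
    measurable_fun (`[0, +oo[ : set R) (splice t f (cst 0)) /\
    forall T : R, [bounded splice t f (cst 0) s | s in `[0, T]].
  move=> [mf [M fM]]; split.
    have -> : [set` `[0 : R, +oo[] = [set` `[0, t]] `|` [set` `]t, +oo[].
      by rewrite -itv_bndbnd_setU// bnd_simp.
    apply/measurable_funU => //; split.
      apply: eq_measurable_fun mf => r /set_mem /=; rewrite in_itv /= /splice => /andP[_ ru].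
      by rewrite ru.
    apply: (@eq_measurable_fun _ _ _ _ _ (cst (0 : R))) => // r /set_mem /=.
    by rewrite in_itv /= /splice andbT => tr; rewrite leNgt tr.
  move=> T; exists M; split; first exact: num_real.
  move=> x Mx r /=; rewrite in_itv /= /splice => /andP[r0 _].
  have M0 : 0 <= M by apply: le_trans (fM 0 _); rewrite ?lexx.
  case: (leP r t) => rt; last by rewrite normr0 ltW// (le_lt_trans M0).
  by apply: le_trans (ltW Mx); apply: fM; rewrite r0.
have [m1 B1] := ctl a ta; have [m2 B2] := ctl b tb.
have kc : controls k.
  split=> //= s s0; rewrite /splice; case: (leP s t) => // st; by apply: b0; rewrite s0 st.
have Fk : flow 0 t k.1 k.2 w1 w2.
  have E1 r : 0 <= r <= t -> a r = k.1 r by rewrite /= /splice => /andP[_ ->].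
  have E2 r : 0 <= r <= t -> b r = k.2 r by rewrite /= /splice => /andP[_ ->].
  split=> //.
  - exact: tame_eq ta.
  - exact: tame_eq tb.
  - by move=> r rt; rewrite -E2// b0.
  - by split; [apply: prim_eq p1|apply: prim_eq p2] => // r rt; rewrite E1// E2.
have tr := flow_trajectory t0 Fk.
apply: (@le_trans _ _ (cost c eta gamma v0 (w1 t, w2 t) t k)).
  by apply: ereal_inf_lbound; exists k.
rewrite /cost; apply: leeD.
  rewrite le_eqVlt; apply/orP; left; apply/eqP; apply: eq_integral => r /set_mem.
  by rewrite /= in_itv /= /splice => /andP[_ ->].
rewrite /initial_cost; case: pselect => [exw|[]]; last by exists (fun r => (w1 r, w2 r)).
by case: cid => w trw /=; rewrite (trajectory_unique c_tame eta_tame t0 kc trw tr).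
Qed.

(** A finite cost forces the trajectory to exist and to start in the half-plane. *)
Lemma value_lt_flow t x (M : \bar R) : 0 <= t -> (V x t < M)%E ->
  exists a b w1 w2, [/\ flow 0 t a b w1 w2, (w1 t, w2 t) = x &
   (running 0%R t a b + v0 (w1 0%R, w2 0%R) < M)%E].
Proof.
move=> t0 /ereal_inf_lt[_ [k kc <-]]; rewrite /cost => cM.
have [ta tb] := controls_tame t kc.
have ad : admissible 0 t k.1 k.2.
  by have [_ _ k0 _] := kc; split=> // r /andP[r0 _]; exact: k0.
have I0 := running_ge0 gamma_ok ad.
move: cM; rewrite /initial_cost; case: pselect => [exw|_]; last first.
  by rewrite addey ?gt_eqF ?(lt_le_trans _ I0)// ltNge leey.
case: cid => w trw /= cM.
have wU : halfplane (w 0).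
  apply: contrapT => nU; have [Vinf _ _ _ _] := v0_ok.
  by move: cM; rewrite Vinf// addey ?gt_eqF ?(lt_le_trans _ I0)// ltNge leey.
have [F wt] := trajectory_flow c_tame eta_tame t0 kc trw wU.
exists k.1, k.2, (fun r => (w r).1), (fun r => (w r).2); split=> //.
  by rewrite wt; case: (x).
by rewrite -surjective_pairing.
Qed.

Lemma v0_lower : exists m : R, forall x, (m%:E <= v0 x)%E.
Proof.
have [Vinf _ [m Hm] _ _] := v0_ok; exists m => x.
by have [/Hm//|/Vinf ->] := pselect (halfplane x); rewrite leey.
Qed.

Lemma value_lower : exists m : R, forall x t, 0 <= t -> (m%:E <= V x t)%E.
Proof.
have [m Hm] := v0_lower; exists m => x t t0.
rewrite leNgt; apply/negP => /(value_lt_flow t0)[a [b [w1 [w2 [F _]]]]].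
rewrite ltNge => /negP; apply; rewrite -[m%:E]add0e; apply: leeD => //.
by apply: running_ge0 => //; apply: flow_admissible F.
Qed.

(** Over a short interval, a trajectory moves little as soon as its effort is small,
    however large its control is pointwise. *)
Lemma flow_displacement (T K : R) : 0 <= T -> 0 <= K -> exists2 C : R, 0 <= C &
  forall s t a b w1 w2, 0 <= s -> s <= t -> t <= T -> flow s t a b w1 w2 ->
    (forall r, s <= r <= t -> `|w1 r| <= K /\ 0 <= w2 r <= K) ->
    forall r, s <= r <= t ->
    `|w1 r - w1 t| <= C * (effort s t a b + (t - s)) /\
    `|w2 r - w2 t| <= C * (effort s t a b + (t - s)).
Proof.
move=> T0 K0.
have [Mc Mc0 cM] := tame_bound (c_tame T); have [Me Me0 eM] := tame_bound (eta_tame T).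
pose C1 := (K + Me) * (1 + K); pose C2 := K ^+ 2 + 2 * K.
have C10 : 0 <= C1 by rewrite mulr_ge0 ?addr_ge0.
have C20 : 0 <= C2 by rewrite addr_ge0 ?sqr_ge0 ?mulr_ge0.
have M20 := sqr_ge0 Mc.
exists (C1 + C2 + Mc ^+ 2); first by do ?[assumption | apply: addr_ge0].
move=> s t a b w1 w2 s0 st tT F wK r rst.
have [ta tb b0 _ [[t1 p1] [t2 p2]]] := F.
have [sr rt] := andP rst.
have te := effort_tame F.
have E0 := effort_ge0 F.
have Er := effort_sub F sr rt (lexx _).
have ts0 : 0 <= t - s by rewrite subr_ge0.
have rs0 : 0 <= t - r by rewrite subr_ge0.
have X0 : 0 <= effort s t a b + (t - s) by exact: addr_ge0.
have ter : tame r t (fun q => `|a q| + b q) by apply: tameS te.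
have facts q : r <= q <= t -> [/\ `|w1 q| <= K, 0 <= w2 q <= K, 0 <= b q,
    `|eta q| <= Me & `|c q| <= Mc].
  move=> qrt; have qst : s <= q <= t by clear -c eta sr qrt; lra.
  have qT : 0 <= q <= T by clear -c eta s0 tT qst; lra.
  by have [? ?] := wK _ qst; split => //; [exact: b0|exact: eM|exact: cM].
split.
- rewrite distrC p1//; apply: le_trans (Int_abs _) _; first by apply: tameS t1.
  apply: (@le_trans _ _ (Int (fun q => C1 * (`|a q| + b q)) r t)).
    apply: Int_le; [by apply: tame_norm; apply: tameS t1|by apply: tameM; [exact: tame_cst|]|].
    move=> q qrt; have [wq w2q bq eq _] := facts _ qrt.
    rewrite normrM normrN /C1 -mulrA; apply: ler_pM => //.
      by apply: le_trans (ler_normD _ _) _; exact: lerD.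
    apply: le_trans (ler_normD _ _) _; rewrite normrM (ger0_norm bq).
    have [w20 w2K] := andP w2q; rewrite (ger0_norm w20) mulrDl mul1r.
    have aq := normr_ge0 (a q).
    apply: (@le_trans _ _ (`|a q| + b q * K)); first by rewrite lerD2l ler_wpM2l.
    rewrite mulrDr addrA [K * b q]mulrC lerD2r -addrA lerDl addr_ge0// mulr_ge0//.
  rewrite IntZ// -/(effort r t a b).
  apply: (@le_trans _ _ (C1 * (effort s t a b + (t - s)))).
    by rewrite ler_wpM2l//; clear -c eta Er ts0; lra.
  by rewrite ler_wpM2r// -addrA lerDl addr_ge0.
- rewrite distrC p2//; apply: le_trans (Int_abs _) _; first by apply: tameS t2.
  have th : tame r t (fun q => C2 * (`|a q| + b q) + Mc ^+ 2).
    by apply: tameD; [apply: tameM => //|]; exact: tame_cst.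
  apply: (@le_trans _ _ (Int (fun q => C2 * (`|a q| + b q) + Mc ^+ 2) r t)).
    apply: Int_le => //; first by apply: tame_norm; apply: tameS t2.
    move=> q qrt; have [_ w2q bq _ cq] := facts _ qrt.
    have [w20 w2K] := andP w2q.
    apply: le_trans (ler_normD _ _) _; apply: lerD; last first.
      by rewrite normrX lerXn2r ?nnegrE.
    have aq := normr_ge0 (a q); have w22 : w2 q ^+ 2 <= K ^+ 2 by rewrite lerXn2r ?nnegrE.
    have -> : - b q * w2 q ^+ 2 - 2 * a q * w2 q = - (b q * w2 q ^+ 2 + (2 * w2 q) * a q).
      by clear -c eta; ring.
    rewrite normrN; apply: (@le_trans _ _ (b q * K ^+ 2 + 2 * K * `|a q|)).
      apply: le_trans (ler_normD _ _) _; apply: lerD.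
        rewrite ger0_norm; first by rewrite ler_wpM2l.
        by rewrite mulr_ge0// sqr_ge0.
      by rewrite normrM ger0_norm ?mulr_ge0// ler_wpM2r// ler_wpM2l.
    rewrite /C2; have H1 := mulr_ge0 aq (sqr_ge0 K); have H2 := mulr_ge0 bq K0.
    by move: H1 H2; set x := `|a q|; clear -c eta; lra.
  rewrite IntD; [|by apply: tameM => //; exact: tame_cst|exact: tame_cst].
  rewrite IntZ// Int_cst// -/(effort r t a b).
  apply: (@le_trans _ _ (C2 * (effort s t a b + (t - s)) + Mc ^+ 2 * (effort s t a b + (t - s)))).
    by apply: lerD; rewrite ler_wpM2l//; clear -c eta Er E0 ts0 sr; lra.
  by rewrite -mulrDl ler_wpM2r// lerD2r lerDr.
Qed.

(** A bound on the cost bounds both the effort, by coercivity, and the starting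
    point, by the growth of the initial cost; the whole trajectory is then confined
    to a compact subset of the half-plane. The constants depend on the bound [M] on
    the value, but not on the required accuracy, which is expressed by [N]. *)
Lemma near_optimal (T M : R) : 0 <= T -> exists A K d : R, [/\ 0 <= A, 0 <= K, 0 < d &
  forall x t, 0 <= t <= T -> (V x t < M%:E)%E -> forall N : \bar R, (V x t < N)%E ->
  exists a b w1 w2, [/\ flow 0 t a b w1 w2, (w1 t, w2 t) = x,
    (running 0%R t a b + v0 (w1 0%R, w2 0%R) < N)%E,
    effort 0 t a b <= A /\ (running 0%R t a b <= A%:E)%E &
    forall r, 0 <= r <= t -> `|w1 r| <= K /\ d <= w2 r <= K]].
Proof.
move=> T0; have [m Hm] := v0_lower.
have [K0 K00 [d0 d00 Hv0]] := v0_sublevel M.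
have [KE KE0 HE] := running_effort gamma_ok T0 (ler01 : 0 <= (1 : R)).
pose A := `|M - m| + KE * T.
have A0 : 0 <= A by rewrite addr_ge0// mulr_ge0.
have [K K'0 [d d'0 HB]] := flow_bounds c_tame eta_tame T0 A0 K00 d00.
exists A, K, d; split=> // x t tT VM N VN.
have t0 : 0 <= t by case/andP: tT.
have [a [b [w1 [w2 [F wt cM]]]]] : exists a b w1 w2, [/\ flow 0 t a b w1 w2, (w1 t, w2 t) = x &
   (running 0%R t a b + v0 (w1 0%R, w2 0%R) < mine M%:E N)%E].
  by apply: value_lt_flow => //; rewrite lt_min VM VN.
exists a, b, w1, w2; move: cM; rewrite lt_min => /andP[cM cN].
have ad := flow_admissible (lexx 0) F.
have I0 := running_ge0 gamma_ok ad.
have v0M : (v0 (w1 0%R, w2 0%R) <= M%:E)%E.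
  by apply: le_trans (ltW cM); rewrite leeDr.
have IM : (running 0%R t a b <= (M - m)%:E)%E.
  rewrite EFinB leeBrDr//; apply: le_trans (ltW cM); apply: leeD => //; exact: Hm.
have EA : effort 0 t a b <= A.
  have := le_trans (HE _ _ _ _ ad t0 (andP tT).2) IM; rewrite lee_fin mul1r subr0.
  have : KE * t <= KE * T by rewrite ler_wpM2l//; case/andP: tT.
  have := ler_norm (M - m); rewrite /A; clear -c eta; lra.
split=> //; first split=> //.
  by apply: le_trans IM _; rewrite lee_fin (le_trans (ler_norm _))// /A lerDl mulr_ge0.
by apply: (HB t a b w1 w2) => //; have [] := Hv0 _ v0M.
Qed.

End NearOptimal.

(** * Dynamic programming *)

Section DynamicProgramming.
Context {R : realType} (c eta : R -> R) (gamma : R -> R -> R -> \bar R) (v0 : R * R -> \bar R).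
Hypothesis c_tame : forall T, tame 0 T c.
Hypothesis eta_tame : forall T, tame 0 T eta.
Hypothesis gamma_ok : running_cost_assumptions gamma.
Hypothesis v0_ok : initial_cost_assumptions v0.

Local Notation flow := (flow c eta).
Local Notation V := (value c eta gamma v0).
Local Notation running := (running gamma).
Local Notation v := (fun x t => fine (value c eta gamma v0 x t)).

Lemma v0_continuous : {within @halfplane R, continuous (fun x => fine (v0 x))}.
Proof.
have [_ _ _ H _] := v0_ok; apply/within_continuousP => x xU e e0.
have [N Nx lipN] := H x xU.
have [L [L0 HL]] := @filter_ex _ _ _ _ (filterI (nbhs_pinfty_gt (num_real 0)) lipN).
have [d d0 dH] := (@nbhs_ballP R (R * R)%type x N).1 Nx.
exists (Num.min d (e / L)); first by rewrite lt_min d0 divr_gt0.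
move=> y yU; rewrite lt_min ltr_pdivlMr// => /andP[yd ye].
apply: le_lt_trans ye; rewrite mulrC; apply: (HL (y, x)); split; split => //=.
  by apply: dH; rewrite -ball_normE /= distrC.
exact: nbhs_singleton.
Qed.

Lemma stay_control (T K d : R) : 0 <= T -> 0 <= K -> 0 < d ->
  exists2 C : R, 0 <= C & forall x s t, `|x.1| <= K -> d <= x.2 <= K ->
    0 <= s -> s <= t -> t <= T ->
  exists a b w1 w2, [/\ flow s t a b w1 w2, (w1 t, w2 t) = x,
    (running s t a b <= (C * (t - s))%:E)%E, `|w1 s - x.1| <= C * (t - s) &
    w2 s = x.2].
Proof.
move=> T0 K0 d0; have [C C0 HC] := flow_stay c_tame eta_tame T0 K0 d0.
pose B := ([set` `[0, T]] `*` [set` `[- C, C]]) `*` [set (1 : R)].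
have cB : compact B.
  by apply: compact_setX; [apply: compact_setX; exact: segment_compact|exact: compact_set1].
have [||G G0 HG] := gamma_bounded gamma_ok cB.
- by move=> z [[/= + _] ->]; rewrite in_itv /= => /andP[].
- move=> z [[/= + _] ->]; rewrite in_itv /= => /andP[z0 _].
  by have [_ _ H _ _] := gamma_ok; exact: H.
exists (C + G) => [|x s t x1 x2 s0 st tT]; first exact: addr_ge0.
have [a [w1 [F wt aC wC]]] := HC _ _ _ _ x1 x2 s0 st tT.
have ts0 : 0 <= t - s by rewrite subr_ge0.
exists a, (cst 1), w1, (cst x.2); split=> //.
- by rewrite wt -surjective_pairing.
- apply: le_trans (running_le gamma_ok (flow_admissible s0 F) (tame_cst s t G) _) _.
    move=> r rst; apply: (HG (r, a r, 1)); split=> //; split; rewrite /= in_itv /=.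
      by clear -c eta s0 tT rst; lra.
    by rewrite -ler_norml; exact: aC.
  by rewrite Int_cst// lee_fin ler_wpM2r// lerDr.
- by apply: le_trans wC _; rewrite ler_wpM2r// lerDl.
Qed.

Lemma value_fin (x : R * R) t : 0 < x.2 -> 0 <= t -> V x t \is a fin_num.
Proof.
move=> x0 t0; have [m Hm] := value_lower c_tame eta_tame gamma_ok v0_ok.
have K0 : 0 <= Num.max `|x.1| x.2 by rewrite le_max normr_ge0.
have [C C0 HC] := stay_control t0 K0 x0.
have [||a [b [w1 [w2 [F wt I wC w2E]]]]] := HC x 0 t _ _ (lexx _) t0 (lexx _).
- by rewrite le_max lexx.
- by rewrite lexx le_max lexx orbT.
have := value_le_flow gamma v0 c_tame eta_tame t0 F; rewrite wt => Vle.
rewrite fin_real// (lt_le_trans _ (Hm x t t0)) ?ltNyr//= (le_lt_trans Vle)//.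
apply: lte_add_pinfty; first by apply: le_lt_trans I _; rewrite ltry.
have /(v0_fin v0_ok) : 0 < (w1 0, w2 0).2 by rewrite /= w2E.
by rewrite fin_numElt => /andP[].
Qed.

Lemma valueE (x : R * R) t : 0 < x.2 -> 0 <= t -> V x t = (v x t)%:E.
Proof. by move=> x0 t0; rewrite fineK// value_fin. Qed.

Lemma value_initial (x : R * R) : 0 < x.2 -> V x 0 = v0 x.
Proof.
move=> x0; apply/eqP; rewrite eq_le; apply/andP; split.
  have K0 : 0 <= Num.max `|x.1| x.2 by rewrite le_max normr_ge0.
  have [C C0 HC] := stay_control (lexx 0) K0 x0.
  have [||a [b [w1 [w2 [F wt I _ _]]]]] := HC x 0 0 _ _ (lexx _) (lexx _) (lexx _).
  - by rewrite le_max lexx.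
  - by rewrite lexx le_max lexx orbT.
  have := value_le_flow gamma v0 c_tame eta_tame (lexx 0) F; rewrite wt => /le_trans; apply.
  by rewrite -[leRHS]add0e leeD2r//; apply: le_trans I _; rewrite subrr mulr0.
rewrite leNgt; apply/negP => /(value_lt_flow c_tame eta_tame gamma_ok v0_ok (lexx 0)).
move=> [a [b [w1 [w2 [F wt]]]]]; rewrite wt ltNge => /negP; apply.
by rewrite -[leLHS]add0e leeD2r//; apply: running_ge0 => //; apply: flow_admissible F.
Qed.

(** Concatenate the given control with an almost optimal one for the point reached at
    time [s]. *)
Lemma dpp_le s t a b w1 w2 : 0 <= s -> s <= t -> flow s t a b w1 w2 ->
  (V (w1 t, w2 t) t <= running s t a b + V (w1 s, w2 s) s)%E.
Proof.
move=> s0 st F; have [_ _ _ w0 _] := F.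
have w2s : 0 < (w1 s, w2 s).2 by apply: w0; rewrite lexx.
apply/lee_addgt0Pr => e e0.
have [|a' [b' [z1 [z2 [F' zs cost_lt]]]]] := @value_lt_flow _ _ _ _ _ c_tame eta_tame gamma_ok v0_ok
    s (w1 s, w2 s) (V (w1 s, w2 s) s + e%:E)%E s0.
  by rewrite lteDl ?value_fin// lte_fin.
have [E1 E2] : z1 s = w1 s /\ z2 s = w2 s by case: zs.
have F2 := flow_splice s0 st F' F E1 E2.
have t0 := le_trans s0 st.
have := value_le_flow gamma v0 c_tame eta_tame t0 F2.
have At f g : splice s f g t = if t <= s then f t else g t by [].
have -> : (splice s z1 w1 t, splice s z2 w2 t) = (w1 t, w2 t).
  rewrite !At; case: leP => // ts; have -> : t = s by apply/le_anti; rewrite ts st.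
  by rewrite E1 E2.
have -> : (splice s z1 w1 0%R, splice s z2 w2 0%R) = (z1 0%R, z2 0%R) by rewrite /splice s0.
move=> /le_trans; apply.
have ad2 := flow_admissible (lexx 0) F2.
rewrite (running_cat gamma_ok s0 st ad2).
have -> : running 0%R s (splice s a' a) (splice s b' b) = running 0%R s a' b'.
  by apply: eq_integral => r /set_mem; rewrite /= in_itv /= /splice => /andP[_ ->].
have -> : running s t (splice s a' a) (splice s b' b) = running s t a b.
  apply: running_eq_open => //.
  - exact: (admissibleS s0 (lexx t) ad2).
  - exact: flow_admissible F.
  - by move=> r /andP[sr _]; rewrite /splice leNgt sr.
rewrite [X in (X + _ <= _)%E]addeC -2!(addeA (running s t a b)) leeD2l//; exact: ltW.
Qed.

(** The part of the trajectory before [s] is a competitor for the point reached at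
    time [s]. *)
Lemma dpp_ge s t a b w1 w2 : 0 <= s -> s <= t -> flow 0 t a b w1 w2 ->
  (running s t a b + V (w1 s, w2 s) s <= running 0%R t a b + v0 (w1 0%R, w2 0%R))%E.
Proof.
move=> s0 st F; have ad := flow_admissible (lexx 0) F.
rewrite (running_cat gamma_ok s0 st ad) [X in (_ <= X + _)%E]addeC -(addeA (running s t a b)) leeD2l//.
by apply: value_le_flow => //; apply: flowS F.
Qed.

Lemma value_sublevel (T M : R) : 0 <= T -> exists2 K : R, 0 <= K & exists2 d : R, 0 < d &
  forall x t, 0 <= t <= T -> (V x t < M%:E)%E -> `|x.1| <= K /\ d <= x.2 <= K.
Proof.
move=> T0; have [A [K [d [A0 K0 d0 H]]]] := near_optimal c_tame eta_tame gamma_ok v0_ok M T0.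
exists K => //; exists d => // x t tT VM.
have [a [b [w1 [w2 [F <- _ _ Hb]]]]] := H x t tT VM _ VM.
by apply: Hb; rewrite lexx (andP tT).1.
Qed.

(** An almost optimal control for one point is used for the other. *)
Lemma value_space_modulus (T M e : R) : 0 <= T -> 0 < e -> exists2 d : R, 0 < d &
  forall x x' t, 0 <= t <= T -> 0 < x.2 -> (V x t < M%:E)%E ->
    `|x'.1 - x.1| <= d -> `|x'.2 - x.2| <= d -> (V x' t <= V x t + e%:E)%E.
Proof.
move=> T0 e0; have e2 : 0 < e / 2 by rewrite divr_gt0.
have [A [K [d [A0 K0 d0 H]]]] := near_optimal c_tame eta_tame gamma_ok v0_ok M T0.
have [C C0 [h0 h00 HS]] := flow_shift c eta_tame T0 A0 K0 d0.
pose B := [set` `[- (K + d), K + d]] `*` [set` `[d / 2, K + d]].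
have d2 : 0 < d / 2 by rewrite divr_gt0.
have BU : B `<=` @halfplane R.
  by move=> x [_]; rewrite /= in_itv /= => /andP[+ _]; exact: lt_le_trans.
have cB : compact B by apply: compact_setX; exact: segment_compact.
have cv : {within B, continuous (fun x => fine (v0 x))} := continuous_subspaceW BU v0_continuous.
have [r r0 Hr] := compact_uniform cB cv e2.
pose h := Num.min h0 (r / 2 / C).
have h_gt0 : 0 < h by rewrite lt_min h00 !divr_gt0.
exists h => // x x' t tT x0 VM xx1 xx2.
have t0 := (andP tT).1.
have VF := value_fin x0 t0.
have [|a [b [w1 [w2 [F wt cost_lt [EA IA] wK]]]]] := H x t tT VM (V x t + (e / 2)%:E)%E.
  by rewrite lteDl// lte_fin.
have [E1 E2] : w1 t = x.1 /\ w2 t = x.2 by rewrite -wt.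
have hh : h <= h0 by rewrite ge_min lexx.
rewrite -E1 in xx1; rewrite -E2 in xx2.
have [z1 [z2 [F' zt1 zt2 z1C [z2C Ch]]]] := HS t a b w1 w2 _ _ h tT F EA wK xx1 xx2 hh.
have := value_le_flow gamma v0 c_tame eta_tame t0 F'; rewrite zt1 zt2 -surjective_pairing.
move=> /le_trans; apply.
have [w10 /andP[w20l w20u]] := wK 0 (introT andP (conj (lexx 0) t0)).
have Bw : B (w1 0, w2 0).
  by split; rewrite /= in_itv /= -?ler_norml; [clear -c eta w10 d0; lra|clear -c eta w20l w20u d0; lra].
have Bz : B (z1 0, z2 0).
  move: z1C z2C w10; rewrite !ler_norml => z1C z2C w10.
  split; rewrite /= in_itv /=; first by clear -c eta z1C Ch d0 w10; lra.
  by clear -c eta z2C Ch d0 w20l w20u; lra.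
have Chr : C * h < r.
  apply: (@le_lt_trans _ _ (r / 2)); last by rewrite ltr_pdivrMr// ltr_pMr// ltrDl.
  by rewrite mulrC -ler_pdivlMr// ge_min lexx orbT.
have := Hr _ _ Bw Bz; rewrite norm_lt_pair (le_lt_trans z1C Chr) (le_lt_trans z2C Chr).
move=> /(_ isT); rewrite ltr_norml => /andP[_ vv].
have vz : (v0 (z1 0%R, z2 0%R) <= v0 (w1 0%R, w2 0%R) + (e / 2)%:E)%E.
  rewrite -[v0 (z1 _, _)]fineK ?(v0_fin v0_ok) ?(BU _ Bz)//.
  rewrite -[v0 (w1 _, _)]fineK ?(v0_fin v0_ok) ?(BU _ Bw)// -EFinD lee_fin.
  by clear -c eta vv; lra.
apply: le_trans (leeD2l _ vz) _; rewrite addeA.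
apply: le_trans (leeD2r _ (ltW cost_lt)) _.
by rewrite -addeA -EFinD -splitr.
Qed.

End DynamicProgramming.

(** * Continuity and growth of the value function *)

Section ValueRegularity.
Context {R : realType} (c eta : R -> R) (gamma : R -> R -> R -> \bar R) (v0 : R * R -> \bar R).
Hypothesis c_tame : forall T, tame 0 T c.
Hypothesis eta_tame : forall T, tame 0 T eta.
Hypothesis gamma_ok : running_cost_assumptions gamma.
Hypothesis v0_ok : initial_cost_assumptions v0.

Local Notation flow := (flow c eta).
Local Notation V := (value c eta gamma v0).
Local Notation running := (running gamma).
Local Notation v := (fun x t => fine (value c eta gamma v0 x t)).

(** By coercivity with the factor [L], the effort is at most [(A + K (t - s)) / L],
    and [L] is at disposal. *)
Lemma effort_small (T A e : R) : 0 <= T -> 0 <= A -> 0 < e -> exists2 h : R, 0 < h &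
  forall s t a b, admissible s t a b -> s <= t -> t <= T -> t - s <= h ->
    (running s t a b <= A%:E)%E -> effort s t a b <= e.
Proof.
move=> T0 A0 e0; pose L := 2 * (A + 1) / e.
have L0 : 0 < L by rewrite divr_gt0// mulr_gt0// ltr_wpDl.
have [K K0 HK] := running_effort gamma_ok T0 (ltW L0).
exists (1 / (K + 1)); first by rewrite divr_gt0// ltr_wpDl.
move=> s t a b ad st tT; rewrite ler_pdivlMr ?ltr_wpDl// => h I.
have := le_trans (HK _ _ _ _ ad st tT) I; rewrite lee_fin => H.
have ts0 : 0 <= t - s by rewrite subr_ge0.
have {}H : L * effort s t a b <= A + 1.
  have := mulr_ge0 K0 ts0; move: h H; rewrite mulrDr mulr1 [(t - s) * K]mulrC.
  by clear -c eta gamma v0 ts0; lra.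
rewrite -(ler_pM2l L0); apply: le_trans H _.
by rewrite /L divfK ?gt_eqF// ler_peMl ?ler1n// addr_ge0.
Qed.

(** If [t <= t'], a control that keeps [w2] constant leads from [(x', t')] back to
    time [t] at small cost. If [t' < t], an almost optimal trajectory for [(x, t)]
    is followed back to time [t'], where it is still close to [x] because its effort
    on the short interval is small. In both cases continuity in space at a fixed
    time concludes. *)
Lemma value_modulus (x0 : R * R) (t0 M e : R) : 0 < x0.2 -> 0 <= t0 -> 0 < e ->
  exists2 d : R, 0 < d & forall x t x' t', 0 < x.2 -> 0 < x'.2 -> 0 <= t -> 0 <= t' ->
    `|(x, t) - (x0, t0)| < d -> `|(x', t') - (x0, t0)| < d ->
    (V x t < M%:E)%E -> (V x' t' <= V x t + e%:E)%E.
Proof.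
move=> x00 t00 e0; pose T := t0 + 1.
have T0 : 0 <= T by rewrite addr_ge0.
pose K := Num.max `|x0.1| x0.2 + 1.
have m0 : 0 <= Num.max `|x0.1| x0.2 by rewrite le_max normr_ge0.
have K0 : 0 <= K by rewrite addr_ge0.
have xd0 : 0 < x0.2 / 2 by rewrite divr_gt0.
have [C C0 HC] := stay_control c_tame eta_tame gamma_ok T0 K0 xd0.
have e20 : 0 < e / 2 by rewrite divr_gt0.
have [d1 d10 Hd1] := value_space_modulus c_tame eta_tame gamma_ok v0_ok (M + e) T0 e20.
have [A [K2 [d2 [A0 K20 d20 HN]]]] := near_optimal c_tame eta_tame gamma_ok v0_ok M T0.
have [C2 C20 HD] := flow_displacement c_tame eta_tame T0 K20.
have C21 : 0 < 3 * (C2 + 1) by rewrite mulr_gt0// ltr_wpDl.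
have [h h0 Hh] := effort_small T0 A0 (divr_gt0 d10 C21).
have C1 : 0 < 4 * (C + 1) by rewrite mulr_gt0// ltr_wpDl.
pose d := Num.min (1 / 2) (Num.min (x0.2 / 2) (Num.min (h / 2)
  (Num.min (d1 / (2 * (3 * (C2 + 1)))) (Num.min (d1 / (4 * (C + 1))) (e / (4 * (C + 1))))))).
exists d; first by rewrite !lt_min xd0 !divr_gt0// mulr_gt0.
move=> x t x' t' x20 x'20 t_0 t'_0; rewrite !norm_lt_triple /= => /and3P[x1 x2 xt] /and3P[x'1 x'2 x't] VM.
have VF := value_fin c_tame eta_tame gamma_ok v0_ok x20 t_0.
have [dx dh d3 d4 d5] : [/\ d <= 1 / 2, d <= x0.2 / 2, d * 2 <= h,
    d * 2 <= d1 / (3 * (C2 + 1)) & d * (4 * (C + 1)) <= Num.min d1 e].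
  have C20' : 0 < C2 + 1 by rewrite ltr_wpDl.
  split; rewrite /d ?ge_min ?lexx ?orbT//.
  - by rewrite -ler_pdivlMr// !ge_min lexx ?orbT.
  - rewrite -ler_pdivlMr// !ge_min (_ : d1 / (2 * (3 * (C2 + 1))) = d1 / (3 * (C2 + 1)) / 2); last first.
      by rewrite [2 * (3 * _)]mulrC invfM mulrA.
    by rewrite lexx !orbT.
  - by rewrite le_min -!ler_pdivlMr// !ge_min !lexx !orbT.
have d_0 : 0 < d by apply: le_lt_trans x1.
have [bK bx bt bt'] : [/\ `|x'.1| <= K, x0.2 / 2 <= x'.2 <= K, t <= T & t' <= T].
  have M1 : `|x0.1| <= Num.max `|x0.1| x0.2 by rewrite le_max lexx.
  have M2 : x0.2 <= Num.max `|x0.1| x0.2 by rewrite le_max lexx orbT.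
  move: x1 x2 xt x'1 x'2 x't; rewrite !ltr_norml => x1 x2 xt x'1 x'2 x't.
  split.
  - by move: M1; rewrite /K !ler_norml; clear -c eta gamma v0 dx x'1; lra.
  - by rewrite /K; clear -c eta gamma v0 dx dh x'2 M2; lra.
  - by rewrite /T; clear -c eta gamma v0 dx xt; lra.
  - by rewrite /T; clear -c eta gamma v0 dx x't; lra.
have close1 : `|x'.1 - x.1| <= d * 2 by move: x1 x'1; rewrite ltr_norml ltr_norml ler_norml; clear -c eta gamma v0; lra.
have close2 : `|x'.2 - x.2| <= d * 2 by move: x2 x'2; rewrite ltr_norml ltr_norml ler_norml; clear -c eta gamma v0; lra.
have closet : `|t' - t| <= d * 2 by move: xt x't; rewrite ltr_norml ltr_norml ler_norml; clear -c eta gamma v0; lra.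
move: d5; rewrite le_min => /andP[d5 d6].
have Cd : 0 <= C * d by rewrite mulr_ge0// ltW.
have [tt'|/ltW t't] := leP t t'.
- have [a [b [w1 [w2 [F wt I wC w2E]]]]] := HC x' t t' bK bx t_0 tt' bt'.
  have ttd : C * (t' - t) <= C * (d * 2).
    by rewrite ler_wpM2l// (le_trans (ler_norm _)).
  have := dpp_le c_tame eta_tame gamma_ok v0_ok t_0 tt' F; rewrite wt => /le_trans; apply.
  have V1 : (V (w1 t, w2 t) t <= V x t + (e / 2)%:E)%E.
    apply: Hd1 => //.
    - by rewrite t_0.
    - by apply: lt_trans VM _; rewrite lte_fin ltrDl.
    - rewrite /= -(subrKA x'.1); apply: le_trans (ler_normD _ _) _.
      by clear -c eta gamma v0 wC close1 ttd d5 d_0 Cd; lra.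
    - by rewrite /= w2E; clear -c eta gamma v0 close2 d5 d_0 Cd; lra.
  apply: le_trans (leeD I V1) _; rewrite addeC -addeA leeD2l// -EFinD lee_fin.
  by clear -c eta gamma v0 ttd d6 d_0 Cd; lra.
- have [|a [b [w1 [w2 [F wt cost_lt [EA IA] wK]]]]] := HN x t (introT andP (conj t_0 bt)) VM (V x t + (e / 2)%:E)%E.
  + by rewrite lteDl// lte_fin.
  have ad := flow_admissible (lexx 0) F.
  have ad' := admissibleS t'_0 (lexx t) ad.
  have I0 := running_ge0 gamma_ok ad'.
  have V1 : (V (w1 t', w2 t') t' <= V x t + (e / 2)%:E)%E.
    apply: le_trans (ltW cost_lt).
    apply: le_trans (dpp_ge v0 c_tame eta_tame gamma_ok t'_0 t't F).
    by rewrite -[leLHS]add0e leeD2r.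
  have w20 : 0 < w2 t' by have [_ _ _ H _] := F; apply: H; rewrite t'_0.
  have I1 : (running t' t a b <= A%:E)%E.
    apply: le_trans IA; rewrite (running_cat gamma_ok t'_0 t't ad) leeDr//.
    by apply: running_ge0 => //; apply: admissibleS ad.
  have tt : t - t' <= d * 2 by move: closet; rewrite ler_norml; clear -c eta gamma v0; lra.
  have E1 := Hh _ _ _ _ ad' t't bt (le_trans tt d3) I1.
  have F' : flow t' t a b w1 w2 by apply: flowS F.
  have Eb r : t' <= r <= t -> `|w1 r| <= K2 /\ 0 <= w2 r <= K2.
    move=> rt; have [|? /andP[? ->]] := wK r; first by clear -c eta gamma v0 t'_0 rt; lra.
    by split=> //; rewrite andbT ltW// (lt_le_trans d20).
  have [|D1 D2] := HD _ _ _ _ _ _ t'_0 t't bt F' Eb t'; first by rewrite lexx.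
  have D : C2 * (effort t' t a b + (t - t')) <= d1 / 3 * 2.
    apply: (@le_trans _ _ ((C2 + 1) * (d1 / (3 * (C2 + 1)) * 2))).
      apply: ler_pM => //; first by rewrite addr_ge0 ?subr_ge0// (effort_ge0 F').
        by rewrite lerDl.
      by clear -c eta gamma v0 E1 tt d4; lra.
    by rewrite le_eqVlt; apply/orP; left; apply/eqP; field; rewrite gt_eqF// ltr_wpDl.
  have d7 : d * 2 <= d1 / 3.
    apply: le_trans d4 _; apply: ler_wpM2l; first exact: ltW.
    by rewrite lef_pV2 ?posrE// ler_peMr// lerDr.
  have [w1t w2t] : w1 t = x.1 /\ w2 t = x.2 by rewrite -wt.
  rewrite w1t in D1; rewrite w2t in D2.
  have V2 : (V x' t' <= V (w1 t', w2 t') t' + (e / 2)%:E)%E.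
    apply: Hd1 => //=.
    - by rewrite t'_0.
    - apply: le_lt_trans V1 _; rewrite EFinD lteD// ?lte_fin//.
      by rewrite ltr_pdivrMr// ltr_pMr// ltrDl.
    - rewrite -(subrKA x.1); apply: le_trans (ler_normD _ _) _.
      by rewrite [`|x.1 - _|]distrC; clear -c eta gamma v0 close1 D1 D d7; lra.
    - rewrite -(subrKA x.2); apply: le_trans (ler_normD _ _) _.
      by rewrite [`|x.2 - _|]distrC; clear -c eta gamma v0 close2 D2 D d7; lra.
  apply: le_trans V2 _; apply: le_trans (leeD2r _ V1) _.
  by rewrite -addeA -EFinD -splitr.
Qed.

Lemma value_continuous : {within @spacetime0 R, continuous (fun z => v z.1 z.2)}.
Proof.
apply/within_continuousP => -[x0 t0] [/= x00 t00] e e0.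
have V0 := valueE c_tame eta_tame gamma_ok v0_ok x00 t00.
have m0 : 0 < Num.min (e / 2) 1 by rewrite lt_min divr_gt0/=.
have [d d0 H] := value_modulus (v x0 t0 + 2) x00 t00 m0.
exists d => // -[x t] [/= x_0 t_0] xd.
have Vx := valueE c_tame eta_tame gamma_ok v0_ok x_0 t_0.
have zd : `|(x0, t0) - (x0, t0)| < d by rewrite subrr normr0.
have := H _ _ _ _ x00 x_0 t00 t_0 zd xd; rewrite V0 Vx lte_fin ltrDl => /(_ (ltr0Sn R 1)).
rewrite -EFinD lee_fin => H1.
have m1 : Num.min (e / 2) 1 <= 1 by rewrite ge_min lexx orbT.
have m2 : Num.min (e / 2) 1 <= e / 2 by rewrite ge_min lexx.
have := H _ _ _ _ x_0 x00 t_0 t00 xd zd; rewrite V0 Vx lte_fin => H2.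
have {}H2 : v x0 t0 <= v x t + Num.min (e / 2) 1.
  by rewrite -lee_fin EFinD; apply: H2; clear -c eta gamma v0 H1 m1; lra.
by rewrite /= ltr_norml; clear -c eta gamma v0 H1 H2 m2 e0; lra.
Qed.

Lemma value_class_Vloc : class_Vloc (fun z => v z.1 z.2).
Proof.
split.
  have [m Hm] := value_lower c_tame eta_tame gamma_ok v0_ok; exists m => -[x t] [/= x0 t0].
  by rewrite -lee_fin -(valueE c_tame eta_tame gamma_ok v0_ok x0 t0) Hm.
move=> T T0; split=> M.
  have [K K0 [d d0 H]] := value_sublevel c_tame eta_tame gamma_ok v0_ok M (ltW T0).
  exists (K + 1) => x x0 xK; apply: le_ereal_inf_tmp => y [t]; rewrite /= in_itv /= => tT <- {y}.
  rewrite -(valueE c_tame eta_tame gamma_ok v0_ok x0 (andP tT).1) leNgt; apply/negP.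
  move=> /(H x t tT)[x1 /andP[_ x2]]; move: xK; rewrite leNgt => /negP; apply.
  case: x x0 x1 x2 {tT} => y1 y2 /= y0 y1K y2K; rewrite norm_lt_pair; apply/andP; split.
    by rewrite (le_lt_trans y1K)// ltrDl.
  by rewrite gtr0_norm// (le_lt_trans y2K)// ltrDl.
have [K K0 [d d0 H]] := value_sublevel c_tame eta_tame gamma_ok v0_ok M (ltW T0).
exists d => // x2 /andP[x20 x2d]; apply: le_ereal_inf_tmp => z [y]; rewrite /= in_itv /= => tT <- {z}.
have x2' : 0 < (y.1, x2).2 by [].
rewrite -(valueE c_tame eta_tame gamma_ok v0_ok x2' (andP tT).1) leNgt; apply/negP.
by move=> /(H _ _ tT)[_ /andP[]]; rewrite /= leNgt x2d.
Qed.

End ValueRegularity.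

(** * The value function is a subsolution *)

Section Subsolution.
Context {R : realType} (c eta : R -> R) (gamma : R -> R -> R -> \bar R) (v0 : R * R -> \bar R).
Hypothesis c_tame : forall T, tame 0 T c.
Hypothesis eta_tame : forall T, tame 0 T eta.
Hypothesis c_cont : {within `[0, +oo[, continuous c}.
Hypothesis eta_cont : {within `[0, +oo[, continuous eta}.
Hypothesis gamma_ok : running_cost_assumptions gamma.
Hypothesis v0_ok : initial_cost_assumptions v0.

Local Notation flow := (flow c eta).
Local Notation V := (value c eta gamma v0).
Local Notation running := (running gamma).
Local Notation v := (fun x t => fine (value c eta gamma v0 x t)).
Local Notation H := (hamiltonian c eta gamma).

(** Coefficients of the drift, paired with the momentum [p], as an affine function of
    the control. *)
Definition slope0 (x : R * R) (t : R) (p : R * R) := c t * c t * p.2.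
Definition slope1 (x : R * R) (t : R) (p : R * R) :=
  0 - (x.1 + eta t) * p.1 - 2 * x.2 * p.2.
Definition slope2 (x : R * R) (t : R) (p : R * R) :=
  0 - (x.1 + eta t) * x.2 * p.1 - x.2 * x.2 * p.2.

Lemma dot_drift (x : R * R) t a b p : 0 < x.2 ->
  dot (drift c eta x t a b) p = slope0 x t p + a * slope1 x t p + b * slope2 x t p.
Proof.
move=> x0; rewrite /dot /drift x0 /slope0 /slope1 /slope2 /=; ring.
Qed.

Lemma hamiltonian_ge x t p a b : 0 <= b ->
  ((dot (drift c eta x t a b) p)%:E - gamma t a b <= H x t p)%E.
Proof. by move=> b0; apply: ereal_sup_ubound; exists (a, b). Qed.

(** The Hamiltonian is tested with a single control. *)
Lemma subsolution_control u phi z : viscosity_subsolution H u -> C1 phi -> spacetime z ->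
  (\forall y \near z, u y - phi y <= u z - phi z) -> forall a b, 0 <= b ->
  ((dt phi z + dot (drift c eta z.1 z.2 a b) (grad phi z))%:E <= gamma z.2 a b)%E.
Proof.
move=> [_ Hu] Cphi zQ loc a b b0.
have := Hu phi Cphi z zQ loc; move=> /(le_trans (leeD2l _ (hamiltonian_ge z.1 z.2 (grad phi z) a b0))).
have := gamma_ge0 gamma_ok a (ltW zQ.2) b0.
case: (gamma z.2 a b) => [g| |//] _; last by rewrite leey.
by rewrite -EFinB -EFinD !lee_fin addrA subr_le0.
Qed.

Lemma hamiltonian_lt x t p (k : R) : (H x t p < k%:E)%E -> exists2 e : R, 0 < e &
  forall a b, 0 <= t -> 0 <= b -> ((dot (drift c eta x t a b) p - k + e)%:E <= gamma t a b)%E.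
Proof.
move=> Hk.
have [e e0 He] : exists2 e : R, 0 < e & (H x t p <= (k - e)%:E)%E.
  move: Hk; case: (H x t p) => [h| |] //.
    by rewrite lte_fin => hk; exists (k - h); [rewrite subr_gt0|rewrite subKr].
  by exists 1 => //; rewrite leNye.
exists e => // a b t0 b0.
have := le_trans (hamiltonian_ge x t p a b0) He.
have := gamma_ge0 gamma_ok a t0 b0.
case: (gamma t a b) => [g| |//] _; last by rewrite leey.
rewrite -EFinB !lee_fin; clear -c_tame eta_tame c_cont eta_cont gamma_ok v0_ok; lra.
Qed.

(** If the inequality failed for the control value [(a0, b0)], then following
    backwards, for a short time, a continuous control that takes this value at time
    [t] would cost less than the increase of the test function, hence less than the
    increase of the value function, which dynamic programming forbids. *)
Lemma value_subsolution : viscosity_subsolution H (fun z => v z.1 z.2).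
Proof.
split; first exact: value_continuous c_tame eta_tame gamma_ok v0_ok.
move=> phi Cphi [x t] [/= x20 t0] loc.
suff hle : (H x t (grad phi (x, t)) <= (- dt phi (x, t))%:E)%E.
  by apply: le_trans (leeD2l _ hle) _; rewrite -EFinD subrr.
apply: ge_ereal_sup => _ [[a0 b0] /= b00 <-].
have := gamma_ge0 gamma_ok a0 (ltW t0) b00.
case gE: (gamma t a0 b0) => [g| |//] g0; last by rewrite addeNy leNye.
rewrite lee_fin in g0; rewrite -EFinB lee_fin leNgt; apply/negP => bad.
pose e := Num.min 1 ((dot (drift c eta x t a0 b0) (grad phi (x, t)) - g + dt phi (x, t)) / 3).
have e0 : 0 < e by rewrite lt_min ltr01 divr_gt0//; move: bad; clear -c_tame eta_tame c_cont eta_cont gamma_ok v0_ok; lra.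
have e1 : e <= 1 by rewrite ge_min lexx.
have e3 : e * 3 <= dot (drift c eta x t a0 b0) (grad phi (x, t)) - g + dt phi (x, t).
  by rewrite -ler_pdivlMr// ge_min lexx orbT.
have [h [a [w1 [w2 [/andP[h0 ht] F w1t w2t [at0 ca]]]]]] :=
  flow_local eta_tame c_cont x.1 a0 x20 t0 b00.
have [_ _ _ w20 [p1 p2]] := F.
have s0 : 0 <= t - h by rewrite subr_ge0.
have stt : t - h <= t by rewrite gerBl ltW.
have tt : t - h <= t <= t by rewrite stt lexx.
have G0 : 0 <= g + 1 by rewrite addr_ge0.
have cg : {within `[t - h, t], continuous (fun r => gtrunc gamma (g + 1) r (a r) b0)}.
  apply/within_continuousP => r rt e' e'0.
  have r0 : 0 <= r by move: rt; rewrite /= in_itv /= => /andP[rt _]; exact: le_trans rt.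
  have /within_continuousP/(_ (r, a r, b0) (conj r0 b00) _ e'0)[d d0 dH] :=
    gtrunc_continuous gamma_ok G0.
  have /within_continuousP/(_ r rt _ d0)[d' d'0 d'H] := ca.
  exists (Num.min d d'); first by rewrite lt_min d0.
  move=> q qt; rewrite lt_min => /andP[qd qd'].
  apply: (dH (q, a q, b0)).
    split=> //=; move: qt; rewrite /= in_itv /= => /andP[qt _]; exact: le_trans qt.
  by rewrite norm_lt_triple /= qd subrr normr0 d0 d'H.
have gt_t : gtrunc gamma (g + 1) t (a t) b0 = g.
  by rewrite at0 /gtrunc gE -EFin_min /= min_l// lerDl.
have /within_continuousP/(_ t _ _ e0)[|d1 d10 D1] := cg; first by rewrite /= in_itv.
pose q r := (grad phi (w1 r, w2 r, r)).1 * (- (w1 r + eta r) * (a r + b0 * w2 r)) +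
  (grad phi (w1 r, w2 r, r)).2 * (- b0 * w2 r ^+ 2 - 2 * a r * w2 r + c r ^+ 2) +
  dt phi (w1 r, w2 r, r).
pose s1 := Num.max (t - h) (t / 2).
have s1t : s1 < t by rewrite gt_max; apply/andP; split; clear -c_tame eta_tame c_cont eta_cont gamma_ok v0_ok h0 t0; lra.
have s10 : 0 < s1 by rewrite lt_max divr_gt0// orbT.
have hs1 : t - h <= s1 by rewrite le_max lexx.
have p1' := primS hs1 (lexx t) p1; have p2' := primS hs1 (lexx t) p2.
have w20' r : s1 <= r <= t -> 0 < w2 r.
  by move=> /andP[sr rt]; apply: w20; rewrite rt (le_trans hs1).
have cq : {within `[s1, t], continuous q}.
  have sub : `[s1, t] `<=` (`[t - h, t] : set R).
    by move=> r; rewrite /= !in_itv /= => /andP[sr ->]; rewrite (le_trans hs1).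
  have sub0 : `[s1, t] `<=` (`[0, +oo[ : set R).
    by move=> r; rewrite /= !in_itv /= andbT => /andP[sr _]; rewrite (le_trans _ sr)// ltW.
  have cw1 := prim_within_continuous p1'; have cw2 := prim_within_continuous p2'.
  have ca' := continuous_subspaceW sub ca.
  have cc := continuous_subspaceW sub0 c_cont.
  have ce := continuous_subspaceW sub0 eta_cont.
  have cD (k : R * R * R) : {within `[s1, t], continuous (fun r => 'D_k phi (w1 r, w2 r, r))}.
    apply: (path_within_continuous p1' p2' _ (Cphi.2 k)) => r rt; split; first exact: w20'.
    by rewrite /= (lt_le_trans s10)//; case/andP: rt.
  have -> : q = fun r => 'D_(1, 0, 0) phi (w1 r, w2 r, r) *
      (0 - (w1 r + eta r) * (a r + b0 * w2 r)) + 'D_(0, 1, 0) phi (w1 r, w2 r, r) *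
      (c r * c r - b0 * (w2 r * w2 r) - 2 * a r * w2 r) + 'D_(0, 0, 1) phi (w1 r, w2 r, r).
    by apply/funext => r; rewrite /q; congr (_ * _ + _ * _ + _); ring.
  apply: within_add; last exact: cD.
  apply: within_add; apply: within_mul; try exact: cD.
    apply: within_sub; first exact: within_cst.
    apply: within_mul; first exact: within_add.
    by apply: within_add => //; apply: within_mul => //; exact: within_cst.
  apply: within_sub; [apply: within_sub|]; first exact: within_mul.
    by apply: within_mul; [exact: within_cst|exact: within_mul].
  by apply: within_mul => //; apply: within_mul => //; exact: within_cst.
have xE : (w1 t, w2 t) = x by rewrite w1t w2t; case: (x).
have qt : q t = dot (drift c eta x t a0 b0) (grad phi (x, t)) + dt phi (x, t).
  rewrite /q xE at0 w1t w2t /dot /drift x20 [_ * (grad _ _).1]mulrC [_ * (grad _ _).2]mulrC.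
  by [].
have /within_continuousP/(_ t _ _ e0)[|d2 d20 D2] := cq; first by rewrite /= in_itv /= ltW/=.
have [d3 d30 D3] := (@nbhs_ballP R (R * R * R)%type (x, t) _).1 loc.
have [L L0 pL] := path_lip p1' p2'.
pose s := Num.max s1 (Num.max (t - d1 / 2) (Num.max (t - d2 / 2) (t - d3 / 2 / L))).
have st : s < t.
  by rewrite gt_max s1t /= gt_max gtrBl divr_gt0//= gt_max !gtrBl !divr_gt0.
have ss1 : s1 <= s by rewrite le_max lexx.
have [sd1 sd2 sd3] : [/\ t - d1 / 2 <= s, t - d2 / 2 <= s & t - d3 / 2 / L <= s].
  by split; rewrite /s !le_max lexx ?orbT.
have Fs : flow s t a (cst b0) w1 w2 by apply: flowS F => //; apply: le_trans ss1.
have s_0 : 0 < s by apply: lt_le_trans ss1.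
have ad := flow_admissible (ltW s_0) Fs.
have near_t r : s <= r <= t -> [/\ s1 <= r <= t, t - h <= r <= t, `|r - t| < d1 & `|r - t| < d2].
  move=> /andP[sr rt]; split.
  - by rewrite rt (le_trans ss1).
  - by rewrite rt (le_trans hs1)// (le_trans ss1).
  - by rewrite ltr_norml; clear -c_tame eta_tame c_cont eta_cont gamma_ok v0_ok d10 sd1 sr rt; lra.
  - by rewrite ltr_norml; clear -c_tame eta_tame c_cont eta_cont gamma_ok v0_ok d20 sd2 sr rt; lra.
have I : (running s t a (cst b0) <= ((g + e) * (t - s))%:E)%E.
  rewrite -(Int_cst _ (ltW st)); apply: running_le => //; first exact: tame_cst.
  move=> r rst; have [_ rt1 rd _] := near_t _ rst.
  have r0 : 0 <= r by apply: le_trans (andP rst).1; exact: ltW.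
  have [_ _ gr] := gtruncP gamma_ok (a r) G0 r0 b00.
  have := D1 r; rewrite /= in_itv /= gt_t => /(_ rt1 rd); rewrite ltr_norml => /andP[_ gl].
  have gl' : gtrunc gamma (g + 1) r (a r) b0 < g + 1 by clear -c_tame eta_tame c_cont eta_cont gamma_ok v0_ok gl e1; lra.
  by rewrite gr// lee_fin; clear -c_tame eta_tame c_cont eta_cont gamma_ok v0_ok gl; lra.
have pphi := prim_chain Cphi s_0 (primS ss1 (lexx t) p1') (primS ss1 (lexx t) p2')
   (fun r rt => w20' r (introT andP (conj (le_trans ss1 (andP rt).1) (andP rt).2))).
have [tq /(_ s t (lexx s) (ltW st) (lexx t)) phiE] := pphi.
have Iq : (g + e * 2) * (t - s) <= Int q s t.
  rewrite -(Int_cst _ (ltW st)); apply: Int_le => //; first exact: tame_cst.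
  move=> r rst; have [rs1 _ _ rd] := near_t _ rst.
  have := D2 r; rewrite /= in_itv /= => /(_ rs1 rd); rewrite qt ltr_norml => /andP[ql _].
  by rewrite /cst; clear -c_tame eta_tame c_cont eta_cont gamma_ok v0_ok ql e3; lra.
rewrite xE in phiE.
have := dpp_le c_tame eta_tame gamma_ok v0_ok (ltW s_0) (ltW st) Fs; rewrite xE => dpp.
have w2s : 0 < (w1 s, w2 s).2 by apply: w20'; rewrite ss1 ltW.
have {}dpp : v x t <= (g + e) * (t - s) + v (w1 s, w2 s) s.
  rewrite -lee_fin EFinD -(valueE c_tame eta_tame gamma_ok v0_ok x20 (ltW t0)).
  rewrite -(valueE c_tame eta_tame gamma_ok v0_ok w2s (ltW s_0)).
  by apply: le_trans dpp _; rewrite leeD2r.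
have := D3 (w1 s, w2 s, s); rewrite -ball_normE /= => locs.
have {}locs : v (w1 s, w2 s) s - phi (w1 s, w2 s, s) <= v x t - phi (x, t).
  apply: locs; have s1s : s1 <= s <= t by rewrite ss1 ltW.
  have s1tt : s1 <= t <= t by rewrite lexx ltW.
  rewrite -xE; apply: le_lt_trans (pL _ _ s1s s1tt) _.
  rewrite ger0_norm ?subr_ge0 ?ltW// mulrC -ltr_pdivlMr//.
  have dL : 0 < d3 / L by rewrite divr_gt0.
  by move: sd3; rewrite mulrAC; clear -c_tame eta_tame c_cont eta_cont gamma_ok v0_ok dL; lra.
move: phiE; rewrite -/q => phiE.
have ts : 0 < e * (t - s) by rewrite mulr_gt0// subr_gt0.
by clear -c_tame eta_tame c_cont eta_cont gamma_ok v0_ok phiE Iq dpp locs ts; lra.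
Qed.

End Subsolution.

(** * The value function is a supersolution *)

Section Supersolution.
Context {R : realType} (c eta : R -> R) (gamma : R -> R -> R -> \bar R) (v0 : R * R -> \bar R).
Hypothesis c_tame : forall T, tame 0 T c.
Hypothesis eta_tame : forall T, tame 0 T eta.
Hypothesis c_cont : {within `[0, +oo[, continuous c}.
Hypothesis eta_cont : {within `[0, +oo[, continuous eta}.
Hypothesis gamma_ok : running_cost_assumptions gamma.
Hypothesis v0_ok : initial_cost_assumptions v0.

Local Notation flow := (flow c eta).
Local Notation V := (value c eta gamma v0).
Local Notation running := (running gamma).
Local Notation v := (fun x t => fine (value c eta gamma v0 x t)).
Local Notation H := (hamiltonian c eta gamma).

Lemma within_time (e : R -> R) : {within `[0, +oo[, continuous e} ->
  {within @spacetime R, continuous (fun z : R * R * R => e z.2)}.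
Proof.
move=> /within_continuousP ce; apply/within_continuousP => x [_ x0] r r0.
have [|d d0 dH] := ce x.2 _ r r0; first by rewrite /= in_itv /= andbT ltW.
exists d => // y [_ y0]; rewrite norm_lt_triple => /and3P[_ _ yx].
by apply: dH => //; rewrite /= in_itv /= andbT ltW.
Qed.

(** Large controls satisfy the inequality by coercivity. For bounded ones both sides
    are uniformly continuous, after truncation of the running cost. *)
Lemma strict_inequality_open phi (z : R * R * R) (e : R) : C1 phi -> spacetime z -> 0 < e ->
  (forall a b, 0 <= b ->
    ((dot (drift c eta z.1 z.2 a b) (grad phi z) + dt phi z + e)%:E <= gamma z.2 a b)%E) ->
  exists2 d : R, 0 < d & forall y, spacetime y -> `|y - z| < d -> forall a b, 0 <= b ->
    ((dot (drift c eta y.1 y.2 a b) (grad phi y) + dt phi y + e / 2)%:E <= gamma y.2 a b)%E.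
Proof.
move=> Cphi zQ e0 Hz; have [x1 x2 xt] := within_coords (@spacetime R).
have ct := within_time c_cont; have et := within_time eta_cont.
have cD := Cphi.2.
pose P0 y := slope0 c y.1 y.2 (grad phi y) + dt phi y.
pose P1 y := slope1 eta y.1 y.2 (grad phi y).
pose P2 y := slope2 eta y.1 y.2 (grad phi y).
have c0 : {within @spacetime R, continuous P0}.
  apply: within_add; last exact: cD.
  by apply: within_mul; [exact: within_mul|exact: cD].
have c1 : {within @spacetime R, continuous P1}.
  apply: within_sub; last first.
    by apply: within_mul; [apply: within_mul => //; exact: within_cst|exact: cD].
  apply: within_sub; first exact: within_cst.
  by apply: within_mul; [exact: within_add|exact: cD].
have c2 : {within @spacetime R, continuous P2}.
  apply: within_sub; last first.
    by apply: within_mul; [exact: within_mul|exact: cD].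
  apply: within_sub; first exact: within_cst.
  by apply: within_mul; [apply: within_mul => //; exact: within_add|exact: cD].
have E y a b : spacetime y ->
    dot (drift c eta y.1 y.2 a b) (grad phi y) + dt phi y = P0 y + a * P1 y + b * P2 y.
  move=> [y20 _]; rewrite dot_drift// /P0 /P1 /P2.
  move: (slope0 _ _ _ _) (slope1 _ _ _ _) (slope2 _ _ _ _) (dt _ _) => u0 u1 u2 w.
  by rewrite addrAC [u0 + _ + w]addrAC.
clearbody P0 P1 P2.
pose Cp := `|P0 z| + `|P1 z| + `|P2 z| + 1.
have [n0 n1 n2] : [/\ 0 <= `|P0 z|, 0 <= `|P1 z| & 0 <= `|P2 z|] by [].
have Cp0 : 0 < Cp by rewrite ltr_wpDl// !addr_ge0.
have [z20 zt0] := zQ.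
have T0 : 0 <= z.2 + 1 by rewrite addr_ge0// ltW.
have [K K0 HK] := gamma_coercive gamma_ok T0 (ltW (ltr_wpDl (ltW Cp0) (@ltr01 R))).
pose B := K + Cp + e.
have B0 : 0 < B by rewrite ltr_wpDl// addr_ge0// ltW.
pose G := Cp * (1 + 2 * B) + e + 1.
have [B0' Cp0' e0'] : [/\ 0 <= B, 0 <= Cp & 0 <= e] by split; exact: ltW.
have G0 : 0 <= G by do ?[assumption | exact: ler0n | exact: ler01 | apply: addr_ge0 | apply: mulr_ge0].
have e4 : 0 < e / 4 by rewrite divr_gt0.
have [d1 d10 D1] := gtrunc_uniform gamma_ok (z.2 + 1) B G0 e4.
pose r := Num.min 1 (e / 4 / (1 + 2 * B)).
have B1 : 0 < 1 + 2 * B by rewrite ltr_wpDr// mulr_ge0// ltW.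
have r0 : 0 < r by rewrite lt_min ltr01 divr_gt0.
have r1 : r <= 1 by rewrite ge_min lexx.
have rB : r * (1 + 2 * B) <= e / 4 by rewrite -ler_pdivlMr// ge_min lexx orbT.
have /within_continuousP/(_ z zQ r r0)[d2 d20 D2] := c0.
have /within_continuousP/(_ z zQ r r0)[d3 d30 D3] := c1.
have /within_continuousP/(_ z zQ r r0)[d4 d40 D4] := c2.
exists (Num.min 1 (Num.min d1 (Num.min d2 (Num.min d3 d4)))).
  by rewrite !lt_min ltr01 d10 d20 d30 d40.
move=> y yQ; rewrite !lt_min => /and5P[yz y1 y2 y3 y4] a b b0.
have [y20 yt0] := yQ; rewrite E//.
have Q0 := ltW (D2 y yQ y2); have Q1 := ltW (D3 y yQ y3); have Q2 := ltW (D4 y yQ y4).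
have yT : 0 <= y.2 <= z.2 + 1.
  rewrite ltW//=; move: yz; rewrite norm_lt_triple => /and3P[_ _].
  by rewrite ltr_norml => /andP[_]; clear -c_tame eta_tame c_cont eta_cont gamma_ok v0_ok; lra.
have a0 := normr_ge0 a.
have [small|big] := ltP (`|a| + b) B; last first.
  apply: le_trans (HK y.2 a b yT b0); rewrite lee_fin.
  have A1 : P0 y <= Cp.
    move: Q0; rewrite ler_norml => /andP[_]; have := ler_norm (P0 z); rewrite /Cp.
    by clear -c_tame eta_tame c_cont eta_cont gamma_ok v0_ok r1 n0 n1 n2; lra.
  have A2 : a * P1 y <= `|a| * Cp.
    apply: le_trans (ler_norm _) _; rewrite normrM ler_wpM2l//.
    have : `|P1 y| <= `|P1 z| + r by rewrite -[P1 y](subrK (P1 z)) addrC (le_trans (ler_normD _ _))// lerD2l.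
    by rewrite /Cp; clear -c_tame eta_tame c_cont eta_cont gamma_ok v0_ok r1 n0 n1 n2; lra.
  have A3 : b * P2 y <= b * Cp.
    rewrite ler_wpM2l//; apply: le_trans (ler_norm _) _.
    have : `|P2 y| <= `|P2 z| + r by rewrite -[P2 y](subrK (P2 z)) addrC (le_trans (ler_normD _ _))// lerD2l.
    by rewrite /Cp; clear -c_tame eta_tame c_cont eta_cont gamma_ok v0_ok r1 n0 n1 n2; lra.
  move: big A1 A2 A3; rewrite /B.
  by clear -c_tame eta_tame c_cont eta_cont gamma_ok v0_ok e0 Cp0; lra.
have [gt1 gt2 _] := gtruncP gamma_ok a G0 (ltW yt0) b0.
apply: le_trans gt2; rewrite lee_fin.
have aB : `|a| <= B by apply: le_trans (ltW small); rewrite lerDl.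
have bB : 0 <= b <= B by rewrite b0/=; apply: le_trans (ltW small); rewrite lerDr.
have gz : P0 z + a * P1 z + b * P2 z + e <= gtrunc gamma G z.2 a b.
  have := Hz a b b0; rewrite E// /gtrunc.
  have EG : P0 z + a * P1 z + b * P2 z + e <= G.
    have A1 : P0 z <= Cp.
      by have := ler_norm (P0 z); rewrite /Cp; clear -c_tame eta_tame c_cont eta_cont gamma_ok v0_ok n1 n2; lra.
    have A2 : a * P1 z <= Cp * B.
      apply: le_trans (ler_norm _) _; rewrite normrM mulrC; apply: ler_pM => //.
      by rewrite /Cp; clear -c_tame eta_tame c_cont eta_cont gamma_ok v0_ok n0 n1 n2; lra.
    have A3 : b * P2 z <= Cp * B.
      apply: le_trans (ler_norm _) _; rewrite normrM mulrC; apply: ler_pM => //.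
        by rewrite /Cp; clear -c_tame eta_tame c_cont eta_cont gamma_ok v0_ok n0 n1 n2; lra.
      by rewrite ger0_norm//; case/andP: bB.
    by move: A1 A2 A3; rewrite /G; clear -c_tame eta_tame c_cont eta_cont gamma_ok v0_ok; lra.
  have := gamma_ge0 gamma_ok a (ltW zt0) b0.
  case: (gamma z.2 a b) => [g| |//] g0; last by rewrite min_r ?leey.
  by rewrite -EFin_min /= lee_fin le_min EG andbT.
have boxz : box (z.2 + 1) B (z.2, a, b) by split=> //=; rewrite ltW//= lerDl.
have boxy : box (z.2 + 1) B (y.2, a, b) by [].
have := D1 _ _ _ _ _ _ boxz boxy; rewrite !subrr normr0 d10.
move: y1; rewrite norm_lt_triple => /and3P[_ _ y1] /(_ y1 isT isT).
rewrite ltr_norml => /andP[gy _].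
have diff : P0 y + a * P1 y + b * P2 y <= P0 z + a * P1 z + b * P2 z + e / 4.
  rewrite -lerBlDl (_ : _ - _ = (P0 y - P0 z) + a * (P1 y - P1 z) + b * (P2 y - P2 z)); last first.
    by clear -c_tame eta_tame c_cont eta_cont gamma_ok v0_ok; ring.
  apply: le_trans rB; have r0' := ltW r0.
  have A1 : P0 y - P0 z <= r by apply: le_trans Q0; exact: ler_norm.
  have A2 : a * (P1 y - P1 z) <= r * B.
    by apply: le_trans (ler_norm _) _; rewrite normrM mulrC; apply: ler_pM.
  have A3 : b * (P2 y - P2 z) <= r * B.
    apply: le_trans (ler_norm _) _; rewrite normrM mulrC; apply: ler_pM => //.
    by rewrite ger0_norm//; case/andP: bB.
  by move: A1 A2 A3; clear -c_tame eta_tame c_cont eta_cont gamma_ok v0_ok; lra.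
by clear -c_tame eta_tame c_cont eta_cont gamma_ok v0_ok gy gz diff; lra.
Qed.

(** Otherwise the strict reverse inequality holds near the contact point, uniformly
    in the control. Almost optimal trajectories stay there for a short time;
    integrated along one of them, the inequality contradicts its near-optimality. *)
Lemma value_supersolution : viscosity_supersolution H (fun z => v z.1 z.2).
Proof.
split; first exact: value_continuous c_tame eta_tame gamma_ok v0_ok.
move=> phi Cphi [x t] zQ loc; have [/= x20 t0] := zQ.
rewrite leNgt; apply/negP => neg.
have {neg}hlt : (H x t (grad phi (x, t)) < (- dt phi (x, t))%:E)%E.
  move: neg => /=; case: (H x t _) => [h| |] //.
    by rewrite -EFinD !lte_fin -ltrBrDl sub0r.
  by move=> _; exact: ltNyr.
have [e e0 He] := hamiltonian_lt gamma_ok hlt.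
have [d d0 Hd] : exists2 d : R, 0 < d & forall y, spacetime y -> `|y - (x, t)| < d ->
    forall a b, 0 <= b ->
    ((dot (drift c eta y.1 y.2 a b) (grad phi y) + dt phi y + e / 2)%:E <= gamma y.2 a b)%E.
  apply: strict_inequality_open => // a b b0.
  by have := He a b (ltW t0) b0; rewrite opprK.
have [d3 d30 D3] := (@nbhs_ballP R (R * R * R)%type (x, t) _).1 loc.
have T0 := ltW t0.
have Vx := valueE c_tame eta_tame gamma_ok v0_ok x20 T0.
have [A [K [d2 [A0 K0 d20 HN]]]] := near_optimal c_tame eta_tame gamma_ok v0_ok (v x t + 1) T0.
have [C C0 HD] := flow_displacement c_tame eta_tame T0 K0.
pose m := Num.min d d3.
have m0 : 0 < m by rewrite lt_min d0.
have C1' : 0 < 2 * (C + 1) by rewrite mulr_gt0// ltr_wpDl.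
have [h1 h10 Hh] := effort_small gamma_ok T0 A0 (divr_gt0 m0 C1').
pose h := Num.min (m / (4 * (C + 1))) (Num.min h1 (t / 2)).
have h0 : 0 < h by rewrite !lt_min h10 !divr_gt0// mulr_gt0// ltr_wpDl.
have ht : h <= t / 2 by rewrite !ge_min lexx !orbT.
have hh1 : h <= h1 by rewrite !ge_min lexx !orbT.
have hm : h <= m / (4 * (C + 1)) by rewrite ge_min lexx.
pose s := t - h.
have s0 : 0 < s by rewrite /s; clear -c_tame eta_tame c_cont eta_cont gamma_ok v0_ok ht t0; lra.
have st : s < t by rewrite gtrBl.
have ts : t - s = h by rewrite /s subKr.
have htp : 0 < e / 4 * h by rewrite mulr_gt0// divr_gt0.
have [||a [b [w1 [w2 [F wt cost_lt [EA IA] wK]]]]] :=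
    HN x t (introT andP (conj T0 (lexx t))) _ (V x t + (e / 4 * h)%:E)%E.
- by rewrite Vx lte_fin ltrDl.
- by rewrite Vx -EFinD lte_fin ltrDl.
have ad := flow_admissible (lexx 0) F.
have ad' := admissibleS (ltW s0) (lexx t) ad.
have F' : flow s t a b w1 w2 by apply: flowS F => //; exact: ltW.
have I1 : (running s t a b <= A%:E)%E.
  apply: le_trans IA; rewrite (running_cat gamma_ok (ltW s0) (ltW st) ad) leeDr//.
  apply: running_ge0 => //; apply: admissibleS ad => //; exact: ltW.
have E1 : effort s t a b <= m / (2 * (C + 1)).
  by apply: Hh ad' (ltW st) (lexx t) _ I1; rewrite ts.
have Eb r : s <= r <= t -> `|w1 r| <= K /\ 0 <= w2 r <= K.
  move=> /andP[sr rt]; have [|? /andP[? ->]] := wK r; first by rewrite rt (le_trans (ltW s0)).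
  by split=> //; rewrite andbT ltW// (lt_le_trans d20).
have close r : s <= r <= t -> `|((w1 r, w2 r, r) : R * R * R) - (x, t)| < m.
  move=> rst; have [D1 D2] := HD _ _ _ _ _ _ (ltW s0) (ltW st) (lexx t) F' Eb r rst.
  have D : C * (effort s t a b + (t - s)) < m.
    apply: (@le_lt_trans _ _ (C * (m / (2 * (C + 1)) + m / (4 * (C + 1))))).
      by rewrite ler_wpM2l// ts lerD.
    apply: (@lt_le_trans _ _ ((C + 1) * (m / (2 * (C + 1)) + m / (4 * (C + 1))))).
      rewrite ltr_pM2r ?ltrDl// addr_gt0// divr_gt0// mulr_gt0// ltr_wpDl//.
    have fe (k : R) : (C + 1) * (k / (2 * (C + 1)) + k / (4 * (C + 1))) = k * (3 / 4).
      by field; rewrite gt_eqF// ltr_wpDl.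
    rewrite fe.
    by rewrite ler_piMr//; [exact: ltW|rewrite ler_pdivrMr// mul1r ler_nat].
  have [w1t w2t] : w1 t = x.1 /\ w2 t = x.2 by rewrite -wt.
  rewrite norm_lt_triple /= -w1t -w2t (le_lt_trans D1 D) (le_lt_trans D2 D) /=.
  have hm' : h < m.
    apply: le_lt_trans hm _; rewrite ltr_pdivrMr ?mulr_gt0 ?ltr_wpDl// ltr_pMr//.
    by clear -c_tame eta_tame c_cont eta_cont gamma_ok v0_ok C0; lra.
  case/andP: rst => sr rt; rewrite ltr_norml.
  by move: sr; rewrite /s; clear -c_tame eta_tame c_cont eta_cont gamma_ok v0_ok hm' rt m0; lra.
have [_ _ b0 w20 [p1 p2]] := F'.
have pphi := prim_chain Cphi s0 p1 p2 w20.
have [tq /(_ s t (lexx s) (ltW st) (lexx t))] := pphi.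
set q := (fun r => _ + _) in tq *; move=> phiE.
have Iq : ((Int (fun r => q r + e / 2) s t)%:E <= running s t a b)%E.
  apply: running_ge => //; first by apply: tameD => //; exact: tame_cst.
  move=> r rst; have rQ : spacetime (w1 r, w2 r, r).
    by split; [exact: w20|rewrite /= (lt_le_trans s0)//; case/andP: rst].
  have rd : `|((w1 r, w2 r, r) : R * R * R) - (x, t)| < d.
    by apply: lt_le_trans (close r rst) _; rewrite ge_min lexx.
  have := Hd _ rQ rd (a r) (b r) (b0 _ rst).
  rewrite /dot /drift /= (w20 _ rst) /=.
  by rewrite [_ * (grad _ _).1]mulrC [_ * (grad _ _).2]mulrC.
have s1 : s <= s <= t by rewrite lexx ltW.
have w2s : 0 < (w1 s, w2 s).2 by exact: w20.
have := dpp_ge v0 c_tame eta_tame gamma_ok (ltW s0) (ltW st) F.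
move=> /le_lt_trans/(_ cost_lt).
rewrite Vx (valueE c_tame eta_tame gamma_ok v0_ok w2s (ltW s0)) => dpp.
have {}dpp : Int (fun r => q r + e / 2) s t + v (w1 s, w2 s) s < v x t + e / 4 * h.
  by rewrite -lte_fin !EFinD; apply: le_lt_trans dpp; rewrite leeD2r.
have := D3 (w1 s, w2 s, s); rewrite -ball_normE /= distrC => locs.
have {}locs : v x t - phi (x, t) <= v (w1 s, w2 s) s - phi (w1 s, w2 s, s).
  by apply: locs; apply: lt_le_trans (close s s1) _; rewrite ge_min lexx orbT.
move: dpp; rewrite IntD//; last exact: tame_cst.
rewrite (Int_cst (e / 2) (ltW st)) ts -phiE wt => dpp.
by clear -c_tame eta_tame c_cont eta_cont gamma_ok v0_ok dpp locs htp; lra.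
Qed.

End Supersolution.

(** * Smooth test functions *)

Section Smooth.
Context {R : realType}.
Implicit Types (f g p q : R * R * R -> R).

(** Test functions together with their gradient, whose components are parameters
    so that the closure rules below compute it. *)
Definition smooth f p1 p2 p3 :=
  (forall z : R * R * R, is_diff z f (fun h : R * R * R => h.1.1 * p1 z + h.1.2 * p2 z + h.2 * p3 z : R)) /\
  [/\ continuous p1, continuous p2 & continuous p3].

Lemma continuous_add f g : continuous f -> continuous g -> continuous (fun z => f z + g z).
Proof. by move=> cf cg z; apply: continuousD; [exact: cf|exact: cg]. Qed.

Lemma continuous_mul f g : continuous f -> continuous g -> continuous (fun z => f z * g z).
Proof. by move=> cf cg z; apply: continuousM; [exact: cf|exact: cg]. Qed.

Lemma smooth_C1 f p1 p2 p3 : smooth f p1 p2 p3 -> C1 f.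
Proof.
move=> [df [c1 c2 c3]]; split=> [z _|h]; first by have [] := df z.
have -> : (fun z => 'D_h f z) = fun z => h.1.1 * p1 z + h.1.2 * p2 z + h.2 * p3 z.
  by apply/funext => z; have [dfz e] := df z; rewrite deriveE// e.
apply: within_add; [apply: within_add|]; (apply: within_mul; [exact: within_cst|exact: continuous_subspaceT]).
Qed.

Lemma smooth_grad f p1 p2 p3 z : smooth f p1 p2 p3 -> grad f z = (p1 z, p2 z) /\ dt f z = p3 z.
Proof.
move=> [df _]; have [dfz e] := df z; rewrite /grad /dt !deriveE// e /=.
by rewrite !mul1r !mul0r !addr0 !add0r.
Qed.

Lemma smooth_continuous f p1 p2 p3 : smooth f p1 p2 p3 -> continuous f.
Proof. by move=> [df _] z; have [dfz _] := df z; exact: differentiable_continuous. Qed.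

Lemma smooth_ext f p1 p2 p3 q1 q2 q3 : p1 =1 q1 -> p2 =1 q2 -> p3 =1 q3 ->
  smooth f p1 p2 p3 -> smooth f q1 q2 q3.
Proof. by move=> /funext <- /funext <- /funext <-. Qed.

Lemma smooth_cst (k : R) : smooth (fun=> k) (fun=> 0) (fun=> 0) (fun=> 0).
Proof.
split; last by split=> z; exact: cst_continuous.
move=> z; have := is_diff_cst k z.
by congr (is_diff _ _ _); apply/funext => h /=; rewrite !mulr0 !addr0.
Qed.

Lemma smoothD f g p1 p2 p3 q1 q2 q3 : smooth f p1 p2 p3 -> smooth g q1 q2 q3 ->
  smooth (fun z => f z + g z) (fun z => p1 z + q1 z) (fun z => p2 z + q2 z) (fun z => p3 z + q3 z).
Proof.
move=> [df [c1 c2 c3]] [dg [d1 d2 d3]]; split; last first.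
  by split; exact: continuous_add.
move=> z; have := @is_diffD _ _ _ f g _ _ z (df z) (dg z).
by congr (is_diff _ _ _); apply/funext => h; rewrite !fctE; ring.
Qed.

Lemma smoothM f g p1 p2 p3 q1 q2 q3 : smooth f p1 p2 p3 -> smooth g q1 q2 q3 ->
  smooth (fun z => f z * g z) (fun z => f z * q1 z + g z * p1 z)
    (fun z => f z * q2 z + g z * p2 z) (fun z => f z * q3 z + g z * p3 z).
Proof.
move=> sf sg; have cf := smooth_continuous sf; have cg := smooth_continuous sg.
move: sf sg => [df [c1 c2 c3]] [dg [d1 d2 d3]]; split; last first.
  by split; apply: continuous_add; exact: continuous_mul.
move=> z; have := @is_diffM _ _ f g _ _ z (df z) (dg z).
by congr (is_diff _ _ _); apply/funext => h; rewrite !fctE /GRing.scale /=; ring.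
Qed.

Lemma smooth_coords : [/\ smooth (fun z => z.1.1) (fun=> 1) (fun=> 0) (fun=> 0),
  smooth (fun z => z.1.2) (fun=> 0) (fun=> 1) (fun=> 0) &
  smooth (fun z => z.2) (fun=> 0) (fun=> 0) (fun=> 1)].
Proof.
have c (k : R) : continuous (fun _ : R * R * R => k) by move=> z; exact: cst_continuous.
have dfst (V W : normedModType R) (x : V * W) : is_diff x fst fst.
  by apply: DiffDef; [apply: linear_differentiable|rewrite diff_lin//] => y; exact: cvg_fst.
have dsnd (V W : normedModType R) (x : V * W) : is_diff x snd snd.
  by apply: DiffDef; [apply: linear_differentiable|rewrite diff_lin//] => y; exact: cvg_snd.
split; split=> // z.
- have := @is_diff_comp _ _ _ _ fst fst fst fst z (dfst _ _ z) (dfst _ _ z.1).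
  by congr (is_diff _ _ _); apply/funext => h /=; ring.
- have := @is_diff_comp _ _ _ _ fst fst snd snd z (dfst _ _ z) (dsnd _ _ z.1).
  by congr (is_diff _ _ _); apply/funext => h /=; ring.
- have := dsnd _ _ z.
  by congr (is_diff _ _ _); apply/funext => h /=; ring.
Qed.

Lemma smooth_time_power (n : nat) :
  smooth (fun z => z.2 ^+ n) (fun=> 0) (fun=> 0) (fun z => n%:R * z.2 ^+ n.-1).
Proof.
have [_ _ st] := smooth_coords.
elim: n => [|n IH].
  have := smooth_cst 1; rewrite (_ : (fun=> 1) = fun z : R * R * R => z.2 ^+ 0); last by apply/funext.
  by apply: smooth_ext => // z; rewrite mul0r.
have := smoothM st IH; rewrite (_ : (fun z => _ * _) = fun z : R * R * R => z.2 ^+ n.+1); last first.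
  by apply/funext => z; rewrite exprS.
apply: smooth_ext => z /=; [by rewrite !mulr0 addr0|by rewrite !mulr0 addr0|].
by case: n {IH} => [|n] /=; rewrite -?natr1 ?exprS ?expr0; ring.
Qed.

Lemma smoothZ (k : R) f p1 p2 p3 : smooth f p1 p2 p3 ->
  smooth (fun z => k * f z) (fun z => k * p1 z) (fun z => k * p2 z) (fun z => k * p3 z).
Proof.
by move=> /(smoothM (smooth_cst k)); apply: smooth_ext => z; rewrite mulr0 addr0.
Qed.

End Smooth.

(** * Sub- and supersolutions at points of contact *)

Section Touching.
Context {R : realType} (c eta : R -> R) (gamma : R -> R -> R -> \bar R).
Hypothesis gamma_ok : running_cost_assumptions gamma.

Local Notation H := (hamiltonian c eta gamma).

(** [N^2 / (K - d)], the inverse of the map [r |-> N r / (r + N)] shifted by [N], is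
    bounded by its quadratic expansion at [d = 0], with the last coefficient doubled
    to cover the remainder. Composing with it needs only sums and products. *)
Lemma inverse_quadratic_bound (N K d r : R) : 0 < N -> 0 < K -> `|d| < K / 2 -> 0 < r ->
  N * r / (r + N) <= N - K + d ->
  r + N <= N ^+ 2 / K + N ^+ 2 / K ^+ 2 * d + 2 * N ^+ 2 / K ^+ 3 * d ^+ 2.
Proof.
move=> N0 K0; rewrite ltr_norml => dK r0 H1.
have X0 : 0 < K - d by lra.
have rN : 0 < r + N by exact: addr_gt0.
have {}H1 : (K - d) * (r + N) <= N ^+ 2.
  move: H1; rewrite ler_pdivrMr// expr2; lra.
have H2 : r + N <= N ^+ 2 / (K - d) by rewrite ler_pdivlMr// mulrC.
apply: le_trans H2 _.
have -> : N ^+ 2 / (K - d) = N ^+ 2 / K + N ^+ 2 / K ^+ 2 * d + N ^+ 2 / K ^+ 2 * d ^+ 2 / (K - d).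
  by field; apply/andP; split; lra.
rewrite lerD2l (_ : 2 * N ^+ 2 / K ^+ 3 * d ^+ 2 = N ^+ 2 / K ^+ 2 * d ^+ 2 * (2 / K)); last first.
  by field; lra.
apply: ler_wpM2l; first by rewrite mulr_ge0 ?divr_ge0 ?sqr_ge0.
rewrite -[_^-1]mul1r ler_pdivlMr// mulrAC ler_pdivrMr//; lra.
Qed.

(** A smooth function touching [N r / (r + N)] with [r = u + kap] from above gives,
    through the inverse of this map, a test function for [u]. The gradient of the
    latter is larger by the inverse of the derivative [(N / (r + N))^2], which thus
    multiplies the running cost. As this factor is less than 1, a fraction of the
    running cost is gained. *)
Lemma subsolution_transform u (kap N : R) z Q q1 q2 q3 :
  viscosity_subsolution H u -> smooth Q q1 q2 q3 -> spacetime z -> 0 < N ->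
  Q z = N * (u z + kap) / (u z + kap + N) ->
  (\forall y \near z, 0 < u y + kap /\ N * (u y + kap) / (u y + kap + N) <= Q y) ->
  forall a b g, 0 <= b -> gamma z.2 a b = g%:E ->
  q3 z + dot (drift c eta z.1 z.2 a b) (q1 z, q2 z) <= (N / (u z + kap + N)) ^+ 2 * g.
Proof.
move=> usub sQ zQ N0 Qz loc a b g b0 gE.
have [uz0 _] := nbhs_singleton loc.
have rN : 0 < u z + kap + N by exact: addr_gt0.
pose K := N ^+ 2 / (u z + kap + N).
have K0 : 0 < K by rewrite divr_gt0// exprn_gt0.
have QK : Q z = N - K by rewrite Qz /K; field; rewrite gt_eqF.
pose c1 := N ^+ 2 / K ^+ 2; pose c2 := 2 * N ^+ 2 / K ^+ 3.
have sS := smoothD sQ (smooth_cst (- Q z)).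
have sphi := smoothD (smooth_cst (N ^+ 2 / K - N - kap))
  (smoothD (smoothZ c1 sS) (smoothZ c2 (smoothM sS sS))).
have nearK : \forall y \near z, `|Q y - Q z| < K / 2.
  have K2 : 0 < K / 2 by rewrite divr_gt0.
  have /cvgrPdist_lt/(_ _ K2) : Q @ z --> Q z by exact: (smooth_continuous sQ).
  by apply: filterS => y; rewrite distrC.
have c1E : c1 = ((u z + kap + N) / N) ^+ 2.
  by rewrite /c1 /K; field; rewrite !gt_eqF.
have touch : \forall y \near z,
    u y - (N ^+ 2 / K - N - kap + (c1 * (Q y + - Q z) + c2 * ((Q y + - Q z) * (Q y + - Q z)))) <=
    u z - (N ^+ 2 / K - N - kap + (c1 * (Q z + - Q z) + c2 * ((Q z + - Q z) * (Q z + - Q z)))).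
  near=> y.
  have -> : N ^+ 2 / K = u z + kap + N by rewrite /K; field; rewrite !gt_eqF.
  have [uy0 uy] : 0 < u y + kap /\ N * (u y + kap) / (u y + kap + N) <= Q y by near: y.
  have yK : `|Q y - Q z| < K / 2 by near: y.
  have := inverse_quadratic_bound N0 K0 yK uy0.
  rewrite -QK subrKC => /(_ uy).
  have -> : N ^+ 2 / K = u z + kap + N by rewrite /K; field; rewrite !gt_eqF.
  rewrite -/c1 -/c2 subrr; set d := Q y - Q z.
  by clear; rewrite expr2; lra.
have := subsolution_control gamma_ok usub (smooth_C1 sphi) zQ touch a b0.
have [-> ->] := smooth_grad z sphi; rewrite gE lee_fin !subrr !mul0r !addr0 !mulr0 !add0r !addr0 => ineq.
have c10 : 0 < c1 by rewrite c1E exprn_gt0// divr_gt0.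
have -> : (N / (u z + kap + N)) ^+ 2 = c1^-1 by rewrite c1E; field; rewrite !gt_eqF.
rewrite mulrC ler_pdivlMr//; apply: le_trans ineq.
rewrite le_eqVlt; apply/orP; left; apply/eqP; rewrite /dot /=.
by move: (q1 z) (q2 z) (q3 z) (drift c eta z.1 z.2 a b) => x1 x2 x3 [f1 f2] /=; ring.
Unshelve. all: by end_near. Qed.

Lemma supersolution_touch w z Q q1 q2 q3 (e : R) :
  viscosity_supersolution H w -> smooth Q q1 q2 q3 -> spacetime z -> 0 < e ->
  (\forall y \near z, w z - Q z <= w y - Q y) ->
  exists a b g, [/\ 0 <= b, gamma z.2 a b = g%:E &
    - e <= q3 z + dot (drift c eta z.1 z.2 a b) (q1 z, q2 z) - g].
Proof.
move=> [_ wsup] sQ zQ e0 loc.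
have := wsup Q (smooth_C1 sQ) z zQ loc; have [-> ->] := smooth_grad z sQ => HQ.
have : ((- q3 z - e)%:E < H z.1 z.2 (q1 z, q2 z))%E.
  move: HQ; case: (H z.1 z.2 (q1 z, q2 z)) => [h| |] //=; last by rewrite ltry.
  rewrite -EFinD lee_fin lte_fin; move: e0; lra.
move=> /ereal_sup_gt[_ [[a b] /= b0 <-]].
have := gamma_ge0 gamma_ok a (ltW zQ.2) b0.
case gE: (gamma z.2 a b) => [g| |//] _ //.
rewrite -EFinB lte_fin => ineq; exists a, b, g; split=> //.
by move: ineq; lra.
Qed.

End Touching.

(** * Doubled Hamiltonians *)

Section Barrier.
Context {R : realType}.

(** The linear term has a positive slope, which makes the subsolution inequality
    strict; the power exceeds any bound at time [2 tau] while remaining small at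
    [tau], which confines maximum points to bounded times. *)
Lemma barrier (tau rho B : R) : 0 < tau -> 0 < rho -> exists k1 k2 n,
  [/\ 0 < k1, 0 <= k2, k1 * tau + k2 * tau ^+ n <= rho &
      forall t, 2 * tau <= t -> B <= k1 * t + k2 * t ^+ n].
Proof.
move=> tau0 rho0; pose n := Num.bound `|2 * B / rho|.
exists (rho / 2 / tau), (rho / 2 / tau ^+ n), n.
have r2 : 0 < rho / 2 by rewrite divr_gt0.
have tn : 0 < tau ^+ n by rewrite exprn_gt0.
split; first by rewrite divr_gt0.
- by rewrite divr_ge0// ltW.
- by rewrite !mulfVK ?gt_eqF//; lra.
- move=> t tt; have t0 : 0 < t by apply: lt_le_trans tt; rewrite mulr_gt0.
  apply: (@le_trans _ _ (rho / 2 / tau ^+ n * t ^+ n)); last first.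
    by rewrite lerDr mulr_ge0// ltW// divr_gt0.
  have : rho / 2 / tau ^+ n * (2 * tau) ^+ n <= rho / 2 / tau ^+ n * t ^+ n.
    apply: ler_wpM2l; first by rewrite divr_ge0// ltW.
    by rewrite lerXn2r ?nnegrE// ltW// mulr_gt0.
  move=> h; apply: le_trans h; rewrite exprMn mulrCA mulfVK ?gt_eqF//.
  have : `|2 * B / rho| <= 2 ^+ n.
    apply: (le_trans (ltW (archi_boundP (normr_ge0 _)))).
    by rewrite -natrX ler_nat ltnW// ltn_expl.
  move=> /(le_trans (ler_norm _)); rewrite ler_pdivrMr//; lra.
Qed.

End Barrier.

Section ControlBounds.
Context {R : realType} (c eta : R -> R).

Lemma dot_drift_bound (K C E P : R) y s a b p : 0 <= K -> 0 <= P ->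
  `|y.1| <= K -> 0 < y.2 <= K -> `|c s| <= C -> `|eta s| <= E ->
  `|p.1| <= P -> `|p.2| <= P -> 0 <= b ->
  `|dot (drift c eta y s a b) p| <= C * C * P +
     ((K + E) * P + 2 * K * P + ((K + E) * K * P + K * K * P)) * (`|a| + b).
Proof.
move=> K0 P0 y1 /andP[y20 y2] cC eE p1 p2 b0; rewrite dot_drift//.
have y2' : `|y.2| <= K by rewrite gtr0_norm.
have ye : `|y.1 + eta s| <= K + E by rewrite (le_trans (ler_normD _ _))// lerD.
have KE : 0 <= K + E by apply: le_trans ye.
have CC : 0 <= C by apply: le_trans cC.
have s0 : `|slope0 c y s p| <= C * C * P by rewrite /slope0 !normrM !ler_pM ?mulr_ge0.
have s1 : `|slope1 eta y s p| <= (K + E) * P + 2 * K * P.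
  rewrite /slope1 sub0r (le_trans (ler_normB _ _))// normrN !normrM (ger0_norm (ler0n _ 2)).
  by rewrite lerD// ler_pM// ?mulr_ge0// ler_pM2l.
have s2 : `|slope2 eta y s p| <= (K + E) * K * P + K * K * P.
  rewrite /slope2 sub0r (le_trans (ler_normB _ _))// normrN !normrM.
  by rewrite lerD// !ler_pM ?mulr_ge0.
rewrite (le_trans (ler_normD _ _))// (le_trans (lerD (ler_normD _ _) (lexx _)))//.
rewrite (normrM a) (normrM b) (ger0_norm b0) -addrA lerD//.
set k1 := (_ + 2 * K * P) in s1 *; set k2 := (_ + K * K * P) in s2 *.
have k10 : 0 <= k1 by apply: le_trans s1.
have k20 : 0 <= k2 by apply: le_trans s2.
have h1 : `|a| * `|slope1 eta y s p| <= `|a| * k1 by rewrite ler_wpM2l.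
have h2 : b * `|slope2 eta y s p| <= b * k2 by rewrite ler_wpM2l.
have h3 : 0 <= `|a| * k2 by rewrite mulr_ge0.
have h4 : 0 <= b * k1 by rewrite mulr_ge0.
by clear -h1 h2 h3 h4; lra.
Qed.

Lemma dot_drift_time (K P e : R) y s t a b p : 0 <= K -> 0 <= P ->
  0 < y.2 <= K -> `|c s * c s - c t * c t| <= e -> `|eta s - eta t| <= e ->
  `|p.1| <= P -> `|p.2| <= P -> 0 <= b ->
  `|dot (drift c eta y s a b) p - dot (drift c eta y t a b) p| <=
     e * (P + P * (1 + K) * (`|a| + b)).
Proof.
move=> K0 P0 /andP[y20 y2] ce ee p1 p2 b0; rewrite !dot_drift//.
have -> : slope0 c y s p + a * slope1 eta y s p + b * slope2 eta y s p -
    (slope0 c y t p + a * slope1 eta y t p + b * slope2 eta y t p) =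
    (c s * c s - c t * c t) * p.2 - (eta s - eta t) * (p.1 * (a + b * y.2)).
  by rewrite /slope0 /slope1 /slope2; ring.
have e0 : 0 <= e by apply: le_trans ce.
rewrite [leRHS]mulrDr (le_trans (ler_normB _ _))// !normrM lerD//; first by rewrite ler_pM.
rewrite ler_pM ?mulr_ge0// -mulrA.
rewrite ler_pM// (le_trans (ler_normD _ _))// normrM (ger0_norm b0) (gtr0_norm y20).
have h1 : b * y.2 <= b * K by rewrite ler_wpM2l.
have h2 : 0 <= K * `|a| by rewrite mulr_ge0.
by clear -h1 h2 b0; lra.
Qed.

(** [p] is the momentum produced by the penalization [k |x - y|^2]. It is of order
    [k |x - y|] and the drift is Lipschitz in space, so the difference is bounded by
    the penalization itself times the size of the control, up to a constant. *)
Lemma dot_drift_space (K E k : R) (x y p : R * R) t a b : 0 <= k -> 0 < x.2 <= K -> 0 < y.2 <= K ->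
  `|y.1| <= K -> `|eta t| <= E -> 0 <= b ->
  p = (2 * k * (x.1 - y.1), 2 * k * (x.2 - y.2)) ->
  - ((8 * K + 2 * E + 4) * (k * ((x.1 - y.1) ^+ 2 + (x.2 - y.2) ^+ 2)) * (`|a| + b)) <=
  dot (drift c eta x t a b) p - dot (drift c eta y t a b) p.
Proof.
move=> k0 /andP[x20 x2] /andP[y20 y2] y1 eE b0 ->; rewrite !dot_drift// /slope0 /slope1 /slope2 /=.
have ye : `|y.1 + eta t| <= K + E by rewrite (le_trans (ler_normD _ _))// lerD.
set D1 := x.1 - y.1; set D2 := x.2 - y.2; set f := y.1 + eta t.
have -> : c t * c t * (2 * k * D2) +
    a * (0 - (x.1 + eta t) * (2 * k * D1) - 2 * x.2 * (2 * k * D2)) +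
    b * (0 - (x.1 + eta t) * x.2 * (2 * k * D1) - x.2 * x.2 * (2 * k * D2)) -
  (c t * c t * (2 * k * D2) +
    a * (0 - (y.1 + eta t) * (2 * k * D1) - 2 * y.2 * (2 * k * D2)) +
    b * (0 - (y.1 + eta t) * y.2 * (2 * k * D1) - y.2 * y.2 * (2 * k * D2))) =
  - (2 * k * a * (D1 ^+ 2 + 2 * D2 ^+ 2)) -
  2 * k * b * (D1 ^+ 2 * x.2 + f * (D1 * D2) + (x.2 + y.2) * D2 ^+ 2).
  by rewrite /D1 /D2 /f; ring.
have q1 : 0 <= D1 ^+ 2 by exact: sqr_ge0.
have q2 : 0 <= D2 ^+ 2 by exact: sqr_ge0.
have q12 : `|D1 * D2| <= D1 ^+ 2 + D2 ^+ 2.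
  have := sqr_ge0 (D1 + D2); have := sqr_ge0 (D1 - D2); move: q1 q2; clear.
  rewrite !expr2; clearbody D1 D2 => q1 q2 h1 h2; rewrite ler_norml; apply/andP; split; lra.
have KE : 0 <= K + E by apply: le_trans ye.
have K0 : 0 <= K by apply: le_trans y1.
have E0 : 0 <= E by apply: le_trans eE.
set S := D1 ^+ 2 + D2 ^+ 2.
have S0 : 0 <= S by exact: addr_ge0.
have h1 : a * (D1 ^+ 2 + 2 * D2 ^+ 2) <= `|a| * (2 * S).
  apply: le_trans (ler_norm _) _; rewrite normrM ler_wpM2l// ger0_norm.
    by rewrite /S; clear -q1; lra.
  by clear -q1 q2; lra.
have h2 : f * (D1 * D2) <= (K + E) * S.
  by apply: le_trans (ler_norm _) _; rewrite normrM ler_pM.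
have h3 : D1 ^+ 2 * x.2 <= K * S.
  rewrite mulrC; apply: ler_pM => //; first exact: ltW.
  by rewrite /S lerDl.
have h4 : (x.2 + y.2) * D2 ^+ 2 <= 2 * K * S.
  apply: ler_pM => //; last by rewrite /S lerDr.
    by clear -x20 y20; lra.
  by clear -x2 y2; lra.
have h5 : b * (D1 ^+ 2 * x.2 + f * (D1 * D2) + (x.2 + y.2) * D2 ^+ 2) <=
    b * ((4 * K + E) * S).
  by rewrite ler_wpM2l//; clear -h2 h3 h4; lra.
have h6 : k * (a * (D1 ^+ 2 + 2 * D2 ^+ 2)) <= k * (`|a| * (2 * S)) by rewrite ler_wpM2l.
have h7 := ler_wpM2l k0 h5.
have h8 : 0 <= k * S * (`|a| * (8 * K + 2 * E)).
  by rewrite !mulr_ge0// addr_ge0// mulr_ge0.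
have h9 : 0 <= k * S * b by rewrite !mulr_ge0.
move: h6 h7 h8 h9; move: (D1 ^+ 2 + _) (D1 ^+ 2 * x.2 + _ + _) => X Y; clear.
move: `|a| S => A S; lra.
Qed.

End ControlBounds.

Section DoubledControl.
Context {R : realType} (c eta : R -> R) (gamma : R -> R -> R -> \bar R).
Hypothesis c_cont : {within `[0, +oo[, continuous c}.
Hypothesis eta_cont : {within `[0, +oo[, continuous eta}.
Hypothesis gamma_ok : running_cost_assumptions gamma.

Lemma continuous_data (T : R) : exists C E, [/\ 0 <= C, 0 <= E,
  forall t, 0 <= t <= T -> `|c t| <= C /\ `|eta t| <= E &
  forall e, 0 < e -> exists2 d : R, 0 < d & forall t s, 0 <= t <= T -> 0 <= s <= T ->
    `|s - t| < d -> `|c s * c s - c t * c t| <= e /\ `|eta s - eta t| <= e].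
Proof.
have sub : `[0, T] `<=` (`[0, +oo[ : set R).
  by move=> r; rewrite /= !in_itv /= andbT => /andP[].
have cc := continuous_subspaceW sub c_cont.
have ce := continuous_subspaceW sub eta_cont.
have [C C0 HC] := tame_bound (tame_cont cc).
have [E E0 HE] := tame_bound (tame_cont ce).
exists C, E; split=> // [t tT|e e0]; first by split; [exact: HC|exact: HE].
have [d1 d10 H1] := compact_uniform (@segment_compact _ 0 T) (within_mul cc cc) e0.
have [d2 d20 H2] := compact_uniform (@segment_compact _ 0 T) ce e0.
exists (Num.min d1 d2); first by rewrite lt_min d10.
move=> t s tT sT; rewrite lt_min => /andP[st1 st2].
by split; apply: ltW; [apply: H1|apply: H2]; rewrite /= ?in_itv.
Qed.

(** The sub- and supersolution inequalities hold at different times. The control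
    [(0, 0)] in the former bounds [q] above; by coercivity the latter then bounds the
    control and its running cost. On the resulting bounded set the data are
    uniformly continuous in time, so both inequalities can be used with the same
    control and subtracted. *)
Lemma doubled_control (T K P e : R) : 0 < T -> 0 <= K -> 0 <= P -> 0 < e ->
  exists2 r : R, 0 < r & forall t s (x y p : R * R) q lam P',
    0 <= t <= T -> 0 <= s <= T -> `|t - s| < r ->
    `|x.1| <= K -> 0 < x.2 <= K -> `|y.1| <= K -> 0 < y.2 <= K ->
    `|p.1| <= P -> `|p.2| <= P -> 0 <= lam <= 1 -> 0 <= P' ->
    (forall a b g, 0 <= b -> gamma t a b = g%:E ->
      P' + q + dot (drift c eta x t a b) p <= lam * g) ->
    (forall e', 0 < e' -> exists a b g, [/\ 0 <= b, gamma s a b = g%:E &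
      - e' <= q + dot (drift c eta y s a b) p - g]) ->
    exists a b g, [/\ 0 <= b, gamma s a b = g%:E &
      P' + (dot (drift c eta x t a b) p - dot (drift c eta y t a b) p) + (1 - lam) * g <= e].
Proof.
move=> T0 K0 P0 e0.
have [C [E [C0 E0 CE ucE]]] := continuous_data T.
pose L0 := C * C * P.
pose L1 := (K + E) * P + 2 * K * P + ((K + E) * K * P + K * K * P).
have L00 : 0 <= L0 by rewrite !mulr_ge0.
have L10 : 0 <= L1 by rewrite /L1 !addr_ge0// !mulr_ge0// addr_ge0.
have [K1 K10 HK1] := gamma_coercive gamma_ok (ltW T0) (addr_ge0 L10 ler01).
(* the cost of doing nothing bounds the common time derivative [q] *)
have [C1 C10 HC1] : exists2 C1 : R, 0 <= C1 & forall t, 0 <= t <= T -> (gamma t 0%R 0%R <= C1%:E)%E.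
  have bq : box T 0 `<=` [set z : R * R * R | 0 <= z.1.1 /\ 0 <= z.2].
    by move=> z [/andP[z1 _] _ /andP[z3 _]].
  have bfin z : box T 0 z -> (gamma z.1.1 z.1.2 z.2 < +oo)%E.
    have [_ _ _ _ fin] := gamma_ok.
    by move=> [/andP[z1 _]]; rewrite normr_le0 => /eqP -> /le_anti <-; exact: fin.
  have [C1 C10 H] := gamma_bounded gamma_ok (@box_compact _ T 0) bq bfin.
  by exists C1 => // t tT; apply: (H (t, 0, 0)); split; rewrite /= ?normr0 ?lexx.
pose B := 1 + C1 + 2 * L0 + K1.
pose G := 3 + C1 + 2 * L0 + L1 * B.
have B0 : 0 <= B by rewrite /B !addr_ge0// mulr_ge0.
have G0 : 0 <= G by rewrite /G !addr_ge0// mulr_ge0.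
pose e3 := Num.min 1 (e / 3).
have e30 : 0 < e3 by rewrite lt_min ltr01 divr_gt0.
have [e31 e3e] : e3 <= 1 /\ e3 * 3 <= e.
  by split; [rewrite ge_min lexx|rewrite -ler_pdivlMr// ge_min lexx orbT].
have [d1 d10 D1] := gtrunc_uniform gamma_ok T B G0 e30.
pose X := P + P * (1 + K) * B.
have X0 : 0 <= X by rewrite addr_ge0// !mulr_ge0// addr_ge0.
have X10 : 0 < X + 1 by rewrite ltr_wpDl.
have [d2 d20 D2] := ucE (e3 / (X + 1)) (divr_gt0 e30 X10).
exists (Num.min d1 d2); first by rewrite lt_min d10.
move=> t s x y p q lam P' tT sT; rewrite lt_min => /andP[ts1 ts2] x1 x2 y1 y2 p1 p2
  /andP[lam0 lam1] P'0 Hsub Hsup.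
have [ct et] := CE t tT; have [cs es] := CE s sT.
have q_le : q <= C1 + L0.
  have := HC1 _ tT; have := gamma_ge0 gamma_ok 0 (andP tT).1 (lexx 0).
  case gE : (gamma t 0%R 0%R) => [g| |//]; rewrite ?lee_fin// => g0 gC.
  have := Hsub 0 0 g (lexx 0) gE.
  have := dot_drift_bound 0 K0 P0 x1 x2 ct et p1 p2 (lexx 0).
  rewrite normr0 addr0 mulr0 addr0 ler_norml => /andP[l1 _] l2.
  have l3 : lam * g <= 1 * g by rewrite ler_wpM2r.
  by rewrite -/L0 in l1; clear -l1 l2 l3 gC P'0; lra.
have [a [b [g [b0 gE ineq]]]] := Hsup _ e30.
have g0 : 0 <= g by have := gamma_ge0 gamma_ok a (andP sT).1 b0; rewrite gE lee_fin.
have := dot_drift_bound a K0 P0 y1 y2 cs es p1 p2 b0.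
rewrite -/L0 -/L1 ler_norml => /andP[_ l1].
have := HK1 s a b sT b0; rewrite gE lee_fin => l2.
set n := `|a| + b in l1 l2.
have n0 : 0 <= n by rewrite addr_ge0.
have nB : n <= B by rewrite /B; clear -q_le ineq l1 l2 e31; lra.
have gG : g + 2 <= G.
  have : L1 * n <= L1 * B by rewrite ler_wpM2l.
  by rewrite /G; clear -q_le ineq l1 e31; lra.
have [aB bB] : `|a| <= B /\ b <= B.
  by split; apply: le_trans nB; rewrite /n ?lerDl ?lerDr.
have gs : gtrunc gamma G s a b = g.
  by rewrite /gtrunc gE -EFin_min /= min_l//; clear -gG; lra.
have := D1 s t a a b b; rewrite gs !subrr !normr0 => /(_ _ _ ts1 d10 d10).
have [bs bt] : box T B (s, a, b) /\ box T B (t, a, b) by split; split; rewrite //= b0.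
move=> /(_ bs bt); rewrite ltr_norml => /andP[_ gt].
have [_ _ gtE] := gtruncP gamma_ok a G0 (andP tT).1 b0.
have gt' : gtrunc gamma G t a b < G by clear -gt gG e31; lra.
have := Hsub a b _ b0 (gtE gt'); set g' := gtrunc gamma G t a b in gt * => l3.
have l4 : lam * g' <= lam * (g + e3) by rewrite ler_wpM2l//; clear -gt; lra.
have l5 : lam * e3 <= 1 * e3 by rewrite ler_wpM2r// ltW.
have [dc de] := D2 s t sT tT ts2.
have := dot_drift_time a K0 P0 y2 dc de p1 p2 b0.
rewrite -/n distrC ler_norml => /andP[_].
have l6 : e3 / (X + 1) * (P + P * (1 + K) * n) <= e3.
  rewrite mulrAC ler_pdivrMr//; apply: ler_wpM2l; first exact: ltW.
  apply: (@le_trans _ _ X); last by rewrite lerDl.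
  by rewrite lerD2l ler_wpM2l// mulr_ge0// addr_ge0.
move=> l7; exists a, b, g; split=> //.
move: l3 l4 l7 ineq; generalize (dot (drift c eta x t a b) p) (dot (drift c eta y t a b) p)
  (dot (drift c eta y s a b) p) => X1 X2 X3.
by clear -l5 l6 e3e; lra.
Qed.

End DoubledControl.

(** * Doubling of variables *)

Section Doubling.
Context {R : realType}.
Implicit Types (z : R * R * R).

Lemma norm_lt_sqr (x r : R) : 0 < r -> x ^+ 2 < r ^+ 2 -> `|x| < r.
Proof.
move=> r0; rewrite -real_normK ?num_real// => h; rewrite ltNge; apply/negP => rx.
by move: h; rewrite ltNge lerXn2r// nnegrE ?ltW.
Qed.

Definition slab (K d T : R) : set (R * R * R) :=
  [set z | [/\ `|z.1.1| <= K, d <= z.1.2 <= K & 0 <= z.2 <= T]].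

Lemma slab_compact K d T : compact (slab K d T).
Proof.
have -> : slab K d T = ([set` `[- K, K]] `*` [set` `[d, K]]) `*` [set` `[0, T]].
  apply/seteqP; split=> [z [z1 z2 z3]|z [[/= z1 z2] z3]] /=.
    by rewrite !in_itv /= -ler_norml.
  by split; [move: z1; rewrite ler_norml|move: z2|move: z3]; rewrite in_itv.
by apply: compact_setX; [apply: compact_setX|]; exact: segment_compact.
Qed.

Definition inside (K d T : R) : set (R * R * R) :=
  [set z | [/\ `|z.1.1| < K, d < z.1.2 < K & 0 < z.2 < T]].

Lemma inside_slab K d T z : inside K d T z -> \forall y \near z, slab K d T y.
Proof.
move=> [z1 /andP[z2 z2'] /andP[z3 z3']].
pose r := Num.min (K - `|z.1.1|) (Num.min (Num.min (z.1.2 - d) (K - z.1.2)) (Num.min z.2 (T - z.2))).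
apply/(@nbhs_ballP R (R * R * R)%type z); exists r => /=.
  by rewrite /r !lt_min !subr_gt0 z1 z2 z2' z3 z3'.
move=> y; rewrite -ball_normE /= distrC norm_lt_triple /= => /and3P[].
rewrite /r !lt_min => /andP[h1 _] /andP[_ /andP[/andP[h2 h3] _]] /andP[_ /andP[_ /andP[h4 h5]]].
move: h2 h3 h4 h5; rewrite !ltr_norml => /andP[h2 _] /andP[_ h3] /andP[h4 _] /andP[_ h5].
split.
- rewrite -[y.1.1](subrK z.1.1); apply: (le_trans (ler_normD _ _)).
  by clear -h1; lra.
- by clear -h2 h3; apply/andP; split; lra.
- by clear -h4 h5; apply/andP; split; lra.
Qed.

Lemma within_fst (V W : normedModType R) (A : set V) (B : set W) (f : V -> R) :
  {within A, continuous f} -> {within A `*` B, continuous (fun y => f y.1)}.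
Proof.
move=> /within_continuousP cf; apply/within_continuousP => -[x y] [/= xA yB] e e0.
have [d d0 dH] := cf x xA e e0; exists d => // -[x' y'] [/= xA' _].
by rewrite prod_normE /= gt_max => /andP[+ _]; exact: dH.
Qed.

Lemma within_snd (V W : normedModType R) (A : set V) (B : set W) (f : W -> R) :
  {within B, continuous f} -> {within A `*` B, continuous (fun y => f y.2)}.
Proof.
move=> /within_continuousP cf; apply/within_continuousP => -[x y] [/= xA yB] e e0.
have [d d0 dH] := cf y yB e e0; exists d => // -[x' y'] [/= _ yB'].
by rewrite prod_normE /= gt_max => /andP[_]; exact: dH.
Qed.

Definition doubled (U W : R * R * R -> R) (P : R -> R) (k l : R) z z' :=
  U z - W z' - k * ((z.1.1 - z'.1.1) ^+ 2 + (z.1.2 - z'.1.2) ^+ 2) - l * (z.2 - z'.2) ^+ 2 - P z.2.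

(** Positive values of [doubled] force [W z' < N], which keeps [z'] away from the
    boundary of the slab, and [z] is close to [z'] because the penalizations are
    bounded by [N]; the barrier excludes large times, and the ordering of [U] and
    [W] at time zero excludes small ones. The space penalization tends to zero
    because [z] can be compared with the point having the spatial part of [z'].
    The time penalization [l] is chosen after [k], so that the times can be as close
    as required for this [k]. *)
Lemma doubling_maximum (U W : R * R * R -> R) (P : R -> R) (K d T N sigma : R) zb :
  let DD := slab (K + 1) (d / 2) (T + 1) in 0 < d ->
  {within DD, continuous U} -> {within DD, continuous W} ->
  {within DD, continuous (fun z => P z.2)} ->
  (forall z, DD z -> U z <= N) -> (forall z, DD z -> 0 <= W z) ->
  (forall z, DD z -> W z < N -> `|z.1.1| < K /\ d <= z.1.2 < K) ->
  (forall z, DD z -> z.2 = 0 -> U z <= W z) ->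
  (forall t, 0 <= t -> 0 <= P t) -> (forall t, T <= t -> N <= P t) ->
  DD zb -> 0 < sigma -> sigma <= U zb - W zb - P zb.2 ->
  forall w, 0 < w -> exists2 k : R, 0 < k & forall r, 0 < r -> exists l z z',
   [/\ inside (K + 1) (d / 2) (T + 1) z /\ inside (K + 1) (d / 2) (T + 1) z', `|z.2 - z'.2| < r,
     k * ((z.1.1 - z'.1.1) ^+ 2 + (z.1.2 - z'.1.2) ^+ 2) <= w,
     forall y, DD y -> doubled U W P k l y z' <= doubled U W P k l z z' &
     forall y, DD y -> doubled U W P k l z y <= doubled U W P k l z z'].
Proof.
move=> DD d0 cU cW cP UN W0 WN UW0 P0 PT zbD s0 szb w w0.
have N0 : 0 < N.
  apply: (lt_le_trans s0); apply: (le_trans szb); have := W0 _ zbD; have := UN _ zbD.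
  by case: zbD => _ _ /andP[/P0 p _]; clear -p; lra.
have ws0 : 0 < Num.min w sigma by rewrite lt_min w0.
have [rU rU0 HU] := compact_uniform (@slab_compact _ _ _) cU ws0.
have [rW rW0 HW] := compact_uniform (@slab_compact _ _ _) cW s0.
pose r1 := Num.min (Num.min rU rW) (Num.min 1 (d / 2)).
have r10 : 0 < r1 by rewrite !lt_min rU0 rW0 ltr01 divr_gt0.
have [r1U r1W r11 r1d] : [/\ r1 <= rU, r1 <= rW, r1 <= 1 & r1 <= d / 2].
  by split; rewrite /r1 !ge_min lexx ?orbT.
have N10 : 0 < N + 1 by rewrite ltr_wpDl ?ltW.
(* at a maximum both penalizations are less than [N + 1], whence [|x - y| < r1]
   and, with the choice of [l] below, [|t - s| < r2] *)
exists ((N + 1) / r1 ^+ 2); first by rewrite divr_gt0// exprn_gt0.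
move=> r r0; pose r2 := Num.min r r1.
have r20 : 0 < r2 by rewrite lt_min r0.
have [r2r r21] : r2 <= r /\ r2 <= r1 by split; rewrite /r2 ge_min lexx ?orbT.
set k := (N + 1) / r1 ^+ 2; pose l := (N + 1) / r2 ^+ 2; exists l.
have k0 : 0 < k by rewrite divr_gt0// exprn_gt0.
have l0 : 0 < l by rewrite divr_gt0// exprn_gt0.
have [[zM zM'] /= zMD zmax] : exists2 y, y \in DD `*` DD & forall y', y' \in DD `*` DD ->
    doubled U W P k l y'.1 y'.2 <= doubled U W P k l y.1 y.2.
  apply: compact_EVT_max; first by exists (zb, zb).
    by apply: compact_setX; exact: slab_compact.
  have [q1 q2 q3] := @within_coords R DD.
  have diff (f : R * R * R -> R) : {within DD, continuous f} ->
      {within DD `*` DD, continuous (fun y => (f y.1 - f y.2) ^+ 2 : R)}.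
    move=> cf; have cd := within_sub (within_fst (B := DD) cf) (within_snd (A := DD) cf).
    rewrite (_ : (fun y => _) = fun y => (f y.1 - f y.2) * (f y.1 - f y.2)); first exact: (within_mul cd cd).
    by apply/funext => y; rewrite expr2.
  rewrite /doubled; apply: within_sub; last exact: (within_fst cP).
  apply: within_sub; last by apply: within_mul; [exact: within_cst|exact: diff q3].
  apply: within_sub; first by apply: within_sub; [exact: (within_fst cU)|exact: (within_snd cW)].
  apply: within_mul; first exact: within_cst.
  by apply: within_add; [exact: diff q1|exact: diff q2].
have {}zmax z z' : DD z -> DD z' -> doubled U W P k l z z' <= doubled U W P k l zM zM'.
  by move=> zD zD'; apply: (zmax (z, z')); rewrite inE.
have [zD zD'] : DD zM /\ DD zM' by move: zMD; rewrite inE => -[].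
have Mge : sigma <= doubled U W P k l zM zM'.
  by apply: le_trans (zmax zb zb zbD zbD); rewrite /doubled !subrr expr0n /= addr0 !mulr0 !subr0.
set S := (zM.1.1 - zM'.1.1) ^+ 2 + (zM.1.2 - zM'.1.2) ^+ 2.
have [q1 q2] : 0 <= (zM.1.1 - zM'.1.1) ^+ 2 /\ 0 <= (zM.1.2 - zM'.1.2) ^+ 2 by split; exact: sqr_ge0.
have S0 : 0 <= S by exact: addr_ge0.
have kS0 : 0 <= k * S by rewrite mulr_ge0// ltW.
have lt0 : 0 <= l * (zM.2 - zM'.2) ^+ 2 by rewrite mulr_ge0 ?sqr_ge0// ltW.
have t0 : 0 <= zM.2 by case: zD => _ _ /andP[].
have s0' : 0 <= zM'.2 by case: zD' => _ _ /andP[].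
have Pt := P0 _ t0; have Uz := UN _ zD; have Wz := W0 _ zD'.
have Mge' : sigma <= U zM - W zM' - k * S - l * (zM.2 - zM'.2) ^+ 2 - P zM.2 by [].
have kSN : k * S < N + 1 by clear -Mge' lt0 Pt Uz Wz s0; lra.
have ltN : l * (zM.2 - zM'.2) ^+ 2 < N + 1 by clear -Mge' kS0 Pt Uz Wz s0; lra.
have {}kSN : S < r1 ^+ 2.
  by move: kSN; rewrite /k mulrAC ltr_pdivrMr ?exprn_gt0// ltr_pM2l.
have {}ltN : `|zM.2 - zM'.2| < r2.
  apply: norm_lt_sqr => //.
  by move: ltN; rewrite /l mulrAC ltr_pdivrMr ?exprn_gt0// ltr_pM2l.
have D1 : `|zM.1.1 - zM'.1.1| < r1.
  by apply: norm_lt_sqr => //; apply: le_lt_trans kSN; rewrite lerDl.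
have D2 : `|zM.1.2 - zM'.1.2| < r1.
  by apply: norm_lt_sqr => //; apply: le_lt_trans kSN; rewrite lerDr.
have WzN : W zM' < N by clear -Mge' lt0 kS0 Pt Uz s0; lra.
have [y1 /andP[y2 y2']] := WN _ zD' WzN.
have dist : `|zM - zM'| < r1.
  by rewrite norm_lt_triple /= D1 D2 (lt_le_trans ltN).
have tT : zM.2 < T.
  by rewrite ltNge; apply/negP => /PT; clear -Mge' lt0 kS0 Uz Wz s0; lra.
have Wd : `|W zM - W zM'| < sigma by apply: HW => //; apply: lt_le_trans r1W.
have Ud : `|U zM - U zM'| < sigma.
  by have := HU _ _ zD' zD (lt_le_trans dist r1U); rewrite lt_min => /andP[].
have t0' : 0 < zM.2.
  rewrite lt_neqAle t0 andbT; apply/eqP => e; have := UW0 _ zD (esym e).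
  by move: Wd; rewrite ltr_norml => /andP[_]; clear -Mge' lt0 kS0 Pt; lra.
have s0'' : 0 < zM'.2.
  rewrite lt_neqAle s0' andbT; apply/eqP => e; have := UW0 _ zD' (esym e).
  by move: Ud; rewrite ltr_norml => /andP[_]; clear -Mge' lt0 kS0 Pt; lra.
exists zM, zM'; split.
- split; split.
  + rewrite -[zM.1.1](subrK zM'.1.1) (le_lt_trans (ler_normD _ _))// addrC ltrD//.
    exact: lt_le_trans r11.
  + by move: D2; rewrite ltr_norml => /andP[]; clear -y2 y2' r11 r1d; move=> *; apply/andP; split; lra.
  + by rewrite t0' (lt_trans tT)// ltrDl.
  + by rewrite (lt_trans y1)// ltrDl.
  + by clear -y2 y2' d0; apply/andP; split; lra.
  + rewrite s0'' /=; move: ltN; rewrite ltr_norml => /andP[+ _].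
    by clear -tT r21 r11; lra.
- exact: lt_le_trans r2r.
- have zD'' : DD (zM'.1, zM.2) by case: zD zD' => ? ? ? [].
  have := zmax _ _ zD'' zD'; rewrite /doubled /= !subrr expr0n /= addr0 mulr0 subr0 -/S.
  have := HU _ _ zD'' zD; rewrite norm_lt_triple /= subrr normr0 lt_min.
  rewrite (lt_le_trans D1 r1U) (lt_le_trans D2 r1U) rU0 => /(_ isT) /andP[+ _].
  by rewrite ltr_norml => /andP[_]; clear; lra.
- by move=> y yD; apply: zmax.
- by move=> y yD; apply: zmax.
Qed.

End Doubling.

(** * Comparison principle *)

Section Comparison.
Context {R : realType} (c eta : R -> R) (gamma : R -> R -> R -> \bar R).
Hypothesis c_cont : {within `[0, +oo[, continuous c}.
Hypothesis eta_cont : {within `[0, +oo[, continuous eta}.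
Hypothesis gamma_ok : running_cost_assumptions gamma.

Local Notation H := (hamiltonian c eta gamma).

Lemma transform_lip (N r r' : R) : 0 < N -> 0 <= r -> 0 <= r' ->
  `|N * r / (r + N) - N * r' / (r' + N)| <= `|r - r'|.
Proof.
move=> N0 r0 r'0.
have p : 0 < r + N by rewrite ltr_wpDl.
have p' : 0 < r' + N by rewrite ltr_wpDl.
have -> : N * r / (r + N) - N * r' / (r' + N) = (r - r') * (N * N / ((r + N) * (r' + N))).
  by field; rewrite !gt_eqF.
rewrite normrM ler_piMr// ger0_norm; last by rewrite divr_ge0// ?mulr_ge0// ltW.
rewrite ler_pdivrMr ?mulr_gt0// mul1r; apply: ler_pM; rewrite ?lerDr//; exact: ltW.
Qed.

Lemma class_Vloc_sublevel (w : R * R * R -> R) (T M : R) : class_Vloc w -> 0 < T ->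
  exists K d : R, 0 < d /\ forall z, spacetime0 z -> z.2 <= T -> w z < M ->
    `|z.1.1| < K /\ d <= z.1.2 < K.
Proof.
move=> [_ /(_ T) Hw] T0; have [/(_ M)[K HK] /(_ M)[d d0 Hd]] := Hw T0.
exists K, d; split=> // -[[x1 x2] t] [/= x20 t0] tT wM.
have tI : t \in `[0, T] by rewrite in_itv /= t0.
have xK : `|(x1, x2)| < K.
  rewrite ltNge; apply/negP => /(HK _ x20)/le_trans/(_ (ereal_inf_lbound _)) => /(_ _ (ex_intro2 _ _ t tI erefl)).
  by rewrite lee_fin leNgt wM.
have x2d : d <= x2.
  rewrite leNgt; apply/negP => x2d; have x2I : 0 < x2 < d by rewrite x20.
  have := Hd _ x2I => /le_trans/(_ (ereal_inf_lbound _)) => /(_ _ (ex_intro2 _ _ (x1, t) tI erefl)).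
  by rewrite lee_fin leNgt wM.
move: xK; rewrite norm_lt_pair => /andP[-> x2K]; split=> //.
by rewrite x2d (le_lt_trans (ler_norm _)).
Qed.

Lemma smooth_penalty (k l k1 k2 : R) n (o : R * R * R) :
  smooth (fun z => k * ((z.1.1 - o.1.1) ^+ 2 + (z.1.2 - o.1.2) ^+ 2) + l * (z.2 - o.2) ^+ 2 +
      (k1 * z.2 + k2 * z.2 ^+ n))
    (fun z => 2 * k * (z.1.1 - o.1.1)) (fun z => 2 * k * (z.1.2 - o.1.2))
    (fun z => 2 * l * (z.2 - o.2) + (k1 + k2 * (n%:R * z.2 ^+ n.-1))).
Proof.
have [s1 s2 s3] := smooth_coords (R := R).
have d1 := smoothD s1 (smooth_cst (- o.1.1)).
have d2 := smoothD s2 (smooth_cst (- o.1.2)).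
have d3 := smoothD s3 (smooth_cst (- o.2)).
have := smoothD (smoothD (smoothZ k (smoothD (smoothM d1 d1) (smoothM d2 d2))) (smoothZ l (smoothM d3 d3)))
  (smoothD (smoothZ k1 s3) (smoothZ k2 (smooth_time_power n))).
by apply: smooth_ext => z; ring.
Qed.

(** Suppose [w < u] at some point. Subtracting the viscosity inequalities at a
    maximum of the doubled function yields a control with
    [k1 + (1 - lam) g <= Cd k |x - y|^2 (|a| + b) + k1 / 4], where [k1] is the slope
    of the barrier, [g] the running cost and [1 - lam] the gain due to the transform.
    As [|a| + b <= g + G] by coercivity, the right-hand side is at most
    [(1 - lam) g + k1 / 2] once the penalization is small, contradicting [0 < k1]. *)
Lemma comparison (u w : R * R * R -> R) :
  viscosity_subsolution H u -> (exists m, forall z, spacetime0 z -> m <= u z) ->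
  viscosity_supersolution H w -> class_Vloc w ->
  (forall x, halfplane x -> u (x, 0) <= w (x, 0)) ->
  forall z, spacetime0 z -> u z <= w z.
Proof.
move=> usub [m um] wsup wV u0w zb zbQ; rewrite leNgt; apply/negP => wu.
have [m' wm] := wV.1.
(* after a shift of both functions, [1 <= u] and [0 <= w] *)
pose kap := Num.max (1 - m) (- m').
have u1 z : spacetime0 z -> 1 <= u z + kap.
  move=> /um; have : 1 - m <= kap by rewrite /kap le_max lexx.
  by clear -c_cont eta_cont gamma_ok; lra.
have w0 z : spacetime0 z -> 0 <= w z + kap.
  move=> /wm; have : - m' <= kap by rewrite /kap le_max lexx orbT.
  by clear -c_cont eta_cont gamma_ok; lra.
have u0 z : spacetime0 z -> 0 < u z + kap by move=> /u1; exact: lt_le_trans.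
have gap0 : 0 < u zb - w zb by rewrite subr_gt0.
(* the transform lowers [r = u zb + kap] by [r^2 / (r + N)], less than the gap
   [u zb - w zb] for this [N] *)
pose N := (u zb + kap) ^+ 2 / (u zb - w zb).
have N0 : 0 < N by rewrite divr_gt0// exprn_gt0// u0.
pose U z := N * (u z + kap) / (u z + kap + N).
pose W z := w z + kap.
have UE z : spacetime0 z -> U z = N - N * (N / (u z + kap + N)).
  by move=> /u0 uz; rewrite /U; field; rewrite gt_eqF// addr_gt0.
have UN z : spacetime0 z -> U z <= N.
  move=> zQ; rewrite UE// gerBl mulr_ge0 ?ltW// divr_gt0// addr_gt0//; exact: u0.
have Uu z : spacetime0 z -> U z <= u z + kap.
  move=> zQ; have uz := u0 _ zQ; have p : 0 < u z + kap + N by exact: addr_gt0.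
  rewrite /U ler_pdivrMr// mulrC ler_pM2l// lerDr; exact: ltW.
have WU : W zb < U zb.
  have rz := u0 _ zbQ.
  have p : 0 < u zb + kap + N by exact: addr_gt0.
  rewrite /U ltr_pdivlMr// /W.
  have NE : N * (u zb - w zb) = (u zb + kap) * (u zb + kap) by rewrite divfK ?gt_eqF.
  move: NE (mulr_gt0 rz gap0); clear; move: N (u zb) (w zb) => M x y NE h; nra.
have tb0 : 0 < zb.2.
  rewrite lt_neqAle zbQ.2 andbT; apply/eqP => e.
  move: zb zbQ e wu {gap0 N N0 U UE UN Uu WU} => [x t] [/= x0 _] <-.
  by rewrite ltNge u0w.
pose sigma := (U zb - W zb) / 2.
have sigma0 : 0 < sigma by rewrite divr_gt0// subr_gt0.
have [k1 [k2 [n [k10 k20 Pb PN]]]] := barrier N tb0 sigma0.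
pose P t := k1 * t + k2 * t ^+ n.
have P0 t : 0 <= t -> 0 <= P t.
  by move=> t0; rewrite addr_ge0// mulr_ge0 ?exprn_ge0// ltW.
pose T := 2 * zb.2.
have T0 : 0 < T by rewrite mulr_gt0.
have T10 : 0 < T + 1 by rewrite addr_gt0.
have [K [d [d0 HK]]] := class_Vloc_sublevel (N - kap) wV T10.
pose D := slab (K + 1) (d / 2) (T + 1).
have DQ z : D z -> spacetime0 z.
  by move=> [_ /andP[h _] /andP[h' _]]; split=> //; apply: lt_le_trans h; rewrite divr_gt0.
have [cu _] := usub; have [cw _] := wsup.
have cU : {within D, continuous U}.
  move/within_continuousP : cu => cu; apply/within_continuousP => x xD e e0.
  have [r r0 rH] := cu x (DQ _ xD) e e0; exists r => // y yD yx.
  apply: le_lt_trans (rH y (DQ _ yD) yx).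
  have := transform_lip N0 (ltW (u0 _ (DQ _ yD))) (ltW (u0 _ (DQ _ xD))).
  by rewrite /U opprD addrACA subrr addr0.
have cW : {within D, continuous W}.
  apply: within_add; first exact: continuous_subspaceW DQ cw.
  exact: within_cst.
have cP : {within D, continuous (fun z => P z.2)}.
  have [_ _ st] := @smooth_coords R.
  have := smoothD (smoothZ k1 st) (smoothZ k2 (smooth_time_power n)).
  by move=> /smooth_continuous; exact: continuous_subspaceT.
have WK z : D z -> W z < N -> `|z.1.1| < K /\ d <= z.1.2 < K.
  move=> zD WN; apply: HK; [exact: DQ|by case: zD => _ _ /andP[]|by rewrite ltrBrDr].
have UW0 z : D z -> z.2 = 0 -> U z <= W z.
  move=> zD z0; apply: (le_trans (Uu _ (DQ _ zD))); rewrite lerD2r.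
  by have [] := DQ _ zD; move: z z0 {zD} => [x t] /= -> x0 _; exact: u0w.
have zbD : D zb.
  have tT : zb.2 <= T + 1 by rewrite /T; clear -c_cont eta_cont gamma_ok tb0; lra.
  have [|h1 /andP[h2 h3]] := HK _ zbQ tT.
    by rewrite ltrBrDr; apply: lt_le_trans WU (UN _ zbQ).
  split; last by rewrite tT ltW.
    by rewrite ltW// (lt_trans h1)// ltrDl.
  by clear -c_cont eta_cont gamma_ok h2 h3 d0; apply/andP; split; lra.
have szb : sigma <= U zb - W zb - P zb.2.
  by move: Pb; rewrite -/(P zb.2) /sigma; clear -c_cont eta_cont gamma_ok; lra.
have K1 : 0 <= K + 1 by case: zbD => h _ _; exact: le_trans h.
have [C [E [_ E0 CE _]]] := continuous_data c_cont eta_cont (T + 1).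
have [G G0 HG] := gamma_coercive gamma_ok (ltW T10) ler01.
(* [1 <= u + kap] bounds the gain below by [theta] *)
pose theta := 1 - (N / (1 + N)) ^+ 2.
have N1 : 0 < 1 + N by rewrite addr_gt0.
have theta0 : 0 < theta.
  have NN : 0 <= N / (1 + N) by rewrite divr_ge0// ltW.
  by rewrite subr_gt0 expr_lt1// ltr_pdivrMr// mul1r ltrDr.
pose Cd := 8 * (K + 1) + 2 * E + 4.
have Cd0 : 0 < Cd by rewrite ltr_wpDl// addr_ge0// mulr_ge0.
(* the level of the space penalization below which its contribution is absorbed:
   its part proportional to the running cost by the gain, the rest by [k1 / 4] *)
pose om := Num.min theta (k1 / (4 * (G + 1))) / Cd.
have G10 : 0 < G + 1 by rewrite ltr_wpDl.
have om0 : 0 < om by rewrite divr_gt0// lt_min theta0 divr_gt0// mulr_gt0.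
have [k k0 Hk] := doubling_maximum d0 cU cW cP (fun z zD => UN z (DQ z zD)) (fun z zD => w0 z (DQ z zD))
  WK UW0 P0 PN zbD sigma0 szb om0.
have Pm0 : 0 <= 2 * k * (2 * (K + 1)) by rewrite !mulr_ge0// ltW.
have k14 : 0 < k1 / 4 by rewrite divr_gt0.
have [r r0 Hr] := doubled_control c_cont eta_cont gamma_ok T10 K1 Pm0 k14.
have [l [z [z' [[zI zI'] tt kS maxz maxz']]]] := Hk r r0.
have [zD zD'] : D z /\ D z'.
  by split; apply: nbhs_singleton; exact: inside_slab.
pose px := 2 * k * (z.1.1 - z'.1.1); pose py := 2 * k * (z.1.2 - z'.1.2).
pose q := 2 * l * (z.2 - z'.2).
pose P' := k1 + k2 * (n%:R * z.2 ^+ n.-1).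
pose lam := (N / (u z + kap + N)) ^+ 2.
have zQ : spacetime z by case: zI => _ /andP[h _] /andP[h' _]; split=> //; apply: lt_trans h; rewrite divr_gt0.
have zQ' : spacetime z' by case: zI' => _ /andP[h _] /andP[h' _]; split=> //; apply: lt_trans h; rewrite divr_gt0.
have Hsub a b g : 0 <= b -> gamma z.2 a b = g%:E ->
    P' + q + dot (drift c eta z.1 z.2 a b) (px, py) <= lam * g.
  pose A := fun y : R * R * R => k * ((y.1.1 - z'.1.1) ^+ 2 + (y.1.2 - z'.1.2) ^+ 2) +
    l * (y.2 - z'.2) ^+ 2 + (k1 * y.2 + k2 * y.2 ^+ n).
  have sA : smooth A _ _ _ := smooth_penalty k l k1 k2 n z'.
  have sQ := smoothD (smooth_cst (U z - A z)) sA.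
  have := subsolution_transform gamma_ok usub sQ zQ N0 (subrK (A z) (U z)).
  move=> /(_ _ a b g) h b0 gE; rewrite addrC [P' + q]addrC addrA.
  have := h _ b0 gE; rewrite -/px -/py -/q -/P' /= !add0r [_ + dot _ _]addrC addrA; apply.
  apply: filterS (inside_slab zI) => y yD; split; first exact: u0 (DQ _ yD).
  by have := maxz y yD; rewrite /doubled /A -/(U y) /P; clear -c_cont eta_cont gamma_ok; lra.
have Hsup e' : 0 < e' -> exists a b g, [/\ 0 <= b, gamma z'.2 a b = g%:E &
      - e' <= q + dot (drift c eta z'.1 z'.2 a b) (px, py) - g].
  move=> e'0.
  have sA := smooth_penalty (- k) (- l) 0 0 0 z.
  have [|a [b [g [b0 gE h]]]] := supersolution_touch gamma_ok wsup sA zQ' e'0.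
    apply: filterS (inside_slab zI') => y yD.
    by have := maxz' y yD; rewrite /doubled /W; clear -c_cont eta_cont gamma_ok; lra.
  exists a, b, g; split=> //; apply: (le_trans h); rewrite le_eqVlt; apply/orP; left.
  apply/eqP; congr (_ + dot _ (_, _) - _); rewrite /q /px /py; ring.
have T1 y : inside (K + 1) (d / 2) (T + 1) y ->
    [/\ 0 <= y.2 <= T + 1, `|y.1.1| <= K + 1 & 0 < y.1.2 <= K + 1].
  move=> [y1 /andP[y2 y2'] /andP[y3 y3']].
  split; [by rewrite (ltW y3) (ltW y3')|exact: ltW|rewrite (ltW y2') andbT].
  by apply: lt_trans y2; rewrite divr_gt0.
have [zt z1 z2] := T1 z zI; have [zt' z1' z2'] := T1 z' zI'.
have k20' : 0 <= 2 * k by rewrite mulr_ge0// ltW.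
have pxP : `|px| <= 2 * k * (2 * (K + 1)).
  rewrite normrM ger0_norm// ler_wpM2l// (le_trans (ler_normB _ _))//.
  by clear -c_cont eta_cont gamma_ok z1 z1'; lra.
have pyP : `|py| <= 2 * k * (2 * (K + 1)).
  rewrite normrM ger0_norm// ler_wpM2l// ler_norml.
  by clear -c_cont eta_cont gamma_ok z2 z2' K1; apply/andP; split; lra.
have lam0 : 0 <= lam by exact: sqr_ge0.
have uz1 := u1 _ (DQ _ zD).
have lamt : theta <= 1 - lam.
  have uN : 1 + N <= u z + kap + N by rewrite lerD2r.
  have uN0 : 0 < u z + kap + N by apply: lt_le_trans uN.
  rewrite lerD2l lerN2 /lam; apply: lerXn2r.
  - by rewrite nnegrE divr_ge0// ltW.
  - by rewrite nnegrE divr_ge0// ltW.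
  - by rewrite ler_pM2l// lef_pV2.
have lam1 : 0 <= lam <= 1.
  by rewrite lam0 /=; clear -c_cont eta_cont gamma_ok lamt theta0; lra.
have P'1 : k1 <= P' by rewrite lerDl !mulr_ge0// exprn_ge0//; case/andP: zt.
have P'0 : 0 <= P' by apply: le_trans P'1; exact: ltW.
have [a [b [g [b0 gE ineq]]]] :=
  Hr z.2 z'.2 z.1 z'.1 (px, py) q lam P' zt zt' tt z1 z2 z1' z2' pxP pyP lam1 P'0 Hsub Hsup.
have [_ et] := CE z.2 zt.
have := dot_drift_space c a (ltW k0) z2 z2' z1' et b0 (erefl (px, py)).
rewrite -/Cd; set kS' := k * _ in kS *.
have kS0 : 0 <= kS' by rewrite mulr_ge0 ?addr_ge0 ?sqr_ge0// ltW.
clearbody P' lam; have := HG z'.2 a b zt' b0; rewrite gE lee_fin mul1r.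
have : 0 <= g by have := gamma_ge0 gamma_ok a (andP zt').1 b0; rewrite gE lee_fin.
have n0 : 0 <= `|a| + b by rewrite addr_ge0.
move: (`|a| + b) n0 => nn n0 g0 gn diff.
have muo : Cd * kS' <= Cd * om by rewrite ler_wpM2l// ltW.
have Cdo : Cd * om = Num.min theta (k1 / (4 * (G + 1))) by rewrite /om mulrC divfK ?gt_eqF.
have [mut muk] : Cd * kS' <= theta /\ Cd * kS' <= k1 / (4 * (G + 1)).
  by split; apply: (le_trans muo); rewrite Cdo ge_min lexx ?orbT.
have mu0 : 0 <= Cd * kS' by rewrite mulr_ge0// ltW.
have e1 : Cd * kS' * nn <= Cd * kS' * (g + G).
  by rewrite ler_wpM2l//; clear -c_cont eta_cont gamma_ok gn; lra.
have e2 : Cd * kS' * g <= theta * g by rewrite ler_wpM2r.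
have e3 : Cd * kS' * G <= k1 / 4.
  have : Cd * kS' * (G + 1) <= k1 / (4 * (G + 1)) * (G + 1) by rewrite ler_wpM2r// ltW.
  have -> : k1 / (4 * (G + 1)) * (G + 1) = k1 / 4 by field; rewrite gt_eqF.
  by move: mu0; clear; lra.
have e4 : theta * g <= (1 - lam) * g by rewrite ler_wpM2r.
move: ineq diff e1 e2 e3 e4 P'1; clear -c_cont eta_cont gamma_ok k10.
move: (dot _ _ - dot _ _) (Cd * kS') (theta * g) ((1 - lam) * g) P' => X mu X1 X2 X3.
by clear -c_cont eta_cont gamma_ok k10; lra.
Qed.

End Comparison.

(** * Existence and uniqueness *)

Lemma locally_holder_continuous (R : realType) (h : R) (eta : R -> R) :
  0 < h -> locally_holder h eta -> {within `[0, +oo[, continuous eta}.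
Proof.
move=> h0 Heta; apply/within_continuousP => x; rewrite /= in_itv /= andbT => x0 e e0.
have [C HC] := Heta (x + 1) (ltr_wpDl x0 ltr01).
have C0 : 0 < `|C| + 1 by rewrite ltr_wpDl.
pose d := (e / (`|C| + 1)) `^ h^-1.
have d0 : 0 < d by rewrite powR_gt0// divr_gt0.
have dh : d `^ h = e / (`|C| + 1) by rewrite -powRrM mulVf ?gt_eqF// powRr1// divr_ge0// ltW.
exists (Num.min 1 d); first by rewrite lt_min ltr01.
move=> y; rewrite /= in_itv /= andbT => y0; rewrite lt_min => /andP[yx1 yxd].
have y1 : y \in `[0, x + 1].
  by rewrite in_itv /= y0; move: yx1; rewrite ltr_norml => /andP[_]; clear; lra.
have x1 : x \in `[0, x + 1] by rewrite in_itv /= x0 lerDl ler01.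
apply: (le_lt_trans (HC _ _ y1 x1)).
have p : `|y - x| `^ h < e / (`|C| + 1).
  by rewrite -dh gt0_ltr_powR// nnegrE// ltW.
apply: (@le_lt_trans _ _ ((`|C| + 1) * `|y - x| `^ h)).
  by rewrite ler_wpM2r ?powR_ge0// (le_trans (ler_norm _))// lerDl.
by move: p; rewrite ltr_pdivlMr// mulrC.
Qed.

Lemma continuous_tame (R : realType) (g : R -> R) :
  {within `[0, +oo[, continuous g} -> forall T, tame 0 T g.
Proof.
move=> cg T; apply: tame_cont; apply: continuous_subspaceW cg => r.
by rewrite /= !in_itv /= andbT => /andP[].
Qed.

Theorem theorem5p2 (R : realType) (c eta : R -> R)
    (gamma : R -> R -> R -> \bar R) (v0 : R * R -> \bar R)
    (c_cont : {within `[0, +oo[, continuous c})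
    (eta0 : eta 0 = 0)
    (eta_holder : forall h : R, 0 < h -> h < 1 / 2 -> locally_holder h eta)
    (gamma_ok : running_cost_assumptions gamma)
    (v0_ok : initial_cost_assumptions v0) :
  [/\ forall x t, halfplane x -> 0 <= t -> value c eta gamma v0 x t \is a fin_num,
      HJB_solution c eta gamma v0 (fun z => fine (value c eta gamma v0 z.1 z.2)) &
      forall u : R * R * R -> R, HJB_solution c eta gamma v0 u ->
        forall x t, halfplane x -> 0 <= t ->
          (u (x, t))%:E = value c eta gamma v0 x t].
Proof.
have q0 : (0 : R) < 1 / 4 by rewrite divr_gt0.
have q1 : (1 : R) / 4 < 1 / 2 by rewrite ltr_pM2l// ltf_pV2 ?posrE// ltr_nat.
have eta_cont := locally_holder_continuous q0 (eta_holder _ q0 q1).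
have c_tame := continuous_tame c_cont; have eta_tame := continuous_tame eta_cont.
have valueE x t := @valueE _ _ _ _ _ c_tame eta_tame gamma_ok v0_ok x t.
have v_sol : HJB_solution c eta gamma v0 (fun z => fine (value c eta gamma v0 z.1 z.2)).
  split=> [||x x0].
  - split; first exact: value_subsolution.
    exact: value_supersolution.
  - exact: value_class_Vloc.
  - by rewrite /= -valueE// value_initial.
split=> // [x t|u [[usub usup] uV u0] x t x0 t0]; first exact: value_fin.
have [[vsub vsup] vV vi] := v_sol.
have uv0 x' : halfplane x' -> u (x', 0) = fine (value c eta gamma v0 x' 0).
  by move=> x'0; apply/EFin_inj; rewrite u0// -vi.
have xtQ : spacetime0 (x, t) by [].
rewrite valueE//; congr EFin; apply/eqP; rewrite eq_le; apply/andP; split.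
  apply: (comparison c_cont eta_cont gamma_ok usub uV.1 vsup vV _ xtQ) => y y0.
  by rewrite uv0.
apply: (comparison c_cont eta_cont gamma_ok vsub vV.1 usup uV _ xtQ) => y y0.
by rewrite uv0.
Qed.
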